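(* Let $s>1$. Let $K\in\mathcal D_{0,s}'(\mathbf R^{2d})$, that is, $K\in\mathcal D_s'(\mathbf R^d\times\mathbf R^d)$ is the kernel of a positive semi-definite operator from $\mathcal D_s(\mathbf R^d)$ to $\mathcal D_s'(\mathbf R^d)$. Assume that there is some $\chi\in\mathcal D_s(\mathbf R^d)$ with $\chi(0)\neq 0$ such that $K_\chi\in\mathcal S_s'(\mathbf R^{2d})$, where $K_\chi(x,y)=\chi(x-y)K(x,y)$. Then $K\in\mathcal S_{0,s}'(\mathbf R^{2d})$, that is, $K\in\mathcal S_s'(\mathbf R^d\times\mathbf R^d)$ and its corresponding operator from $\mathcal S_s(\mathbf R^d)$ to $\mathcal S_s'(\mathbf R^d)$ is positive semi-definite.
   Context: Let $D=-i\partial$. Gelfand-Shilov spaces: for $s\ge 1/2$ and $h>0$, $\mathcal S_{s,h}(\mathbf R^n)$ is the set of $\varphi\in C^\infty(\mathbf R^n)$ such that $\|\varphi\|_{\mathcal S_{s,h}}=\sup_{\alpha,\beta\in\mathbf N^n}\sup_{x}\frac{|x^\alpha D^\beta\varphi(x)|}{(\alpha!\beta!)^s h^{|\alpha+\beta|}}<\infty$. The space $\mathcal S_s(\mathbf R^n)$ is the inductive limit of $\mathcal S_{s,h}(\mathbf R^n)$ as $h\to\infty$, and $\mathcal S_s'(\mathbf R^n)$ is its dual. Gevrey test functions: for $s>1$, an open set $\Omega\subset\mathbf R^n$ and a compact set $K_0\subset\Omega$, $\mathcal D_{s,h}(K_0)$ is the set of $\varphi\in C^\infty(\mathbf R^n)$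 with support in $K_0$ and $\sup_{\beta}\sup_{x\in K_0}\frac{|D^\beta\varphi(x)|}{(\beta!)^s h^{|\beta|}}<\infty$. The space $\mathcal D_s(\Omega)$ is the inductive limit over $h\to\infty$ and over an exhausting sequence of compact sets in $\Omega$, and $\mathcal D_s'(\Omega)$ is its dual (ultradistributions of Roumieu type of order $s$). Since $\mathcal D_s$ is dense in $\mathcal S_s$ for $s>1$, $\mathcal S_s'$ is regarded as a subspace of $\mathcal D_s'$. $(\cdot,\cdot)$ denotes the sesquilinear duality extending the $L^2$ scalar product. By the kernel theorem, each $K\in\mathcal D_s'(\Omega\times\Omega)$ defines a linear continuous operator $T_K:\mathcal D_s(\Omega)\to\mathcal D_s'(\Omega)$ by $(T_K\varphi_1,\varphi_2)=(K,\varphi_2\otimes\overline{\varphi_1})$. In the same way, each $K\in\mathcal S_s'(\mathbf R^{d}\times\mathbf R^d)$ defines a linear continuous operator $T_K:\mathcal S_s(\mathbf R^d)\to\mathcal S_s'(\mathbf R^d)$. The operator $T_K$ is positive semi-definite if $(T_K\varphi,\varphi)\ge0$ for every $\varphi$ in $\mathcal D_s(\Omega)$, respectively in $\mathcal S_s(\mathbf R^d)$. $\mathcal D_{0,s}'(\Omega\times\Omega)$ ($s>1$) is the set of $K\in\mathcal D_s'(\Omega\times\Omega)$ with $T_K$ positive semi-definite on $\mathcal D_s(\Omega)$. $\mathcal S_{0,s}'(\mathbf R^d\times\mathbf R^d)$ ($s\ge1/2$) is the set of $K\in\mathcal S_s'(\mathbf R^d\times\mathbf R^d)$ with $T_K$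 positive semi-definite on $\mathcal S_s(\mathbf R^d)$. *)

(* Defs.v *)
From HB Require Import structures.
From mathcomp Require Import all_boot all_order all_algebra.
From mathcomp Require Import all_classical all_reals all_analysis.
From mathcomp Require Import complex.

Set Implicit Arguments.
Unset Strict Implicit.
Unset Printing Implicit Defensive.

Import Order.TTheory GRing.Theory Num.Theory.
Import numFieldNormedType.Exports.
Import Normc.

Local Open Scope classical_set_scope.
Local Open Scope ring_scope.

Section Calculus.
Variables (R : realType) (n : nat).
Implicit Types (i : 'I_n) (a b : 'I_n -> nat).

(* Derivatives of complex-valued functions on R^n are taken on the real and
   imaginary parts, since R[i] is not a normed R-module in the library. *)
Definition re_part (f : 'rV[R]_n -> R[i]) : 'rV[R]_n -> R :=
  fun x => complex.Re (f x).
Definition im_part (f : 'rV[R]_n -> R[i]) : 'rV[R]_n -> R :=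
  fun x => complex.Im (f x).

Definition partial i (g : 'rV[R]_n -> R) : 'rV[R]_n -> R :=
  fun x => 'D_(delta_mx 0 i) g x.

Definition smooth_real (g : 'rV[R]_n -> R) : Prop :=
  forall l : seq 'I_n, let gl := foldr partial g l in
    continuous gl /\ forall i x, derivable gl x (delta_mx 0 i).

Definition smooth (f : 'rV[R]_n -> R[i]) : Prop :=
  smooth_real (re_part f) /\ smooth_real (im_part f).

(* D = -i \partial *)
Definition Dop i (f : 'rV[R]_n -> R[i]) : 'rV[R]_n -> R[i] :=
  fun x => - 'i%C * Complex (partial i (re_part f) x) (partial i (im_part f) x).

Definition Dpow b (f : 'rV[R]_n -> R[i]) : 'rV[R]_n -> R[i] :=
  foldr (fun i => iter (b i) (Dop i)) f (enum 'I_n).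

Definition monom (x : 'rV[R]_n) a : R := \prod_(i < n) x 0 i ^+ a i.
Definition mfact a : nat := (\prod_(i < n) (a i)`!)%N.
Definition mlen a : nat := (\sum_(i < n) a i)%N.

End Calculus.

(* The locally convex inductive limit of the spaces [E i], i in [ix], of
   complex-valued functions on X, each one normed by [p i]. *)
Section InductiveLimit.
Variables (R : realType) (X I : Type) (ix : set I).
Variables (E : I -> set (X -> R[i])) (p : I -> (X -> R[i]) -> \bar R).

Definition indlim : set (X -> R[i]) := \bigcup_(i in ix) E i.

Definition absolutely_convex (W : set (X -> R[i])) : Prop :=
  forall f g (a b : R[i]), W f -> W g -> normc a + normc b <= 1 ->
    W (fun x => a * f x + b * g x).

Definition indlim_nbhs0 (U : set (X -> R[i])) : Prop :=
  exists W : set (X -> R[i]),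
    [/\ absolutely_convex W, W `<=` U &
        forall i, ix i -> exists2 e : R, 0 < e &
          forall f, E i f -> (p i f < e%:E)%E -> W f].

(* A functional is a total function of which only the values on [indlim]
   matter: it is linear and continuous there, and arbitrary elsewhere. *)
Definition indlim_dual (u : (X -> R[i]) -> R[i]) : Prop :=
  (forall (a : R[i]) f g, indlim f -> indlim g ->
     u (fun x => a * f x + g x) = a * u f + u g) /\
  (forall e : R, 0 < e -> indlim_nbhs0 (indlim `&` [set f | normc (u f) < e])).

End InductiveLimit.

Section Spaces.
Variables (R : realType) (n : nat) (s : R).
Implicit Types (f : 'rV[R]_n -> R[i]) (h : R).

Definition GS_norm h f : \bar R :=
  ereal_sup [set r | exists (a b : 'I_n -> nat) (x : 'rV[R]_n),
    r = (normc ((monom x a)%:C%C * Dpow b f x) /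
         (((mfact a * mfact b)%:R `^ s) * h ^+ (mlen a + mlen b)))%:E].

Definition GS_step h : set ('rV[R]_n -> R[i]) :=
  [set f | smooth f /\ (GS_norm h f < +oo)%E].

Definition GS_index : set R := [set h | 0 < h].

Definition GS : set ('rV[R]_n -> R[i]) := indlim GS_index GS_step.

Definition GS_dual : set (('rV[R]_n -> R[i]) -> R[i]) :=
  indlim_dual GS_index GS_step GS_norm.

Definition Gevrey_norm (j : R * set 'rV[R]_n) f : \bar R :=
  ereal_sup [set r | exists (b : 'I_n -> nat) (x : 'rV[R]_n), j.2 x /\
    r = (normc (Dpow b f x) /
         (((mfact b)%:R `^ s) * j.1 ^+ mlen b))%:E].

Definition Gevrey_step (j : R * set 'rV[R]_n) : set ('rV[R]_n -> R[i]) :=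
  [set f | [/\ smooth f, closure [set x | f x != 0] `<=` j.2 &
               (Gevrey_norm j f < +oo)%E]].

(* All compact sets are used instead of an exhausting sequence: any such
   sequence is cofinal, so the inductive limit is the same. *)
Definition Gevrey_index : set (R * set 'rV[R]_n) :=
  [set j | 0 < j.1 /\ compact j.2].

Definition Gevrey : set ('rV[R]_n -> R[i]) :=
  indlim Gevrey_index Gevrey_step.

Definition Gevrey_dual : set (('rV[R]_n -> R[i]) -> R[i]) :=
  indlim_dual Gevrey_index Gevrey_step Gevrey_norm.

(* The embedding of the dual of GS into the dual of Gevrey is restriction, so
   "K belongs to the dual of GS" means that K is the restriction to Gevrey of
   some L in the dual of GS (unique by density). *)
Definition restricts_to (L K : ('rV[R]_n -> R[i]) -> R[i]) : Prop :=
  forall f, Gevrey f -> L f = K f.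

Definition in_GS_dual (K : ('rV[R]_n -> R[i]) -> R[i]) : Prop :=
  exists2 L, GS_dual L & restricts_to L K.

End Spaces.

Section Kernels.
Variable R : realType.

(* [u f] is the bilinear pairing <u, f>; this is the sesquilinear one (u, f). *)
Definition pairing (X : Type) (u : (X -> R[i]) -> R[i]) (f : X -> R[i]) : R[i] :=
  u (fun x => (f x)^*%C).

Definition tensor (m n : nat) (f : 'rV[R]_m -> R[i]) (g : 'rV[R]_n -> R[i]) :
    'rV[R]_(m + n) -> R[i] :=
  fun z => f (lsubmx z) * g (rsubmx z).

(* Points of R^d x R^d are row vectors of size d + d. *)
Definition kernel_op (d : nat) (K : ('rV[R]_(d + d) -> R[i]) -> R[i])
    (f : 'rV[R]_d -> R[i]) : ('rV[R]_d -> R[i]) -> R[i] :=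
  fun g => K (tensor g f).

(* (T_K f1, f2) = (K, f2 \otimes \overline{f1}) *)
Lemma pairing_kernel_op (d : nat) (K : ('rV[R]_(d + d) -> R[i]) -> R[i])
    (f1 f2 : 'rV[R]_d -> R[i]) :
  pairing (kernel_op K f1) f2 =
  pairing K (tensor f2 (fun y => (f1 y)^*%C)).
Proof.
rewrite /pairing /kernel_op; congr K; apply: funext => z.
by rewrite /tensor rmorphM /= conjcK.
Qed.

Definition positive_semidefinite (d : nat) (F : set ('rV[R]_d -> R[i]))
    (K : ('rV[R]_(d + d) -> R[i]) -> R[i]) : Prop :=
  forall f, F f -> 0 <= pairing (kernel_op K f) f.

Definition Gevrey_dual_psd (d : nat) (s : R) :
    set (('rV[R]_(d + d) -> R[i]) -> R[i]) :=
  [set K | Gevrey_dual s K /\ positive_semidefinite (Gevrey s) K].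

Definition GS_dual_psd (d : nat) (s : R) :
    set (('rV[R]_(d + d) -> R[i]) -> R[i]) :=
  [set K | GS_dual s K /\ positive_semidefinite (GS s) K].

Definition mult_diff (d : nat) (chi : 'rV[R]_d -> R[i])
    (K : ('rV[R]_(d + d) -> R[i]) -> R[i]) :
    ('rV[R]_(d + d) -> R[i]) -> R[i] :=
  fun f => K (fun z => chi (lsubmx z - rsubmx z) * f z).

End Kernels.

(* Main.v *)
From HB Require Import structures.
Require Import Defs.
From mathcomp Require Import all_boot all_order all_algebra.
From mathcomp Require Import all_classical all_reals all_analysis.
From mathcomp Require Import complex.
From mathcomp Require Import zify ring lra.

(** A bound for K near the diagonal propagates to the whole space, by positivity.
    Near the diagonal, K can be recovered from the kernel K_chi that was cut off:
    if u := 1 - chi (x - y) / chi 0, then K F = K_chi F / chi 0 + K (F u), and u is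
    small where x - y is small, so that K F is the sum of the Neumann series of
    terms K_chi (F u^j) / chi 0. This bounds K on functions located in a small
    diagonal cell by a Gelfand-Shilov norm ([diagonal_bound]). Positivity of K
    gives the Cauchy-Schwarz inequality for the form (f, g) |-> K (f^* (x) g), and
    a product of two functions located in two distant cells is then bounded by two
    products located in diagonal cells ([atom_bound]).

    To exploit this, a function is expanded in functions of that kind. A Gevrey
    partition of unity, which is made out of chi ([profile_exists]), cuts it into
    pieces located in cells of side proportional to delta, and each piece is
    replaced by its trigonometric interpolation on a finite grid, cut off again.
    The result [approx M f] is a finite linear combination of Gevrey functions,
    the atoms, also when f is only in the Gelfand-Shilov space, so that K applies
    to it term by term. The coefficients are discrete Fourier coefficients;
    summation by parts ([fourier_decay]) shows that they decay in the number k of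
    the cell and in the frequency m like the inverses of the weights that dominate
    K on the atom of indices k and m, with room to sum them ([coef_l1]). Hence
    K (approx M f) is bounded by a norm of f, uniformly in M
    ([kernel_approx_bound]).

    The extension of K maps f to the limit of K (approx M f) along an ultrafilter,
    which spares the proof of convergence ([extension]). It is continuous by the
    uniform bound. It is an extension because approx M f tends to f in the Gevrey
    space if f belongs to it: the difference vanishes on a fine grid and all its
    derivatives are bounded uniformly in M, so that it tends to 0 uniformly, and
    so do its derivatives by Landau's inequality ([approx_converges]). It is
    positive because approximation maps f^* (x) f to g^* (x) g, where g is the
    approximation of f ([approxJ], [approx_tensor]). Dimension 0, in which there
    is no coordinate line to build the partition of unity on, is trivial
    ([extension0]). *)

Set Implicit Arguments.
Unset Strict Implicit.
Unset Printing Implicit Defensive.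

Import Order.TTheory GRing.Theory Num.Theory.
Import numFieldNormedType.Exports.
Import Normc.

Local Open Scope classical_set_scope.
Local Open Scope ring_scope.

(** * Complex-valued differential calculus *)

Section ComplexNorm.
Variable R : realType.
Implicit Types z w : R[i].

Lemma ReD z w : complex.Re (z + w) = complex.Re z + complex.Re w.
Proof. by case: z; case: w. Qed.
Lemma ImD z w : complex.Im (z + w) = complex.Im z + complex.Im w.
Proof. by case: z; case: w. Qed.
Lemma ReM z w : complex.Re (z * w) =
  complex.Re z * complex.Re w - complex.Im z * complex.Im w.
Proof. by case: z; case: w. Qed.
Lemma ImM z w : complex.Im (z * w) =
  complex.Re z * complex.Im w + complex.Im z * complex.Re w.
Proof. by case: z; case: w. Qed.

Lemma ReJ z : complex.Re z^*%C = complex.Re z.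
Proof. by case: z. Qed.
Lemma ImJ z : complex.Im z^*%C = - complex.Im z.
Proof. by case: z. Qed.

Lemma normc_ge0 z : 0 <= normc z.
Proof. by case: z => a b /=; exact: sqrtr_ge0. Qed.

Lemma normcX z k : normc (z ^+ k) = normc z ^+ k.
Proof.
elim: k => [|k IH]; first by rewrite !expr0 normc1.
by rewrite !exprS normcM IH.
Qed.

Lemma normcJc z : normc z^*%C = normc z.
Proof. by case: z => a b /=; rewrite sqrrN. Qed.

Lemma Re_le_normc z : `|complex.Re z| <= normc z.
Proof.
case: z => a b /=; rewrite -sqrtr_sqr ler_sqrt ?addr_ge0 ?sqr_ge0 //.
by rewrite lerDl sqr_ge0.
Qed.

Lemma Im_le_normc z : `|complex.Im z| <= normc z.
Proof.
case: z => a b /=; rewrite -sqrtr_sqr ler_sqrt ?addr_ge0 ?sqr_ge0 //.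
by rewrite lerDr sqr_ge0.
Qed.

Lemma normc_le_ReIm z : normc z <= `|complex.Re z| + `|complex.Im z|.
Proof.
case: z => a b /=; rewrite -[leRHS]ger0_norm ?addr_ge0 // -sqrtr_sqr.
rewrite ler_sqrt ?sqr_ge0 // sqrrD !real_normK ?num_real // lerD2r lerDl.
by rewrite mulrn_wge0 // mulr_ge0.
Qed.

Lemma normc_real (a : R) : normc (a%:C)%C = `|a|.
Proof. by rewrite /= expr0n /= addr0 sqrtr_sqr. Qed.

Lemma normc_sum (I : Type) (r : seq I) (P : pred I) (F : I -> R[i]) :
  normc (\sum_(i <- r | P i) F i) <= \sum_(i <- r | P i) normc (F i).
Proof.
elim/big_ind2: _ => [|z a w b h1 h2|//]; first by rewrite normc0.
by apply: le_trans (le_normcD _ _) _; exact: lerD.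
Qed.

Lemma normc_prod (I : Type) (r : seq I) (P : pred I) (F : I -> R[i]) :
  normc (\prod_(i <- r | P i) F i) = \prod_(i <- r | P i) normc (F i).
Proof.
elim/big_rec2: _ => [|i a z _ <-]; first by rewrite normc1.
by rewrite normcM.
Qed.

Lemma normcB_sym z w : normc (z - w) = normc (w - z).
Proof. by rewrite -(normcN (w - z)) opprB. Qed.

End ComplexNorm.

Section ComplexDerivative.
Variable R : realType.

Lemma is_derive_affine (U V W : normedModType R) (f : W -> U) (A : V -> W)
    (x v : V) (w : W) (df : U) :
  (forall h : R, A (h *: v + x) = h *: w + A x) ->
  is_derive (A x) w f df -> is_derive x v (fun y => f (A y)) df.
Proof.
move=> hA [hd hv].
have E : (fun h : R => h^-1 *: (((fun y => f (A y)) \o shift x) (h *: v) - f (A x)))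
   = (fun h : R => h^-1 *: ((f \o shift (A x)) (h *: w) - f (A x))).
  by apply: funext => h /=; rewrite hA.
split.
- by rewrite /derivable E; exact: hd.
- by rewrite /derive E; exact: hv.
Qed.

Section Line.
Variable V : normedModType R.
Implicit Types (x v : V) (f g : V -> R[i]) (a b c : R[i]).

Definition cder x v f a :=
  is_derive x v (fun y => complex.Re (f y)) (complex.Re a) /\
  is_derive x v (fun y => complex.Im (f y)) (complex.Im a).

Lemma cder_eq x v f a b : a = b -> cder x v f a -> cder x v f b.
Proof. by move=> ->. Qed.

Lemma cder_cst x v c : cder x v (fun=> c) 0.
Proof. by split; exact: is_derive_cst. Qed.

Lemma cderD x v f g a b :
  cder x v f a -> cder x v g b -> cder x v (fun y => f y + g y) (a + b).
Proof.
move=> [h1 h2] [h3 h4]; split.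
- under eq_fun do rewrite ReD; rewrite ReD; exact: is_deriveD.
- under eq_fun do rewrite ImD; rewrite ImD; exact: is_deriveD.
Qed.

Lemma cderM x v f g a b : cder x v f a -> cder x v g b ->
  cder x v (fun y => f y * g y) (a * g x + f x * b).
Proof.
move=> [h1 h2] [h3 h4]; split.
- under eq_fun do rewrite ReM.
  apply: (is_derive_eq (is_deriveB (is_deriveM h1 h3) (is_deriveM h2 h4))).
  by rewrite ReD !ReM /GRing.scale /=; ring.
- under eq_fun do rewrite ImM.
  apply: (is_derive_eq (is_deriveD (is_deriveM h1 h4) (is_deriveM h2 h3))).
  by rewrite ImD !ImM /GRing.scale /=; ring.
Qed.

Lemma cderZ x v c f a : cder x v f a -> cder x v (fun y => c * f y) (c * a).
Proof.
move=> hf; apply: cder_eq (cderM (cder_cst x v c) hf).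
by rewrite mul0r add0r.
Qed.

Lemma cder_sum (I : Type) (r : seq I) x v (F : I -> V -> R[i]) (G : I -> R[i]) :
  (forall i, cder x v (F i) (G i)) ->
  cder x v (fun y => \sum_(i <- r) F i y) (\sum_(i <- r) G i).
Proof.
move=> h; elim: r => [|i r IH].
  rewrite big_nil; under eq_fun do rewrite big_nil; exact: cder_cst.
rewrite big_cons; under eq_fun do rewrite big_cons.
exact: cderD.
Qed.

Lemma cderJ x v f a : cder x v f a -> cder x v (fun y => (f y)^*%C) a^*%C.
Proof.
move=> [h1 h2]; split.
- by under eq_fun do rewrite ReJ; rewrite ReJ.
- under eq_fun do rewrite ImJ; rewrite ImJ; exact: is_deriveN.
Qed.

End Line.

Lemma cder_affine (V W : normedModType R) (f : W -> R[i]) (A : V -> W)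
    (x v : V) (w : W) (a : R[i]) :
  (forall h : R, A (h *: v + x) = h *: w + A x) ->
  cder (A x) w f a -> cder x v (fun y => f (A y)) a.
Proof.
by move=> hA [h1 h2]; split; [apply: (is_derive_affine hA h1)|
  apply: (is_derive_affine hA h2)].
Qed.

Lemma cder_scale (V : normedModType R) (f : V -> R[i]) (x v : V) (c : R) a :
  cder x v f a -> cder x (c *: v) f ((c%:C)%C * a).
Proof.
move=> [h1 h2].
have key (g : V -> R) (b : R) : is_derive x v g b -> is_derive x (c *: v) g (c * b).
  move=> hg.
  have [->|c0] := eqVneq c 0; first by rewrite scale0r mul0r; exact: is_derive0.
  have h : is_derive (0:R) (1:R) (fun t : R => g (t *: v + x)) b.
    apply: (@is_derive_affine _ _ _ g (fun t : R => t *: v + x) 0 1 v).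
      by move=> h; rewrite scale0r add0r addr0 /GRing.scale /= mulr1.
    by rewrite scale0r add0r.
  have h' : is_derive (0:R) (1:R) (fun t : R => g ((c * t) *: v + x)) (b * c).
    apply: (@is_derive1_comp _ (fun t : R => g (t *: v + x)) (fun t => c * t)).
      by rewrite mulr0.
    have := @is_deriveZ R R R id c 0 1 1 (is_derive_id _ _).
    by rewrite /GRing.scale /= mulr1.
  have [hd hv] := h'.
  have E : (fun h : R => h^-1 *: ((g \o shift x) (h *: (c *: v)) - g x)) =
           (fun h : R => h^-1 *: (((fun t : R => g ((c * t) *: v + x)) \o shift 0) (h *: 1)
                        - (fun t : R => g ((c * t) *: v + x)) 0)).
    apply: funext => h0 /=; rewrite addr0 mulr0 scale0r add0r scalerA.
    by rewrite [h0 *: 1]mulr1 [h0 * c]mulrC.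
  split; first by rewrite /derivable E; exact: hd.
  by rewrite /derive E [RHS]mulrC; exact: hv.
by split; rewrite ?ReM ?ImM /= mul0r ?subr0 ?addr0; apply: key.
Qed.

End ComplexDerivative.

Section Smooth.
Variables (R : realType) (n : nat).
Implicit Types (f g : 'rV[R]_n -> R[i]) (i j : 'I_n) (l : seq 'I_n).

Definition cpart i f : 'rV[R]_n -> R[i] :=
  fun x => Complex (partial i (re_part f) x) (partial i (im_part f) x).

Definition ccont (T : topologicalType) (f : T -> R[i]) :=
  continuous (fun x => complex.Re (f x)) /\ continuous (fun x => complex.Im (f x)).

Lemma cpartE i f x a : cder x (delta_mx 0 i) f a -> cpart i f x = a.
Proof.
move=> [h1 h2]; rewrite /cpart /partial (@derive_val _ _ _ _ _ _ _ h1).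
by rewrite (@derive_val _ _ _ _ _ _ _ h2); case: (a).
Qed.

(** Smoothness is coinductive: it is enough to exhibit a class of continuous
    functions that is closed under partial derivatives. *)
Lemma smooth_coind (S : set ('rV[R]_n -> R[i])) :
  (forall f, S f -> ccont f /\ forall i, exists2 f', S f' &
      forall x, cder x (delta_mx 0 i) f (f' x)) ->
  forall f, S f -> smooth f.
Proof.
move=> hS f Sf.
suff key l : exists2 g, S g & foldr (@partial R n) (re_part f) l = re_part g /\
   foldr (@partial R n) (im_part f) l = im_part g.
  by split => l; have [g /hS[[c1 c2] hd] [E1 E2]] := key l; rewrite /= ?E1 ?E2;
    split => // i x; have [f' _ /(_ x)[[h1 _] [h2 _]]] := hd i; [exact: h1|exact: h2].
elim: l => [|i l [g Sg [E1 E2]]]; first by exists f.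
have [_ /(_ i)[f' Sf' hf']] := hS _ Sg.
exists f' => //=; rewrite E1 E2; split; apply: funext => x;
  have [h1 h2] := hf' x.
- exact: (@derive_val _ _ _ _ _ _ _ h1).
- exact: (@derive_val _ _ _ _ _ _ _ h2).
Qed.

Lemma smooth_ccont f : smooth f -> ccont f.
Proof. by move=> [h1 h2]; split; [have [] := h1 [::]|have [] := h2 [::]]. Qed.

Lemma smooth_cder f i x : smooth f -> cder x (delta_mx 0 i) f (cpart i f x).
Proof.
move=> [h1 h2]; split; apply: derivableP.
- by have [_ /(_ i x)] := h1 [::].
- by have [_ /(_ i x)] := h2 [::].
Qed.

Lemma smooth_cpart f i : smooth f -> smooth (cpart i f).
Proof.
move=> [h1 h2]; split => l.
- by have := h1 (rcons l i); rewrite foldr_rcons.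
- by have := h2 (rcons l i); rewrite foldr_rcons.
Qed.

Lemma ccont_cst (T : topologicalType) (c : R[i]) : ccont (fun _ : T => c).
Proof. by split => x; exact: cst_continuous. Qed.

Lemma ccontD (T : topologicalType) (f g : T -> R[i]) :
  ccont f -> ccont g -> ccont (fun x => f x + g x).
Proof.
move=> [h1 h2] [h3 h4]; split => x.
- under eq_fun do rewrite ReD; apply: cvgD; [exact: h1|exact: h3].
- under eq_fun do rewrite ImD; apply: cvgD; [exact: h2|exact: h4].
Qed.

Lemma ccontM (T : topologicalType) (f g : T -> R[i]) :
  ccont f -> ccont g -> ccont (fun x => f x * g x).
Proof.
move=> [h1 h2] [h3 h4]; split => x.
- under eq_fun do rewrite ReM; apply: cvgB; apply: cvgM;
    [exact: h1|exact: h3|exact: h2|exact: h4].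
- under eq_fun do rewrite ImM; apply: cvgD; apply: cvgM;
    [exact: h1|exact: h4|exact: h2|exact: h3].
Qed.

Lemma ccontJ (T : topologicalType) (f : T -> R[i]) :
  ccont f -> ccont (fun x => (f x)^*%C).
Proof.
move=> [h1 h2]; split => x.
- by under eq_fun do rewrite ReJ; exact: h1.
- by under eq_fun do rewrite ImJ; apply: cvgN; exact: h2.
Qed.

(** The algebra with conjugation generated by the smooth functions is stable
    under partial derivatives, so it consists of smooth functions. *)
Inductive smooth_gen : ('rV[R]_n -> R[i]) -> Prop :=
| smooth_gen_base f : smooth f -> smooth_gen f
| smooth_gen_cst c : smooth_gen (fun=> c)
| smooth_genD f g : smooth_gen f -> smooth_gen g -> smooth_gen (fun x => f x + g x)
| smooth_genM f g : smooth_gen f -> smooth_gen g -> smooth_gen (fun x => f x * g x)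
| smooth_genJ f : smooth_gen f -> smooth_gen (fun x => (f x)^*%C).

Lemma smooth_genP f : smooth_gen f -> smooth f.
Proof.
apply: smooth_coind => {}f; elim=> {f}
  [f sf|c|f g _ [cf df] _ [cg dg]|f g Gf [cf df] Gg [cg dg]|f _ [cf df]].
- split; first exact: smooth_ccont.
  move=> i; exists (cpart i f); last by move=> x; exact: smooth_cder.
  by apply: smooth_gen_base; exact: smooth_cpart.
- split; first exact: ccont_cst.
  move=> i; exists (fun=> 0); first exact: smooth_gen_cst.
  by move=> x; exact: cder_cst.
- split; first exact: ccontD.
  move=> i; have [f' ? ?] := df i; have [g' ? ?] := dg i.
  exists (fun x => f' x + g' x); first exact: smooth_genD.
  by move=> x; exact: cderD.
- split; first exact: ccontM.
  move=> i; have [f' ? ?] := df i; have [g' ? ?] := dg i.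
  exists (fun x => f' x * g x + f x * g' x); last by move=> x; exact: cderM.
  by apply: smooth_genD; exact: smooth_genM.
- split; first exact: ccontJ.
  move=> i; have [f' ? ?] := df i.
  exists (fun x => (f' x)^*%C); first exact: smooth_genJ.
  by move=> x; exact: cderJ.
Qed.

Lemma smooth_cst c : smooth (fun _ : 'rV[R]_n => c).
Proof. exact: smooth_genP (smooth_gen_cst c). Qed.

Lemma smoothD f g : smooth f -> smooth g -> smooth (fun x => f x + g x).
Proof.
move=> sf sg.
exact: smooth_genP (smooth_genD (smooth_gen_base sf) (smooth_gen_base sg)).
Qed.

Lemma smoothM f g : smooth f -> smooth g -> smooth (fun x => f x * g x).
Proof.
move=> sf sg.
exact: smooth_genP (smooth_genM (smooth_gen_base sf) (smooth_gen_base sg)).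
Qed.

Lemma smoothJ f : smooth f -> smooth (fun x => (f x)^*%C).
Proof. move=> sf; exact: smooth_genP (smooth_genJ (smooth_gen_base sf)). Qed.

Lemma smoothZ c f : smooth f -> smooth (fun x => c * f x).
Proof. exact: smoothM (smooth_cst c). Qed.

Opaque smooth cpart.

Lemma smooth_sum (I : Type) (r : seq I) (F : I -> 'rV[R]_n -> R[i]) :
  (forall k, smooth (F k)) -> smooth (fun x => \sum_(k <- r) F k x).
Proof.
move=> h; elim: r => [|k r IH].
  under eq_fun do rewrite big_nil; exact: smooth_cst.
under eq_fun do rewrite big_cons; exact: (smoothD (h k) IH).
Qed.

(** Iterated partial derivatives; they differ from [Dpow] by the unimodular
    factors carried by [Dop], see [normc_Dpow]. *)
Definition Cl l f := foldr cpart f l.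

Lemma ClE i l f : Cl (i :: l) f = cpart i (Cl l f).
Proof. by []. Qed.

Lemma smooth_Cl l f : smooth f -> smooth (Cl l f).
Proof.
move=> sf; elim: l => [|i l IH]; first exact: sf.
rewrite ClE; exact: smooth_cpart.
Qed.

Lemma Cl_cat l1 l2 f : Cl (l1 ++ l2) f = Cl l1 (Cl l2 f).
Proof. by rewrite /Cl foldr_cat. Qed.

Lemma Cl_rcons l i f : Cl (rcons l i) f = Cl l (cpart i f).
Proof. by rewrite /Cl foldr_rcons. Qed.

Lemma cpartD i f g : smooth f -> smooth g ->
  cpart i (fun x => f x + g x) = (fun x => cpart i f x + cpart i g x).
Proof.
by move=> sf sg; apply: funext => x; apply/cpartE/cderD; exact: smooth_cder.
Qed.

Lemma cpartM i f g : smooth f -> smooth g ->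
  cpart i (fun x => f x * g x) = (fun x => cpart i f x * g x + f x * cpart i g x).
Proof.
by move=> sf sg; apply: funext => x; apply/cpartE/cderM; exact: smooth_cder.
Qed.

Lemma cpartZ i c f : smooth f ->
  cpart i (fun x => c * f x) = (fun x => c * cpart i f x).
Proof.
by move=> sf; apply: funext => x; apply/cpartE/cderZ; exact: smooth_cder.
Qed.

Lemma cpartJ i f : smooth f ->
  cpart i (fun x => (f x)^*%C) = (fun x => (cpart i f x)^*%C).
Proof.
by move=> sf; apply: funext => x; apply/cpartE/cderJ; exact: smooth_cder.
Qed.

Lemma cpart_sum i (I : Type) (r : seq I) (F : I -> 'rV[R]_n -> R[i]) :
  (forall k, smooth (F k)) ->
  cpart i (fun x => \sum_(k <- r) F k x) = (fun x => \sum_(k <- r) cpart i (F k) x).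
Proof.
move=> sF; apply: funext => x; apply/cpartE/cder_sum => k; exact: smooth_cder.
Qed.

Lemma ClD l f g : smooth f -> smooth g ->
  Cl l (fun x => f x + g x) = (fun x => Cl l f x + Cl l g x).
Proof.
move=> sf sg; elim: l => [|i l IH]; first by [].
by rewrite !ClE IH (cpartD i (smooth_Cl l sf) (smooth_Cl l sg)).
Qed.

Lemma ClZ l c f : smooth f -> Cl l (fun x => c * f x) = (fun x => c * Cl l f x).
Proof.
move=> sf; elim: l => [|i l IH]; first by [].
by rewrite !ClE IH (cpartZ i c (smooth_Cl l sf)).
Qed.

Lemma ClJ l f : smooth f ->
  Cl l (fun x => (f x)^*%C) = (fun x => (Cl l f x)^*%C).
Proof.
move=> sf; elim: l => [|i l IH]; first by [].
by rewrite !ClE IH (cpartJ i (smooth_Cl l sf)).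
Qed.

Lemma Cl_sum l (I : Type) (r : seq I) (F : I -> 'rV[R]_n -> R[i]) :
  (forall k, smooth (F k)) ->
  Cl l (fun x => \sum_(k <- r) F k x) = (fun x => \sum_(k <- r) Cl l (F k) x).
Proof.
move=> sF; elim: l => [|i l IH]; first by [].
by rewrite ClE IH (cpart_sum i r (fun k => smooth_Cl l (sF k))).
Qed.

Definition mlist (b : 'I_n -> nat) := flatten [seq nseq (b i) i | i <- enum 'I_n].

Lemma count_mlist b i : count_mem i (mlist b) = b i.
Proof.
rewrite /mlist count_flatten -map_comp sumnE big_map big_enum /=.
rewrite (bigD1 i) //= count_nseq /= eqxx mul1n big1 ?addn0 // => j ji.
by rewrite count_nseq /= (negbTE ji).
Qed.

Lemma size_counts l : size l = (\sum_(i < n) count_mem i l)%N.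
Proof.
elim: l => [|j l IH] /=; first by rewrite big1.
rewrite big_split /= -IH (bigD1 j) //= eqxx big1 // => i ij.
by rewrite eq_sym (negbTE ij).
Qed.

Lemma normc_Dpow b f x : smooth f -> normc (Dpow b f x) = normc (Cl (mlist b) f x).
Proof.
move=> sf.
have Dop_cpart i g : Dop i g = (fun x => - 'i%C * cpart i g x) by [].
have key l : foldr (@Dop R n) f l = (fun x => (- 'i%C) ^+ size l * Cl l f x).
  elim: l => [|i l IH] /=; first by apply: funext => y; rewrite mul1r.
  rewrite IH Dop_cpart cpartZ; last exact: smooth_Cl.
  by apply: funext => y; rewrite exprS -mulrA.
have -> : Dpow b f = foldr (@Dop R n) f (mlist b).
  rewrite /Dpow /mlist; elim: (enum _) => //= i r ->.
  by rewrite foldr_cat; elim: (b i) => //= k ->.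
rewrite key normcM normcX normcN.
by rewrite /= expr0n /= add0r expr1n sqrtr1 expr1n mul1r.
Qed.

Lemma Cl_locally0 (U : set 'rV[R]_n) l f : open U -> smooth f ->
  (forall x, U x -> f x = 0) -> forall x, U x -> Cl l f x = 0.
Proof.
move=> oU sf f0; elim: l => [|i l IH] //= x Ux.
apply: cpartE; have near0 : \forall y \near x, U y by exact: open_nbhs_nbhs.
by split; apply: near_eq_is_derive (is_derive_cst (0 : R) x _);
  apply: filterS near0 => y Uy /=; rewrite IH.
Qed.

End Smooth.
(** * Symmetry of mixed derivatives, affine substitutions, product functions *)

Section MeanValue.
Variable R : realType.

Lemma cder_line_cst (V : normedModType R) (f : V -> R[i]) (x v : V) :
  (forall h : R, f (h *: v + x) = f x) -> cder x v f 0.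
Proof.
move=> hf.
by split; apply: (@is_derive_affine _ _ _ _ id) (is_derive0 _ _) => h;
  rewrite hf scaler0 add0r.
Qed.

Lemma is_derive_continuous (f df : R -> R) :
  (forall t : R, is_derive t 1 f (df t)) -> continuous f.
Proof.
move=> h t; apply: differentiable_continuous.
by apply/derivable1_diffP; have [] := h t.
Qed.

Lemma mean_value (f df : R -> R) (a b : R) : a <= b ->
  (forall t : R, is_derive t 1 f (df t)) ->
  exists2 c, a <= c <= b & f b - f a = df c * (b - a).
Proof.
move=> ab h.
have [c ci E] : exists2 c : R, c \in `[a, b] & f b - f a = df c * (b - a).
  apply: MVT_segment => //.
  by apply: continuous_subspaceT; exact: (is_derive_continuous h).
by exists c => //; move: ci; rewrite in_itv.
Qed.

Lemma cder_mean_value (f df : R -> R[i]) (M a b : R) : a <= b ->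
  (forall t : R, cder t 1 f (df t)) ->
  (forall t, a <= t <= b -> normc (df t) <= M) ->
  normc (f b - f a) <= 2 * M * (b - a).
Proof.
move=> ab h hM.
have [c1 i1 E1] := mean_value ab (fun t => (h t).1).
have [c2 i2 E2] := mean_value ab (fun t => (h t).2).
apply: (le_trans (normc_le_ReIm _)).
have -> : complex.Re (f b - f a) = complex.Re (f b) - complex.Re (f a).
  by case: (f b); case: (f a).
have -> : complex.Im (f b - f a) = complex.Im (f b) - complex.Im (f a).
  by case: (f b); case: (f a).
rewrite E1 E2 !normrM (ger0_norm (_ : 0 <= b - a)) ?subr_ge0 //.
rewrite -mulrDl ler_wpM2r ?subr_ge0 //.
have := le_trans (Re_le_normc _) (hM _ i1); have := le_trans (Im_le_normc _) (hM _ i2).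
lra.
Qed.

Lemma continuous_dist (V : normedModType R) (g : V -> R) (x : V) (e : R) :
  {for x, continuous g} -> 0 < e ->
  exists2 d, 0 < d & forall y, `|x - y| < d -> `|g x - g y| < e.
Proof.
move=> cg e0.
have /nbhs_ballP[d d0 hd] : \forall y \near x, `|g x - g y| < e.
  by move/cvgrPdist_lt : cg; apply.
by exists d => // y hy; apply: hd; rewrite -ball_normE.
Qed.

(** Schwarz's theorem: the mixed difference quotient is a value of each of the
    two mixed derivatives near the point. *)
Lemma mixed_derivatives_sym (V : normedModType R) (g gu gv guv gvu : V -> R) (u v x : V) :
  (forall y, is_derive y u g (gu y)) -> (forall y, is_derive y v g (gv y)) ->
  (forall y, is_derive y v gu (gvu y)) -> (forall y, is_derive y u gv (guv y)) ->
  {for x, continuous guv} -> {for x, continuous gvu} -> guv x = gvu x.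
Proof.
move=> hu hv huv hvu cuv cvu.
have key (p q : V) (G Gp Gqp : V -> R) t : 0 <= t ->
  (forall y, is_derive y p G (Gp y)) -> (forall y, is_derive y q Gp (Gqp y)) ->
  exists ab : R * R, [/\ 0 <= ab.1 <= t, 0 <= ab.2 <= t &
   G (t *: p + (t *: q + x)) - G (t *: p + x) - G (t *: q + x) + G x
     = Gqp (ab.2 *: q + (ab.1 *: p + x)) * t * t].
  move=> t0 hG hGp.
  have d1 (z : V) (s : R) : is_derive s 1 (fun r : R => G (r *: p + z)) (Gp (s *: p + z)).
    apply: (@is_derive_affine _ _ _ _ G (fun r : R => r *: p + z)) => // h.
    by rewrite scalerDl -addrA /GRing.scale /= mulr1.
  have d2 (s : R) : is_derive s 1 (fun r : R => G (r *: p + (t *: q + x)) - G (r *: p + x))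
     (Gp (s *: p + (t *: q + x)) - Gp (s *: p + x)).
    exact: is_deriveB.
  have [a ai Ea] := mean_value t0 d2.
  have d3 (s : R) : is_derive s 1 (fun r : R => Gp (r *: q + (a *: p + x)))
      (Gqp (s *: q + (a *: p + x))).
    apply: (@is_derive_affine _ _ _ _ Gp (fun r : R => r *: q + (a *: p + x))) => // h.
    by rewrite scalerDl -addrA /GRing.scale /= mulr1.
  have [b bi Eb] := mean_value t0 d3.
  exists (a, b); split=> //=.
  move: Ea Eb; rewrite !scale0r !add0r !subr0 => Ea Eb.
  by rewrite [a *: p + (t *: q + x)]addrCA Eb in Ea; rewrite -Ea; ring.
apply/eqP/negPn/negP => ne.
have e0 : 0 < `|guv x - gvu x| / 2 by rewrite divr_gt0 // normr_gt0 subr_eq0.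
have [d1 d10 h1] := continuous_dist cuv e0.
have [d2 d20 h2] := continuous_dist cvu e0.
pose d := Num.min d1 d2; have d0 : 0 < d by rewrite lt_min d10.
pose N := `|u| + `|v| + 1; have N0 : 0 < N by rewrite ltr_wpDl // addr_ge0.
pose t := d / (2 * N); have t0 : 0 < t by rewrite divr_gt0 // mulr_gt0.
have small a b (p q : V) : 0 <= a <= t -> 0 <= b <= t -> `|p| + `|q| <= N ->
    `|x - (b *: q + (a *: p + x))| < d.
  move=> /andP[a0 at_] /andP[b0 bt] pq.
  rewrite addrA opprD addrCA subrr addr0 normrN.
  apply: le_lt_trans (ler_normD _ _) _; rewrite !normrZ !ger0_norm //.
  have : b * `|q| + a * `|p| <= t * N.
    rewrite (le_trans _ (ler_wpM2l (ltW t0) pq)) // mulrDr addrC.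
    by apply: lerD; exact: ler_wpM2r.
  move=> /le_lt_trans; apply.
  have -> : t * N = d / 2 by rewrite /t; field; rewrite gt_eqF.
  lra.
have [[a b] /= [ai bi Q1]] := key u v g gu gvu t (ltW t0) hu huv.
have [[a' b'] /= [ai' bi' Q2]] := key v u g gv guv t (ltW t0) hv hvu.
have Q : gvu (b *: v + (a *: u + x)) = guv (b' *: u + (a' *: v + x)).
  apply: (mulIf (lt0r_neq0 t0)); apply: (mulIf (lt0r_neq0 t0)).
  rewrite -Q1 -Q2 [t *: v + (t *: u + x)]addrCA; ring.
have uvN : `|u| + `|v| <= N by rewrite /N; lra.
have vuN : `|v| + `|u| <= N by rewrite /N; lra.
have dd1 : d <= d1 by rewrite /d ge_min lexx.
have dd2 : d <= d2 by rewrite /d ge_min lexx orbT.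
have l1 := h2 _ (lt_le_trans (small _ _ _ _ ai bi uvN) dd2).
have l2 := h1 _ (lt_le_trans (small _ _ _ _ ai' bi' vuN) dd1).
have E : guv x - gvu x = (guv x - guv (b' *: u + (a' *: v + x))) -
    (gvu x - gvu (b *: v + (a *: u + x))) by rewrite Q; ring.
have := ler_normB (guv x - guv (b' *: u + (a' *: v + x))) (gvu x - gvu (b *: v + (a *: u + x))).
rewrite -E; move: l1 l2; lra.
Qed.

End MeanValue.

Section SmoothOperations.
Variables (R : realType) (n : nat).
Implicit Types (f g : 'rV[R]_n -> R[i]) (i j : 'I_n) (l : seq 'I_n).

Lemma cpart_sym i j f : smooth f -> cpart i (cpart j f) = cpart j (cpart i f).
Proof.
move=> sf; apply: funext => x.
have [si sj] := (smooth_cpart i sf, smooth_cpart j sf).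
have di k y := smooth_cder k y sf.
have dij y := smooth_cder i y sj; have dji y := smooth_cder j y si.
have [c1 c2] := smooth_ccont (smooth_cpart i sj).
have [c3 c4] := smooth_ccont (smooth_cpart j si).
apply/eqP; rewrite eq_complex; apply/andP; split; apply/eqP.
- exact: (mixed_derivatives_sym (fun y => (di i y).1) (fun y => (di j y).1)
    (fun y => (dji y).1) (fun y => (dij y).1) (c1 x) (c3 x)).
- exact: (mixed_derivatives_sym (fun y => (di i y).2) (fun y => (di j y).2)
    (fun y => (dji y).2) (fun y => (dij y).2) (c2 x) (c4 x)).
Qed.

Lemma Cl_cpart l i f : smooth f -> Cl l (cpart i f) = cpart i (Cl l f).
Proof.
move=> sf; elim: l => [|j l IH]; first by [].
by rewrite !ClE IH (cpart_sym j i (smooth_Cl l sf)).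
Qed.

Lemma Cl_perm l1 l2 f : smooth f -> perm_eq l1 l2 -> Cl l1 f = Cl l2 f.
Proof.
move=> sf; elim: l1 l2 => [|i l1 IH] l2 h.
  by move: h; rewrite perm_sym => /perm_nilP ->.
have il2 : i \in l2 by rewrite -(perm_mem h) mem_head.
have /splitPr : i \in l2 by [].
move=> hs; case: hs h => p1 p2 h {il2}.
rewrite Cl_cat !ClE (Cl_cpart p1 i (smooth_Cl p2 sf)) -Cl_cat (IH (p1 ++ p2)) //.
by rewrite -(perm_cons i) (perm_trans h) // -cat1s perm_catCA.
Qed.

Lemma Cl_mlist l f : smooth f -> Cl l f = Cl (mlist (fun i => count_mem i l)) f.
Proof.
move=> sf; apply: Cl_perm => //; apply/allP => i _ /=.
by rewrite count_mlist.
Qed.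

End SmoothOperations.

Lemma ccont_comp (R : realType) (T U : topologicalType) (A : T -> U) (g : U -> R[i]) :
  continuous A -> ccont g -> ccont (fun x => g (A x)).
Proof.
move=> cA [c1 c2]; split => x.
- exact: (@continuous_comp _ _ _ A (fun y => complex.Re (g y)) x (cA x) (c1 (A x))).
- exact: (@continuous_comp _ _ _ A (fun y => complex.Im (g y)) x (cA x) (c2 (A x))).
Qed.

(** Substitution of an affine map, such as a translation, a projection or the
    difference x - y, the linear part of which sends each basis vector to a
    multiple of a basis vector. *)
Section AffineSubstitution.
Variables (R : realType) (m n : nat) (A : 'rV[R]_m -> 'rV[R]_n).
Variables (sg : 'I_m -> 'I_n) (a : 'I_m -> R).
Hypothesis A_basis : forall i (h : R) y,
  A (h *: delta_mx 0 i + y) = h *: (a i *: delta_mx 0 (sg i)) + A y.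
Hypothesis A_cont : continuous A.

Lemma cder_subst i f x : smooth f ->
  cder x (delta_mx 0 i) (fun y => f (A y)) ((a i)%:C%C * cpart (sg i) f (A x)).
Proof.
move=> sf; apply: (cder_affine (fun h => A_basis i h x)).
by apply: cder_scale; exact: smooth_cder.
Qed.

Lemma smooth_subst f : smooth f -> smooth (fun x => f (A x)).
Proof.
move=> sf.
pose S : set ('rV[R]_m -> R[i]) :=
  [set F | exists c g, smooth g /\ F = (fun x => c * g (A x))].
apply: (@smooth_coind _ _ S); last first.
  by exists 1, f; split=> //; apply: funext => x; rewrite mul1r.
move=> F [c [g [sg_ ->]]]; split.
  apply: ccontM; first exact: ccont_cst.
  exact: ccont_comp A_cont (smooth_ccont sg_).
move=> i; exists (fun x => c * ((a i)%:C%C * cpart (sg i) g (A x))).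
  exists (c * (a i)%:C%C), (cpart (sg i) g); split; first exact: smooth_cpart.
  by apply: funext => x; rewrite mulrA.
by move=> x; apply: cderZ; exact: cder_subst.
Qed.

Lemma Cl_subst l f : smooth f -> Cl l (fun x => f (A x)) =
  (fun x => (\prod_(i <- l) (a i)%:C%C) * Cl (map sg l) f (A x)).
Proof.
move=> sf; elim: l => [|i l IH] /=.
  by apply: funext => x; rewrite big_nil mul1r.
have sl := smooth_Cl (map sg l) sf.
rewrite IH cpartZ; last exact: smooth_subst.
apply: funext => x; rewrite (cpartE (cder_subst i x sl)) big_cons.
by rewrite mulrA [_ * (a i)%:C%C]mulrC.
Qed.

End AffineSubstitution.

(** Products of functions of one coordinate; each one is given with the tower
    of all its derivatives. *)
Section ProductFunctions.
Variables (R : realType) (n : nat).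

Definition tower (phi : nat -> R -> R[i]) :=
  forall b (t : R), cder t 1 (phi b) (phi b.+1 t).

Definition prodf (phi : 'I_n -> nat -> R -> R[i]) (c : 'I_n -> nat) :
  'rV[R]_n -> R[i] := fun x => \prod_(i < n) phi i (c i) (x 0 i).

Lemma cder_prodf phi c (j : 'I_n) x : (forall i, tower (phi i)) ->
  cder x (delta_mx 0 j) (prodf phi c) (prodf phi (fun i => (i == j) + c i)%N x).
Proof.
move=> tphi; rewrite /prodf (bigD1 j) //= eqxx.
under eq_fun do rewrite (bigD1 j) //=.
rewrite (eq_bigr (fun i => phi i (c i) (x 0 i))); last first.
  by move=> i /negbTE ->.
have h1 : cder x (delta_mx 0 j) (fun y : 'rV[R]_n => phi j (c j) (y 0 j))
    (phi j (1 + c j)%N (x 0 j)).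
  apply: (@cder_affine _ _ _ _ (fun y : 'rV[R]_n => y 0 j) _ _ 1) => [h|].
    by rewrite !mxE !eqxx.
  exact: tphi.
have h2 : cder x (delta_mx 0 j)
    (fun y : 'rV[R]_n => \prod_(i < n | i != j) phi i (c i) (y 0 i)) 0.
  have E h : \prod_(i < n | i != j) phi i (c i) ((h *: delta_mx 0 j + x) 0 i) =
      \prod_(i < n | i != j) phi i (c i) (x 0 i).
    by apply: eq_bigr => i ij; rewrite !mxE (negbTE ij) mulr0 add0r.
  by apply: cder_line_cst => h; exact: E.
apply: cder_eq (cderM h1 h2).
by rewrite mulr0 addr0.
Qed.

Lemma prodf_ccont phi c : (forall i, tower (phi i)) -> ccont (prodf phi c).
Proof.
move=> tphi; rewrite /prodf; elim: (index_enum _) => [|i r IH].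
  under eq_fun do rewrite big_nil; exact: ccont_cst.
under eq_fun do rewrite big_cons; apply: ccontM IH.
have co : continuous (fun x : 'rV[R]_n => x 0 i) by exact: coord_continuous.
have h1 := is_derive_continuous (fun t => (tphi i (c i) t).1).
have h2 := is_derive_continuous (fun t => (tphi i (c i) t).2).
by split => x; [exact: (continuous_comp (co x) (h1 _))|
  exact: (continuous_comp (co x) (h2 _))].
Qed.

Lemma smooth_prodf phi c : (forall i, tower (phi i)) -> smooth (prodf phi c).
Proof.
move=> tphi; pose S : set ('rV[R]_n -> R[i]) := [set F | exists c, F = prodf phi c].
apply: (@smooth_coind _ _ S); last by exists c.
move=> F [{}c ->]; split; first exact: prodf_ccont.
move=> i; exists (prodf phi (fun k => (k == i) + c k)%N); first by exists (fun k => (k == i) + c k)%N.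
by move=> x; exact: cder_prodf.
Qed.

Lemma Cl_prodf phi l : (forall i, tower (phi i)) ->
  Cl l (prodf phi (fun=> 0%N)) = prodf phi (fun i => count_mem i l).
Proof.
move=> tphi; elim: l => [|j l IH]; first by [].
rewrite ClE IH; apply: funext => x; rewrite (cpartE (cder_prodf _ _ _ tphi)).
by apply: eq_bigr => i _ /=; rewrite eq_sym.
Qed.

End ProductFunctions.
(** * Gevrey weights and the Leibniz rule *)

Section GevreyWeights.
Variables (R : realType) (s : R).
Hypothesis hs : 1 < s.
Implicit Types (h : R) (b k : nat).

(** The Gevrey weight of a derivative of order b, for the radius h. *)
Definition gw h b : R := (b`!%:R `^ s) * h ^+ b.

Lemma s_ge0 : 0 <= s. Proof. by apply: ltW; apply: lt_trans hs. Qed.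

Lemma gw_gt0 h b : 0 < h -> 0 < gw h b.
Proof. by move=> h0; rewrite mulr_gt0 ?exprn_gt0 // powR_gt0 // ltr0n fact_gt0. Qed.

Lemma gw_ge0 h b : 0 <= h -> 0 <= gw h b.
Proof. by move=> h0; rewrite mulr_ge0 ?exprn_ge0 // powR_ge0. Qed.

Lemma gw0 h : gw h 0 = 1.
Proof. by rewrite /gw fact0 powR1 expr0 mulr1. Qed.

Lemma gw_le h h' b : 0 <= h -> h <= h' -> gw h b <= gw h' b.
Proof.
by move=> h0 hh; rewrite ler_wpM2l ?powR_ge0 // lerXn2r ?nnegrE ?(le_trans h0).
Qed.

Lemma fact_powR_ge b : (b`!%:R : R) <= b`!%:R `^ s.
Proof. by apply: le1r_powR; [rewrite ler1n fact_gt0|exact: ltW]. Qed.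

Lemma gw_ge1 h b : 1 <= h -> 1 <= gw h b.
Proof.
move=> h1; rewrite -[1]mulr1 ler_pM //; last exact: exprn_ege1.
by apply: le_trans (fact_powR_ge b); rewrite ler1n fact_gt0.
Qed.

Lemma gw_leS h b b' : 1 <= h -> (b <= b')%N -> gw h b <= gw h b'.
Proof.
move=> h1; elim: b' => [|b' IH]; first by rewrite leqn0 => /eqP ->.
rewrite leq_eqVlt => /orP[/eqP ->//|]; rewrite ltnS => /IH /le_trans; apply.
have h0 : 0 <= h by lra.
apply: ler_pM; rewrite ?powR_ge0 ?exprn_ge0 //.
  by apply: ge0_ler_powR; rewrite ?nnegrE ?ler0n ?s_ge0 // ler_nat factS leq_pmull.
by rewrite exprS ler_peMl // exprn_ge0.
Qed.

Lemma gwZ h c b : gw (c * h) b = c ^+ b * gw h b.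
Proof. by rewrite /gw exprMn mulrCA. Qed.

Lemma gw_prod (I : Type) (r : seq I) h (b : I -> nat) :
  \prod_(i <- r) gw h (b i) =
  ((\prod_(i <- r) (b i)`!)%N%:R `^ s) * h ^+ (\sum_(i <- r) b i)%N.
Proof.
elim: r => [|i r IH]; first by rewrite !big_nil powR1 expr0 mulr1.
rewrite !big_cons IH natrM powRM ?ler0n // exprD /gw; ring.
Qed.

(** The binomial coefficient is at most [2 ^+ (a + b)], so that splitting a
    derivative costs one factor [2 `^ s] in the radius. *)
Lemma gw_add h a b : 0 <= h -> gw h (a + b) <= gw (2 `^ s * h) a * gw (2 `^ s * h) b.
Proof.
move=> h0; rewrite !gwZ.
have E : ((a + b)`!%:R : R) = (a`! * b`!)%N%:R * ('C(a + b, a))%:R.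
  by rewrite -natrM -(bin_fact (leq_addr b a)) addKn mulnC.
have C2 : (('C(a + b, a))%:R : R) <= 2 ^+ (a + b).
  rewrite -natrX ler_nat -[2%N]/(1 + 1)%N expnDn.
  rewrite (bigD1 (inord a)) //= inordK ?ltnS ?leq_addr //.
  by rewrite !exp1n !muln1 leq_addr.
rewrite /gw E powRM ?ler0n // natrM powRM ?ler0n //.
rewrite (exprD h) -!mulrA.
have -> : a`!%:R `^ s * (b`!%:R `^ s * ('C(a + b, a)%:R `^ s * (h ^+ a * h ^+ b)))
  = 'C(a + b, a)%:R `^ s * (a`!%:R `^ s * b`!%:R `^ s * h ^+ a * h ^+ b) by ring.
have -> : (2 `^ s) ^+ a * (a`!%:R `^ s * (h ^+ a * ((2 `^ s) ^+ b * (b`!%:R `^ s * h ^+ b))))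
  = (2 `^ s) ^+ (a + b) * (a`!%:R `^ s * b`!%:R `^ s * h ^+ a * h ^+ b).
  by rewrite exprD; ring.
apply: ler_wpM2r; first by rewrite !mulr_ge0 ?powR_ge0 ?exprn_ge0.
rewrite -powR_mulrn ?powR_ge0 // -powRrM mulrC powRrM powR_mulrn //.
by apply: ge0_ler_powR; rewrite ?nnegrE ?ler0n ?exprn_ge0 ?s_ge0.
Qed.

(** The binomial convolution, written so that one more derivative of a product
    is the sum of two convolutions. *)
Fixpoint conv (alpha beta : nat -> R) b : R :=
  if b is b'.+1 then conv (fun k => alpha k.+1) beta b' + conv alpha (fun k => beta k.+1) b'
  else alpha 0%N * beta 0%N.

Lemma convE (alpha beta : nat -> R) b :
  conv alpha beta b = \sum_(k < b.+1) ('C(b, k))%:R * (alpha k * beta (b - k)%N).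
Proof.
elim: b alpha beta => [|b IH] alpha beta.
  by rewrite big_ord_recl big_ord0 /= bin0 subnn addr0 mul1r.
rewrite /= !IH [RHS]big_ord_recl /= bin0 mul1r subn0.
under [in RHS]eq_bigr do rewrite /bump /= add1n binS natrD mulrDl subSS.
rewrite big_split /= addrA addrC; congr (_ + _).
rewrite [LHS]big_ord_recl /= bin0 mul1r subn0.
rewrite [in RHS]big_ord_recr /= bin_small // mul0r addr0; congr (_ + _).
apply: eq_bigr => k _; rewrite /bump /= add1n.
by rewrite subnSK.
Qed.

(** Keeping the radii of the two factors apart by a factor 2 makes the number
    of terms of the binomial formula harmless, which allows arbitrary powers. *)
Lemma gw_conv h b : 0 < h -> conv (gw (2 * h)) (gw h) b <= 2 * gw (2 * h) b.
Proof.
move=> h0; rewrite convE.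
have term (k : 'I_b.+1) : ('C(b, k))%:R * (gw (2 * h) k * gw h (b - k)) <= 2 ^+ k * gw h b.
  have kb : (k <= b)%N by rewrite -ltnS.
  rewrite gwZ -mulrA mulrCA ler_wpM2l ?exprn_ge0 // /gw.
  have -> : 'C(b, k)%:R * (k`!%:R `^ s * h ^+ k * ((b - k)`!%:R `^ s * h ^+ (b - k)))
    = ('C(b, k)%:R * (k`!%:R `^ s * (b - k)`!%:R `^ s)) * h ^+ b.
    have -> : h ^+ b = h ^+ k * h ^+ (b - k) by rewrite -exprD subnKC.
    ring.
  apply: ler_wpM2r; first by rewrite exprn_ge0 // ltW.
  rewrite -(bin_fact kb) natrM natrM powRM ?ler0n ?mulr_ge0 ?ler0n //.
  rewrite powRM ?ler0n // ler_wpM2r ?mulr_ge0 ?powR_ge0 //.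
  by apply: le1r_powR; [rewrite ler1n bin_gt0|exact: ltW].
apply: (@le_trans _ _ (\sum_(k < b.+1) 2 ^+ k * gw h b)).
  by apply: ler_sum => k _; exact: term.
rewrite -mulr_suml gwZ mulrA -exprS ler_wpM2r ?(ltW (gw_gt0 _ h0)) //.
elim: b {term} => [|b IH]; first by rewrite big_ord_recl big_ord0 /= addr0 expr0 expr1; lra.
rewrite big_ord_recr /=; apply: le_trans (lerD IH (lexx _)) _.
by rewrite [X in _ <= X]exprS; lra.
Qed.

End GevreyWeights.

Section Majorants.
Variables (R : realType) (s : R).
Hypothesis hs : 1 < s.

Section Fixed.
Variable n : nat.
Implicit Types (f g : 'rV[R]_n -> R[i]) (x : 'rV[R]_n) (l : seq 'I_n) (h C : R).

(** Stated at one point, since the bounds on a cell and outside of it differ. *)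
Definition maj h C f x :=
  forall l, normc (Cl l f x) <= C * \prod_(i < n) gw s h (count_mem i l).

Lemma Cl_mul_bound f g x A B (alpha beta : 'I_n -> nat -> R) :
  smooth f -> smooth g ->
  (forall l, normc (Cl l f x) <= A * \prod_(i < n) alpha i (count_mem i l)) ->
  (forall l, normc (Cl l g x) <= B * \prod_(i < n) beta i (count_mem i l)) ->
  forall l, normc (Cl l (fun y => f y * g y) x) <=
    A * B * \prod_(i < n) conv (alpha i) (beta i) (count_mem i l).
Proof.
move=> sf sg hf hg l; elim/last_ind: l alpha beta f g sf sg hf hg => [|l j IH] alpha beta f g sf sg hf hg.
  rewrite /Cl /= normcM.
  apply: le_trans (ler_pM _ _ (hf [::]) (hg [::])) _; rewrite ?normc_ge0 //=.
  by rewrite mulrACA -big_split.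
rewrite Cl_rcons cpartM //.
have sfj := smooth_cpart j sf; have sgj := smooth_cpart j sg.
rewrite (ClD l (smoothM sfj sg) (smoothM sf sgj)).
apply: le_trans (le_normcD _ _) _.
have cnt i l' : count_mem i (rcons l' j) = ((i == j) + count_mem i l')%N.
  by rewrite -cats1 count_cat /= addn0 addnC eq_sym.
have H1 := IH (fun i c => alpha i ((i == j) + c)%N) beta _ _ sfj sg _ hg.
have H2 := IH alpha (fun i c => beta i ((i == j) + c)%N) _ _ sf sgj hf _.
apply: le_trans (lerD (H1 _) (H2 _)) _.
- move=> l'; have := hf (rcons l' j); rewrite Cl_rcons.
  by under eq_bigr do rewrite cnt.
- move=> l'; have := hg (rcons l' j); rewrite Cl_rcons.
  by under eq_bigr do rewrite cnt.
rewrite -mulrDr le_eqVlt; apply/orP; left; apply/eqP; congr (_ * _).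
rewrite (bigD1 j) //= [X in _ + X](bigD1 j) //= [RHS](bigD1 j) //= cnt eqxx /= mulrDl.
by congr (_ * _ + _ * _); apply: eq_bigr => i ij; rewrite cnt (negbTE ij).
Qed.

Lemma maj_C h C f x : maj h C f x -> 0 <= C.
Proof.
move=> /(_ [::]) /=; under eq_bigr do rewrite gw0.
by rewrite big1 // mulr1; apply: le_trans; exact: normc_ge0.
Qed.

Lemma maj_normc h C f x : maj h C f x -> normc (f x) <= C.
Proof.
move=> /(_ [::]) /=; under eq_bigr do rewrite gw0.
by rewrite big1 // mulr1.
Qed.

Lemma gw_prod_ge0 h (b : 'I_n -> nat) : 0 <= h -> 0 <= \prod_(i < n) gw s h (b i).
Proof. by move=> h0; apply: prodr_ge0 => i _; exact: gw_ge0. Qed.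

Lemma gw_prod_gt0 h (b : 'I_n -> nat) : 0 < h -> 0 < \prod_(i < n) gw s h (b i).
Proof. by move=> h0; apply: prodr_gt0 => i _; exact: gw_gt0. Qed.

Lemma gw_prod_le h h' (b : 'I_n -> nat) : 0 <= h -> h <= h' ->
  \prod_(i < n) gw s h (b i) <= \prod_(i < n) gw s h' (b i).
Proof.
by move=> h0 hh; apply: ler_prod => i _; rewrite gw_ge0 //= gw_le.
Qed.

Lemma maj_le h C h' C' f x : 0 <= h -> h <= h' -> C <= C' ->
  maj h C f x -> maj h' C' f x.
Proof.
move=> h0 hh CC hf l; have C0 := maj_C hf; apply: le_trans (hf l) _.
by apply: ler_pM => //; [exact: gw_prod_ge0|exact: gw_prod_le].
Qed.

Lemma maj_mul h A B f g x : 0 < h -> smooth f -> smooth g ->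
  maj (2 * h) A f x -> maj h B g x ->
  maj (2 * h) (2 ^+ n * A * B) (fun y => f y * g y) x.
Proof.
move=> h0 sf sg hf hg l.
apply: le_trans (Cl_mul_bound (alpha := fun=> gw s (2 * h)) (beta := fun=> gw s h)
  sf sg hf hg l) _.
rewrite (_ : 2 ^+ n * A * B = A * B * 2 ^+ n); last by ring.
rewrite -(mulrA (A * B)).
rewrite ler_wpM2l ?mulr_ge0 ?(maj_C hf) ?(maj_C hg) //.
rewrite -[n in 2 ^+ n](card_ord n) -prodr_const -big_split /=.
apply: ler_prod => i _; rewrite (gw_conv hs) // andbT convE sumr_ge0 // => k _.
by apply: mulr_ge0; [exact: ler0n|apply: mulr_ge0; apply: gw_ge0; lra].
Qed.

Lemma majD h A B f g x : smooth f -> smooth g -> maj h A f x -> maj h B g x ->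
  maj h (A + B) (fun y => f y + g y) x.
Proof.
move=> sf sg hf hg l; rewrite (ClD l sf sg) mulrDl.
by apply: le_trans (le_normcD _ _) (lerD (hf l) (hg l)).
Qed.

Lemma majZ h A c f x : smooth f -> maj h A f x ->
  maj h (normc c * A) (fun y => c * f y) x.
Proof.
by move=> sf hf l; rewrite (ClZ l c sf) normcM -mulrA ler_wpM2l ?normc_ge0.
Qed.

Lemma majJ h A f x : smooth f -> maj h A f x -> maj h A (fun y => (f y)^*%C) x.
Proof. by move=> sf hf l; rewrite (ClJ l sf) normcJc. Qed.

Lemma maj_sum (I : Type) (r : seq I) h (A : I -> R) (F : I -> 'rV[R]_n -> R[i]) x :
  (forall k, smooth (F k)) -> (forall k, maj h (A k) (F k) x) ->
  maj h (\sum_(k <- r) A k) (fun y => \sum_(k <- r) F k y) x.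
Proof.
move=> sF hF l; rewrite (Cl_sum l r sF) mulr_suml.
apply: le_trans (normc_sum _ _ _) _.
by apply: ler_sum => k _; exact: hF.
Qed.

Lemma maj_cst h c x : 0 <= h -> maj h (normc c) (fun=> c) x.
Proof.
move=> h0; have E i : cpart i (fun _ : 'rV[R]_n => c) = fun=> 0.
  by apply: funext => y; apply/cpartE/cder_cst.
have E0 i : cpart i (fun _ : 'rV[R]_n => 0 : R[i]) = fun=> 0.
  by apply: funext => y; apply/cpartE/cder_cst.
elim/last_ind => [|l i _].
  by rewrite /Cl /=; under eq_bigr do rewrite gw0; rewrite big1 // mulr1.
rewrite Cl_rcons E (_ : Cl l (fun=> 0) = fun=> 0).
  by rewrite normc0 mulr_ge0 ?normc_ge0 ?gw_prod_ge0.
by elim: l => [|j l IH] //; rewrite ClE IH E0.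
Qed.

(** A bounded function that is small at the point has all its derivatives
    small, once the radius is enlarged. *)
Lemma maj_small h C e f x : 0 < h -> 0 < e -> e <= C -> normc (f x) <= e ->
  maj h C f x -> maj (h * (C / e)) e f x.
Proof.
move=> h0 e0 eC fe hf; case=> [|j l].
  by rewrite /Cl /=; under eq_bigr do rewrite gw0; rewrite big1 // mulr1.
apply: le_trans (hf _) _.
have C0 : 0 < C := lt_le_trans e0 eC.
have -> : \prod_(i < n) gw s (h * (C / e)) (count_mem i (j :: l)) =
    (C / e) ^+ size (j :: l) * \prod_(i < n) gw s h (count_mem i (j :: l)).
  rewrite size_counts -prodrXr -big_split /=.
  by apply: eq_bigr => i _; rewrite mulrC gwZ.
rewrite mulrA ler_wpM2r ?gw_prod_ge0 ?(ltW h0) //= exprS.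
rewrite mulrA (mulrC e) divfK ?lt0r_neq0 // ler_peMr ?(ltW C0) //.
by apply: exprn_ege1; rewrite ler_pdivlMr // mul1r.
Qed.

End Fixed.

Section Substitution.
Variables (m n : nat) (A : 'rV[R]_m -> 'rV[R]_n).
Variables (sg : 'I_m -> 'I_n) (a : 'I_m -> R).
Hypothesis A_basis : forall i (h : R) y,
  A (h *: delta_mx 0 i + y) = h *: (a i *: delta_mx 0 (sg i)) + A y.
Hypothesis A_cont : continuous A.
Hypothesis a_le1 : forall i, `|a i| <= 1.

Lemma normc_Cl_subst l f x : smooth f ->
  normc (Cl l (fun y => f (A y)) x) <= normc (Cl (map sg l) f (A x)).
Proof.
move=> sf; rewrite (Cl_subst A_basis A_cont l sf) normcM ler_piMl ?normc_ge0 //.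
rewrite normc_prod; elim: l => [|i l IH]; first by rewrite big_nil.
by rewrite big_cons normc_real mulr_ile1 // ?prodr_ge0 // => *; exact: normc_ge0.
Qed.

End Substitution.
End Majorants.

(** * The function spaces and their duals *)

Section Spaces.
Variables (R : realType) (s : R).
Hypothesis hs : 1 < s.
Variable n : nat.
Implicit Types (f g : 'rV[R]_n -> R[i]) (x : 'rV[R]_n) (l : seq 'I_n) (h C r : R).
Implicit Types (K : ('rV[R]_n -> R[i]) -> R[i]).

Lemma mfact_mlen h (b : 'I_n -> nat) :
  ((mfact b)%:R `^ s) * h ^+ mlen b = \prod_(i < n) gw s h (b i).
Proof. by rewrite gw_prod. Qed.

Lemma mfact2_mlen h (a b : 'I_n -> nat) :
  ((mfact a * mfact b)%:R `^ s) * h ^+ (mlen a + mlen b) =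
  \prod_(i < n) gw s h (a i) * \prod_(i < n) gw s h (b i).
Proof.
rewrite natrM powRM ?ler0n // exprD -!mfact_mlen; ring.
Qed.

Lemma coord_le_norm x i : `|x 0 i| <= `|x|.
Proof.
rewrite [leRHS]/Num.norm /= mx_normrE.
exact: (le_bigmax 0 (fun ij : 'I_1 * 'I_n => `|x ij.1 ij.2|) (0, i)).
Qed.

Lemma norm_le_coord x e : 0 <= e -> (forall i, `|x 0 i| <= e) -> `|x| <= e.
Proof.
move=> e0 h; rewrite [leLHS]/Num.norm /= mx_normrE.
by apply: bigmax_le => // -[i j] _ /=; rewrite (ord1 i).
Qed.

Lemma ereal_sup_fin_bound (S : set \bar R) : (ereal_sup S < +oo)%E ->
  exists2 C : R, 0 < C & forall c : R, S c%:E -> c <= C.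
Proof.
have H c : S c%:E -> (c%:E <= ereal_sup S)%E by exact: ereal_sup_ubound.
case E : (ereal_sup S) => [c| |] // _; last first.
  by exists 1 => // c /H; rewrite E.
exists (Num.max c 0 + 1); first by rewrite ltr_wpDl // le_max lexx orbT.
by move=> d /H; rewrite E lee_fin => /le_trans; apply; rewrite ler_wpDr // le_max lexx.
Qed.

(** This predicate and the next one are the norm bounds of the two scales of
    spaces, free of suprema and with lists of derivatives in any order. *)
Definition gevrey_bd h r C f :=
  [/\ smooth f, forall x, (exists i, r < `|x 0 i|) -> f x = 0 & forall x, maj s h C f x].

Definition gs_bd h C f :=
  smooth f /\ forall (a : 'I_n -> nat) l x, `|monom x a| * normc (Cl l f x) <=
    C * (\prod_(i < n) gw s h (a i) * \prod_(i < n) gw s h (count_mem i l)).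

Definition box r : set 'rV[R]_n := [set x | forall i, `|x 0 i| <= r].

Lemma compact_box r : compact (box r).
Proof.
have -> : box r = [set x : 'rV[R]_n | forall i, `[- r, r]%classic (x 0 i)].
  by apply/seteqP; split => x /= h i; move: (h i); rewrite /= in_itv /= ler_norml.
by apply: (@rV_compact R n (fun=> `[- r, r]%classic)) => i; exact: segment_compact.
Qed.

Lemma closed_box r : closed (box r).
Proof. by apply: compact_closed (@compact_box r); exact: norm_hausdorff. Qed.

Lemma open_outside_box r : open (~` box r).
Proof. by apply: closed_openC; exact: closed_box. Qed.

Lemma outside_boxP r x : (~` box r) x <-> exists i, r < `|x 0 i|.
Proof.
split=> [|[i hi] /(_ i)]; last by rewrite leNgt hi.
by move=> /existsNP[i /negP]; rewrite -ltNge => ?; exists i.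
Qed.

Lemma Cl_outside_box h r C f l x : gevrey_bd h r C f -> (exists i, r < `|x 0 i|) ->
  Cl l f x = 0.
Proof.
move=> [sf f0 _] /outside_boxP; apply: (Cl_locally0 l (@open_outside_box r) sf).
by move=> y /outside_boxP; exact: f0.
Qed.

Lemma gevrey_bd_step h r C f : 0 < h -> gevrey_bd h r C f ->
  Gevrey_step s (h, box r) f /\ (Gevrey_norm s (h, box r) f <= C%:E)%E.
Proof.
move=> h0 [sf f0 mf].
have N : (Gevrey_norm s (h, box r) f <= C%:E)%E.
  apply: ge_ereal_sup => _ [b [x [_ ->]]].
  rewrite lee_fin mfact_mlen ler_pdivrMr ?gw_prod_gt0 //.
  rewrite normc_Dpow //; have := mf x (mlist b).
  by under eq_bigr do rewrite count_mlist.
split=> //; split=> //=; last exact: le_lt_trans N (ltry _).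
apply: (@subset_trans _ (closure (box r))); last first.
  by move=> x; rewrite -(closure_id _).1 //; exact: closed_box.
apply: closure_subset => x /= fx; apply: contrapT => /outside_boxP /f0 /eqP.
by rewrite (negbTE fx).
Qed.

Lemma gevrey_bd_Gevrey h r C f : 0 < h -> gevrey_bd h r C f -> Gevrey s f.
Proof.
move=> h0 /(gevrey_bd_step h0)[H _]; exists (h, box r) => //; split => //=.
exact: compact_box.
Qed.

Lemma Gevrey_bd f : Gevrey s f -> exists h r C, [/\ 1 <= h, 0 < r, 0 < C & gevrey_bd h r C f].
Proof.
move=> [[h A] [/= h0 cA] [/= sf supp N]].
have [r r0 Ar] : exists2 r, 0 < r & A `<=` box r.
  have [M [_ /(_ (Num.max M 0 + 1))]] := compact_bounded cA.
  have M1 : M < Num.max M 0 + 1 by rewrite ltr_pwDr // le_max lexx.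
  move=> /(_ M1) hM; exists (Num.max M 0 + 1); first by rewrite ltr_wpDl // le_max lexx orbT.
  by move=> x /hM hx i; apply: le_trans hx; exact: coord_le_norm.
pose U := ~` closure [set x | f x != 0].
have f0 x : U x -> f x = 0.
  by move=> nA; apply: contrapT => /eqP fx; apply: nA; exact: subset_closure.
have nAU x : ~ A x -> U x by move=> nA /supp.
have oU : open U by apply: closed_openC; exact: closed_closure.
have [C C0 hC] := ereal_sup_fin_bound N.
have h1 : h <= Num.max h 1 by rewrite le_max lexx.
exists (Num.max h 1), r, C; split=> //; first by rewrite le_max lexx orbT.
split=> //; first by move=> x /outside_boxP bx; apply/f0/nAU => /Ar.
move=> x; apply: (maj_le (ltW h0) h1 (lexx C)) => l.
have [Ax|/nAU Ux] := pselect (A x); last first.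
  by rewrite (Cl_locally0 l oU sf f0 Ux) normc0 mulr_ge0 ?(ltW C0) ?gw_prod_ge0 ?(ltW h0).
rewrite Cl_mlist // -normc_Dpow // -ler_pdivrMr ?gw_prod_gt0 // -mfact_mlen.
by apply: hC; exists (fun i => count_mem i l), x.
Qed.

Lemma gs_bd_step h C f : 0 < h -> gs_bd h C f ->
  GS_step s h f /\ (GS_norm s h f <= C%:E)%E.
Proof.
move=> h0 [sf mf].
have N : (GS_norm s h f <= C%:E)%E.
  apply: ge_ereal_sup => _ [a [b [x ->]]].
  rewrite lee_fin mfact2_mlen ler_pdivrMr ?mulr_gt0 ?gw_prod_gt0 //.
  rewrite normcM normc_real normc_Dpow //; have := mf a (mlist b) x.
  have E : \prod_(i < n) gw s h (count_mem i (mlist b)) = \prod_(i < n) gw s h (b i).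
    by apply: eq_bigr => i _; rewrite count_mlist.
  by rewrite E.
by split=> //; split=> //; apply: le_lt_trans N (ltry _).
Qed.

Lemma gs_bd_le h h' C C' f : 0 <= h -> h <= h' -> 0 <= C -> C <= C' ->
  gs_bd h C f -> gs_bd h' C' f.
Proof.
move=> h0 hh C0 CC [sf mf]; split=> // a l x; apply: le_trans (mf a l x) _.
by apply: ler_pM => //; rewrite ?mulr_ge0 ?gw_prod_ge0 // ler_pM ?gw_prod_ge0 ?gw_prod_le.
Qed.

Lemma GS_step_bd h C f : 0 < h -> GS_step s h f -> (GS_norm s h f <= C%:E)%E -> gs_bd h C f.
Proof.
move=> h0 [sf _] N; split=> // a l x.
rewrite Cl_mlist // -normc_Dpow // -normc_real -normcM.
rewrite -ler_pdivrMr ?mulr_gt0 ?gw_prod_gt0 // -mfact2_mlen -lee_fin.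
apply: le_trans _ N; apply: ereal_sup_ubound.
by exists a, (fun i => count_mem i l), x.
Qed.

Lemma GS_bd f : GS s f -> exists h C, [/\ 1 <= h, 0 < C & gs_bd h C f].
Proof.
move=> [h /= h0 Sf]; have [C C0 hC] := ereal_sup_fin_bound Sf.2.
have h1 : h <= Num.max h 1 by rewrite le_max lexx.
exists (Num.max h 1), C; split=> //; first by rewrite le_max lexx orbT.
apply: (gs_bd_le (ltW h0) h1 (ltW C0) (lexx C)); apply: (GS_step_bd h0 Sf).
by apply: ge_ereal_sup => _ [a [b [x ->]]]; rewrite lee_fin; apply: hC; exists a, b, x.
Qed.

Lemma gs_bd_GS h C f : 0 < h -> gs_bd h C f -> GS s f.
Proof. by move=> h0 /(gs_bd_step h0)[H _]; exists h. Qed.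

(** A compactly supported Gevrey function satisfies the weighted bounds, since
    the powers of the variable are bounded by those of the radius of the support. *)
Lemma gevrey_bd_gs h r C f : 1 <= h -> 0 < r -> 0 <= C -> gevrey_bd h r C f ->
  gs_bd (Num.max h r) C f.
Proof.
move=> h1 r0 C0 hf; have [sf f0 mf] := hf; split=> // a l x.
have h0 : 0 <= h by lra.
have hr : r <= Num.max h r by rewrite le_max lexx orbT.
have hh : h <= Num.max h r by rewrite le_max lexx.
have [/outside_boxP bx|/contrapT bx] := pselect ((~` box r) x).
  have m0 : 0 <= Num.max h r := le_trans h0 hh.
  by rewrite (Cl_outside_box l hf bx) normc0 mulr0 !mulr_ge0 ?gw_prod_ge0.
rewrite mulrCA; apply: ler_pM; rewrite ?normc_ge0 //; last first.
  apply: le_trans (mf x l) _; rewrite ler_wpM2l // gw_prod_le //.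
rewrite /monom normr_prod; apply: ler_prod => i _; rewrite normr_ge0 /= normrX.
apply: (@le_trans _ _ (r ^+ a i)).
  by rewrite lerXn2r ?nnegrE ?(ltW r0) //; exact: bx.
apply: (@le_trans _ _ (gw s r (a i))); last by apply: gw_le => //; exact: ltW.
rewrite ler_peMl ?exprn_ge0 ?(ltW r0) //.
by apply: le_trans (fact_powR_ge hs _); rewrite ler1n fact_gt0.
Qed.

Section Duals.

Lemma indlim_dual_bound (I : Type) (ix : set I) (E : I -> set ('rV[R]_n -> R[i]))
    (p : I -> ('rV[R]_n -> R[i]) -> \bar R) K i :
  indlim_dual ix E p K -> ix i ->
  exists2 e : R, 0 < e & forall f, E i f -> (p i f < e%:E)%E -> normc (K f) < 1.
Proof.
move=> [_ /(_ 1 ltr01) [W [_ WU hW]]] ixi.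
have [e e0 he] := hW i ixi; exists e => // f Ef /(he f Ef) /WU[_ /=]; exact.
Qed.

Lemma gevrey_bdZ h r C c f : gevrey_bd h r C f ->
  gevrey_bd h r (normc c * C) (fun x => c * f x).
Proof.
move=> [sf f0 mf]; split; first exact: smoothZ.
- by move=> x /f0 ->; rewrite mulr0.
- by move=> x; exact: majZ.
Qed.

Lemma gs_bdZ h C c f : gs_bd h C f -> gs_bd h (normc c * C) (fun x => c * f x).
Proof.
move=> [sf mf]; split; first exact: smoothZ.
move=> a l x; rewrite (ClZ l c sf) normcM mulrCA -[leRHS]mulrA.
by rewrite ler_wpM2l ?normc_ge0.
Qed.

Lemma gevrey_bdD h h' r r' C C' f g : 0 <= h -> 0 <= h' ->
  gevrey_bd h r C f -> gevrey_bd h' r' C' g ->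
  gevrey_bd (Num.max h h') (Num.max r r') (C + C') (fun x => f x + g x).
Proof.
move=> h0 h0' [sf f0 mf] [sg g0 mg]; split; first exact: smoothD.
- move=> x [k]; rewrite gt_max => /andP[rx rx'].
  by rewrite f0 ?g0 ?addr0 //; exists k.
- by move=> x; apply: majD => //; [apply: maj_le (mf x)|apply: maj_le (mg x)];
    rewrite // le_max lexx ?orbT.
Qed.

Lemma gs_bdD h h' C C' f g : 0 <= h -> 0 <= h' -> 0 <= C -> 0 <= C' ->
  gs_bd h C f -> gs_bd h' C' g ->
  gs_bd (Num.max h h') (C + C') (fun x => f x + g x).
Proof.
move=> h0 h0' C0 C0' hf hg.
have hh : h <= Num.max h h' by rewrite le_max lexx.
have hh' : h' <= Num.max h h' by rewrite le_max lexx orbT.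
have [sf mf] := gs_bd_le h0 hh C0 (lexx C) hf.
have [sg mg] := gs_bd_le h0' hh' C0' (lexx C') hg.
split; first exact: smoothD.
move=> a l x; rewrite (ClD l sf sg) mulrDl.
apply: le_trans (lerD (mf a l x) (mg a l x)).
by rewrite -mulrDr ler_wpM2l // le_normcD.
Qed.

Lemma Gevrey_lin c f g : Gevrey s f -> Gevrey s g -> Gevrey s (fun x => c * f x + g x).
Proof.
move=> /Gevrey_bd[h [r [C [h1 r0 C0 hf]]]] /Gevrey_bd[h' [r' [C' [h1' r0' C0' hg]]]].
have [hh hh'] : 0 < h /\ 0 < h' by split; lra.
have m0 : 0 < Num.max h h' by rewrite lt_max hh.
exact: gevrey_bd_Gevrey m0 (gevrey_bdD (ltW hh) (ltW hh') (gevrey_bdZ c hf) hg).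
Qed.

Lemma GS_lin c f g : GS s f -> GS s g -> GS s (fun x => c * f x + g x).
Proof.
move=> /GS_bd[h [C [h1 C0 hf]]] /GS_bd[h' [C' [h1' C0' hg]]].
have [hh hh'] : 0 < h /\ 0 < h' by split; lra.
have m0 : 0 < Num.max h h' by rewrite lt_max hh.
have cC : 0 <= normc c * C by rewrite mulr_ge0 ?normc_ge0 // ltW.
exact: gs_bd_GS m0 (gs_bdD (ltW hh) (ltW hh') cC (ltW C0') (gs_bdZ c hf) hg).
Qed.

Lemma gevrey_bd0 : gevrey_bd 1 1 1 (fun=> 0).
Proof.
split=> [|//|x]; first exact: smooth_cst.
by apply: (maj_le ler01 (lexx 1)) (maj_cst _ _ _ ler01); rewrite normc0.
Qed.

Lemma Gevrey0 : Gevrey s (fun _ : 'rV[R]_n => 0).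
Proof. exact: gevrey_bd_Gevrey ltr01 gevrey_bd0. Qed.

Lemma Gevrey_GS f : Gevrey s f -> GS s f.
Proof.
move=> /Gevrey_bd[h [r [C [h1 r0 C0 hf]]]].
by apply: gs_bd_GS (gevrey_bd_gs h1 r0 (ltW C0) hf); rewrite lt_max r0 orbT.
Qed.

Section LinearFunctional.
Variables (P : set ('rV[R]_n -> R[i])) (K : ('rV[R]_n -> R[i]) -> R[i]).
Hypothesis P0 : P (fun=> 0).
Hypothesis Plin : forall c f g, P f -> P g -> P (fun x => c * f x + g x).
Hypothesis Klin : forall (c : R[i]) f g, P f -> P g ->
  K (fun x => c * f x + g x) = c * K f + K g.

Lemma functional0 : K (fun=> 0) = 0.
Proof.
have := Klin 1 P0 P0; under eq_fun do rewrite mulr0 addr0.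
rewrite mul1r => /eqP; by rewrite -subr_eq subrr eq_sym => /eqP.
Qed.

Lemma scale_closed c f : P f -> P (fun x => c * f x).
Proof.
move=> Pf; rewrite (_ : (fun x => c * f x) = (fun x => c * f x + (fun=> 0) x)).
  exact: Plin.
by apply: funext => x; rewrite addr0.
Qed.

Lemma functionalZ c f : P f -> K (fun x => c * f x) = c * K f.
Proof.
move=> Pf; have := Klin c Pf P0; rewrite functional0 addr0 => <-.
by congr K; apply: funext => x; rewrite addr0.
Qed.

Lemma sum_closed (I : Type) (r : seq I) (c : I -> R[i]) (F : I -> 'rV[R]_n -> R[i]) :
  (forall k, P (F k)) -> P (fun x => \sum_(k <- r) c k * F k x).
Proof.
move=> PF; elim: r => [|k r IH]; first by under eq_fun do rewrite big_nil.
under eq_fun do rewrite big_cons; exact: Plin.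
Qed.

Lemma functional_sum (I : Type) (r : seq I) (c : I -> R[i]) (F : I -> 'rV[R]_n -> R[i]) :
  (forall k, P (F k)) ->
  K (fun x => \sum_(k <- r) c k * F k x) = \sum_(k <- r) c k * K (F k).
Proof.
move=> PF; elim: r => [|k r IH].
  by rewrite big_nil; under eq_fun do rewrite big_nil; exact: functional0.
rewrite big_cons -IH -Klin //; last exact: sum_closed.
by congr K; apply: funext => x; rewrite big_cons.
Qed.

End LinearFunctional.

(** By homogeneity, an estimate on a ball of one step is a norm bound. *)
Lemma dual_step_bound (P E : set ('rV[R]_n -> R[i])) (p : ('rV[R]_n -> R[i]) -> \bar R)
    K (e C : R) f :
  P (fun=> 0) -> (forall (c : R[i]) f g, P f -> P g ->
    K (fun x => c * f x + g x) = c * K f + K g) ->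
  0 < e -> 0 < C ->
  (forall f, E f -> (p f < e%:E)%E -> normc (K f) < 1) ->
  P f -> (forall c : R[i], E (fun x => c * f x) /\
    (p (fun x => (c * f x)%R) <= (normc c * C)%:E)%E) ->
  normc (K f) <= 2 / e * C.
Proof.
move=> P0 lin e0 C0 he Pf hf.
pose t := e / (2 * C); have t0 : 0 < t by rewrite divr_gt0 // mulr_gt0.
have [S N] := hf (t%:C)%C.
have := he _ S; rewrite (functionalZ P0 lin) // normcM normc_real gtr0_norm //.
have -> : 2 / e * C = t^-1 by rewrite /t; field; rewrite !gt_eqF.
move=> H; rewrite -[leRHS]mul1r ler_pdivlMr // mulrC ltW // H //.
apply: le_lt_trans N _; rewrite lte_fin normc_real gtr0_norm //.
have -> : t * C = e / 2 by rewrite /t; field; rewrite gt_eqF.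
lra.
Qed.

Lemma Gevrey_dual_bound K h r : Gevrey_dual s K -> 0 < h ->
  exists2 c, 0 < c & forall f C, 0 < C -> gevrey_bd h r C f -> normc (K f) <= c * C.
Proof.
move=> GK h0.
have [|e e0 he] := indlim_dual_bound (i := (h, box r)) GK.
  by split=> //=; exact: compact_box.
exists (2 / e); first exact: divr_gt0.
move=> f C C0 hf; apply: (dual_step_bound Gevrey0 GK.1 e0 C0 he).
  exact: gevrey_bd_Gevrey hf.
by move=> c; exact: gevrey_bd_step h0 (gevrey_bdZ c hf).
Qed.

Lemma GS_dual_bound K h : GS_dual s K -> 0 < h ->
  exists2 c, 0 < c & forall f C, 0 < C -> gs_bd h C f -> normc (K f) <= c * C.
Proof.
move=> GK h0.
have [|e e0 he] := indlim_dual_bound (i := h) GK; first by [].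
exists (2 / e); first exact: divr_gt0.
move=> f C C0 hf; apply: (dual_step_bound (Gevrey_GS Gevrey0) GK.1 e0 C0 he).
  exact: gs_bd_GS hf.
by move=> c; exact: gs_bd_step h0 (gs_bdZ c hf).
Qed.

(** The sublevel sets of the modulus of a linear functional are absolutely convex,
    so that bounds on the steps give continuity. *)
Lemma GS_dual_of_bound (L : ('rV[R]_n -> R[i]) -> R[i]) :
  (forall (c : R[i]) f g, GS s f -> GS s g ->
     L (fun x => c * f x + g x) = c * L f + L g) ->
  (forall h, 1 <= h -> exists2 c, 0 < c &
     forall f C, 0 < C -> gs_bd h C f -> normc (L f) <= c * C) ->
  GS_dual s L.
Proof.
move=> lin bnd; split=> // e e0.
exists (indlim (@GS_index R) (GS_step (n := n) s) `&` [set f | normc (L f) < e]); split=> //.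
- move=> f g a b [Gf /= fe] [Gg /= ge] ab.
  have Gbg := scale_closed (Gevrey_GS Gevrey0) GS_lin b Gg.
  split; first exact: GS_lin.
  rewrite /= lin // (functionalZ (Gevrey_GS Gevrey0) lin) //.
  apply: le_lt_trans (le_normcD _ _) _; rewrite !normcM.
  have [m [me fm gm]] : exists m, [/\ m < e, normc (L f) <= m & normc (L g) <= m].
    exists (Num.max (normc (L f)) (normc (L g))).
    by rewrite gt_max fe ge !le_max !lexx orbT.
  apply: le_lt_trans (lerD (ler_wpM2l (normc_ge0 a) fm) (ler_wpM2l (normc_ge0 b) gm)) _.
  rewrite -mulrDl; have m0 : 0 <= m by apply: le_trans fm; exact: normc_ge0.
  by apply: le_lt_trans me; rewrite ler_piMl.
- move=> h /= h0.
  have m1 : 1 <= Num.max h 1 by rewrite le_max lexx orbT.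
  have [c c0 hc] := bnd _ m1.
  exists (e / (2 * c)); first by rewrite divr_gt0 // mulr_gt0.
  move=> f Ef N; split; first by exists h.
  have C0 : 0 < e / (2 * c) by rewrite divr_gt0 // mulr_gt0.
  apply: le_lt_trans (hc f (e / (2 * c)) C0 _) _; last first.
    have -> : c * (e / (2 * c)) = e / 2 by field; rewrite gt_eqF.
    lra.
  have h1 : h <= Num.max h 1 by rewrite le_max lexx.
  exact: (gs_bd_le (ltW h0) h1 (ltW C0) (lexx _) (GS_step_bd h0 Ef (ltW N))).
Qed.

End Duals.
End Spaces.
(** * Exponentials, decay of discrete Fourier coefficients, a Gevrey partition of unity *)

Section Cis.
Variable R : realType.
Implicit Types (a b t : R).

Definition cis t : R[i] := Complex (cos t) (sin t).

Lemma cisD a b : cis (a + b) = cis a * cis b.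
Proof.
by apply/eqP; rewrite eq_complex ReM ImM /= cosD sinD eqxx addrC mulrC eqxx.
Qed.

Lemma cis0 : cis 0 = 1.
Proof. by rewrite /cis cos0 sin0. Qed.

Lemma normc_cis t : normc (cis t) = 1.
Proof. by rewrite /= cos2Dsin2 sqrtr1. Qed.

Lemma cisN t : cis (- t) = (cis t)^*%C.
Proof. by rewrite /cis cosN sinN. Qed.

Lemma cisMn t k : cis (t *+ k) = cis t ^+ k.
Proof. by elim: k => [|k IH]; rewrite ?mulr0n ?cis0 // mulrS cisD IH exprS. Qed.

Lemma cis2pi : cis (2 * pi) = 1.
Proof. by rewrite mulr_natl /cis cos2pi sin2pi. Qed.

Lemma cis2pin k : cis (2 * pi * k%:R) = 1.
Proof. by rewrite mulr_natr cisMn cis2pi expr1n. Qed.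

Lemma normc_1Bcis a : normc (1 - cis a) = 2 * `|sin (a / 2)|.
Proof.
have E : cos a = 1 - 2 * sin (a / 2) ^+ 2.
  rewrite [in LHS](_ : a = a / 2 + a / 2); last by field.
  have := cos2Dsin2 (a / 2); rewrite cosD -!expr2; lra.
have S : sin a = 2 * (sin (a / 2) * cos (a / 2)).
  by rewrite [in LHS](_ : a = a / 2 + a / 2); [rewrite sinD; ring|field].
rewrite (_ : 2 * `|sin (a / 2)| = `|2 * sin (a / 2)|); last by rewrite normrM ger0_norm.
rewrite /= E S sub0r sqrrN -sqrtr_sqr; congr Num.sqrt.
have := cos2Dsin2 (a / 2) => /eqP; rewrite eq_sym -subr_eq => /eqP H.
rewrite (_ : (2 * (sin (a / 2) * cos (a / 2))) ^+ 2 =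
  4 * sin (a / 2) ^+ 2 * cos (a / 2) ^+ 2); last by ring.
by rewrite -H; ring.
Qed.

(** With y := x / 2, [sin x = 2 sin y cos y >= 2 y cos y ^ 2 >= y], by the mean
    value theorem and since [2 cos y ^ 2 = 1 + cos x]. *)
Lemma sin_ge_half (x : R) : 0 <= x <= pi / 2 -> x / 2 <= sin x.
Proof.
move=> /andP[x0 xpi].
have [->|xn0] := eqVneq x 0; first by rewrite mul0r sin0.
have piP := pi_gt0 R.
pose y := x / 2; have y0 : 0 <= y by rewrite divr_ge0.
have [c /andP[c0 cy] E] := mean_value y0 (fun t => is_derive_sin t).
rewrite sin0 !subr0 in E.
have cosy : cos y <= cos c.
  have [->//|ne] := eqVneq c y.
  apply: ltW; rewrite ltr_cos ?in_itv /= ?lt_neqAle ?ne ?cy // ; rewrite /y in cy *; lra.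
have cx : 0 <= cos x by apply: cos_ge0_pihalf; lra.
have cy0 : 0 <= cos y by apply: cos_ge0_pihalf; rewrite /y; lra.
have -> : sin x = 2 * (sin y * cos y).
  by rewrite [in LHS](_ : x = y + y); [rewrite sinD; ring|rewrite /y; field].
have Cx : cos x = 2 * cos y ^+ 2 - 1.
  rewrite [in LHS](_ : x = y + y); last by rewrite /y; field.
  have := cos2Dsin2 y; rewrite cosD -!expr2; lra.
rewrite E; have H : cos y * cos y <= cos c * cos y by exact: ler_wpM2r.
have H2 : y * (cos y * cos y) <= y * (cos c * cos y) by exact: ler_wpM2l.
have H3 : y * 1 <= y * (2 * (cos y * cos y)) by apply: ler_wpM2l => //; rewrite -expr2; lra.
have -> : x / 2 = y by [].
nra.
Qed.

Lemma normc_1Bcis_ge a : `|a| <= pi -> `|a| / 2 <= normc (1 - cis a).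
Proof.
move=> ha; rewrite normc_1Bcis.
have -> : `|sin (a / 2)| = `|sin (`|a| / 2)|.
  have [a0|a0] := ger0P a; first by [].
  by rewrite mulNr sinN normrN.
have h : 0 <= `|a| / 2 <= pi / 2 by apply/andP; split; [rewrite divr_ge0|lra].
have := sin_ge_half h => H; rewrite (ger0_norm (le_trans _ H)); last by rewrite !divr_ge0.
lra.
Qed.

Lemma cis_neq1 a : 0 < `|a| < 2 * pi -> cis a != 1.
Proof.
move=> /andP[a0 a2]; apply/eqP => E.
have := normc_1Bcis a; rewrite E subrr normc0 => /esym/eqP.
rewrite mulf_eq0 pnatr_eq0 /= normr_eq0 => /eqP S.
have S' : sin (`|a| / 2) = 0.
  by have [h|h] := ger0P a; rewrite ?mulNr ?sinN S ?oppr0.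
by have := @sin_gt0_pi R (`|a| / 2); rewrite S' ltxx => H; suff: false by []; apply: H; apply/andP; split; lra.
Qed.

(** Orthogonality of the characters of Z/N, for the modes centred at 0. *)
Lemma sum_cis (N c : nat) (q : R) (k : nat) : (0 < N)%N -> `|q| = k%:R -> (k < N)%N ->
  \sum_(m < N) cis (2 * pi * ((m%:R - c%:R) * q / N%:R)) = (if k == 0%N then N%:R else 0).
Proof.
move=> N0 qk kN; have NR : N%:R != 0 :> R by rewrite pnatr_eq0 -lt0n.
case: eqP => [k0|/eqP k0].
  have -> : q = 0 by apply/eqP; rewrite -normr_eq0 qk k0.
  under eq_bigr do rewrite mulr0 mul0r mulr0 cis0.
  by rewrite sumr_const card_ord.
pose z := cis (2 * pi * (q / N%:R)).
have E (m : 'I_N) : cis (2 * pi * ((m%:R - c%:R) * q / N%:R)) =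
    cis (- (2 * pi * (c%:R * q / N%:R))) * z ^+ m.
  by rewrite /z -cisMn -cisD; congr cis; rewrite -mulr_natr; field.
under eq_bigr do rewrite E.
rewrite -mulr_sumr.
have z1 : z != 1.
  apply: cis_neq1; rewrite !normrM (ger0_norm (_ : 0 <= 2)) // (gtr0_norm (pi_gt0 R)) qk.
  have piP := pi_gt0 R.
  rewrite normfV (ger0_norm (ler0n _ N)).
  have k0' : 0 < k%:R :> R by rewrite ltr0n lt0n.
  have N0' : 0 < N%:R :> R by rewrite ltr0n.
  apply/andP; split; first by rewrite !mulr_gt0 ?invr_gt0.
  rewrite gtr_pMr ?mulr_gt0 // ltr_pdivrMr // mul1r ltr_nat //.
have zN : z ^+ N = 1.
  rewrite /z -cisMn -[_ *+ N]mulr_natr.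
  have -> : 2 * pi * (q / N%:R) * N%:R = 2 * pi * q by field.
  have [h|h] := lerP 0 q.
    by rewrite ger0_norm // in qk; rewrite qk cis2pin.
  rewrite ltr0_norm // in qk; have -> : q = - k%:R by rewrite -qk opprK.
  by rewrite mulrN cisN cis2pin conjc1.
have := subrX1 z N; rewrite zN subrr => /esym/eqP; rewrite mulf_eq0 subr_eq0 (negbTE z1) /=.
by move=> /eqP ->; rewrite mulr0.
Qed.

Definition exp_tower (lam mu : R) (b : nat) (t : R) : R[i] :=
  (Complex 0 lam) ^+ b * cis (lam * t + mu).

Lemma exp_towerP lam mu : tower (exp_tower lam mu).
Proof.
move=> b t; rewrite /exp_tower.
have lin : is_derive t 1 (fun t : R => lam * t + mu) lam.
  apply: is_derive_eq; rewrite /GRing.scale /=; ring.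
have h : cder t 1 (fun t : R => cis (lam * t + mu)) (Complex 0 lam * cis (lam * t + mu)).
  split; rewrite ?ReM ?ImM /=.
  - have h1 : is_derive t 1 (fun t : R => cos (lam * t + mu)) (- sin (lam * t + mu) * lam).
      exact: is_derive1_comp.
    by apply: (is_derive_eq h1); ring.
  - have h1 : is_derive t 1 (fun t : R => sin (lam * t + mu)) (cos (lam * t + mu) * lam).
      exact: is_derive1_comp.
    by apply: (is_derive_eq h1); ring.
apply: cder_eq (cderZ _ h); rewrite exprS; ring.
Qed.

Lemma normc_exp_tower lam mu (b : nat) t : normc (exp_tower lam mu b t) = `|lam| ^+ b.
Proof.
rewrite /exp_tower normcM normc_cis mulr1 normcX; congr (_ ^+ _).
by rewrite /= expr0n add0r sqrtr_sqr.
Qed.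

End Cis.

Section SummationByParts.
Variables (R : realType) (h : R).
Hypothesis h0 : 0 < h.

Definition nabla (f : R -> R[i]) : R -> R[i] := fun t => f t - f (t - h).

Lemma tower_nabla phi p : tower phi -> tower (fun b => iter p nabla (phi b)).
Proof.
move=> tp; elim: p => [|p IH] // b t /=.
have E : nabla (iter p nabla (phi b)) =
    (fun u => iter p nabla (phi b) u + (-1) * iter p nabla (phi b) (u - h)).
  by apply: funext => u; rewrite /nabla mulN1r.
have H : cder t 1 (fun u : R => iter p nabla (phi b) (u - h)) (iter p nabla (phi b.+1) (t - h)).
  apply: (@cder_affine _ _ _ _ (fun u : R => u - h) _ _ 1) (IH b (t - h)).
  by move=> k; rewrite addrA.
by rewrite E; apply: cder_eq (cderD (IH b t) (cderZ (-1) H)); rewrite /nabla mulN1r.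
Qed.

Lemma nabla_bound phi p q M : tower phi -> (forall t : R, normc (phi (p + q)%N t) <= M) ->
  forall t : R, normc (iter p nabla (phi q) t) <= (2 * h) ^+ p * M.
Proof.
move=> tp; elim: p q M => [|p IH] q M hM t; first by rewrite expr0 mul1r; exact: hM.
have th : t - h <= t by rewrite lerBlDr lerDl ltW.
have H u : normc (iter p nabla (phi q.+1) u) <= (2 * h) ^+ p * M.
  by apply: IH => v; rewrite addnS; exact: hM.
rewrite /= /nabla.
apply: le_trans (cder_mean_value th (fun u => tower_nabla p tp q u) (fun u _ => H u)) _.
rewrite opprB addrCA subrr addr0 exprS; lra.
Qed.

(** Summation by parts, as multiplication of the generating polynomial of the
    samples by a power of [1 - 'X]. *)
Lemma fourier_decay phi (N p : nat) (z : R[i]) M : tower phi ->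
  (forall t : R, t < 0 \/ N%:R * h <= t -> phi 0%N t = 0) ->
  normc z = 1 -> (forall t : R, normc (phi p t) <= M) ->
  normc (\sum_(j < N) z ^+ j * phi 0%N (j%:R * h)) * normc (1 - z) ^+ p
    <= (N + p)%:R * ((2 * h) ^+ p * M).
Proof.
move=> tp supp z1 hM.
pose A := \poly_(j < N) phi 0%N (j%:R * h).
pose B q := (1 - 'X) ^+ q * A.
have neg q (t : R) : t < 0 -> iter q nabla (phi 0%N) t = 0.
  elim: q t => [|q IH] t t0 /=; first by apply: supp; left.
  have th : t - h < 0 by rewrite subr_lt0 (lt_trans t0).
  by rewrite /nabla !IH ?subr0.
have coefB q j : (B q)`_j = iter q nabla (phi 0%N) (j%:R * h).
  elim: q j => [|q IH] j.
    rewrite /B expr0 mul1r coef_poly; case: ltnP => // Nj.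
    by rewrite /= supp //; right; rewrite ler_wpM2r ?ler_nat // ltW.
  rewrite /B exprS -mulrA -/(B q) mulrBl mul1r coefB coefXM IH /= /nabla.
  case: j => [|j] /=; first by rewrite mul0r sub0r (neg q (- h)) ?oppr_lt0.
  by rewrite IH -[j.+1]addn1 natrD mulrDl mul1r addrK.
have sizeB q : (size (B q) <= N + q)%N.
  elim: q => [|q IH]; first by rewrite /B expr0 mul1r addn0 size_poly.
  rewrite /B exprS -mulrA -/(B q); apply: leq_trans (size_polyMleq _ _) _.
  have : (size ((1 - 'X)%R : {poly R[i]}) <= 2)%N.
    by apply: leq_trans (size_polyD _ _) _; rewrite size_polyN size_polyX size_poly1.
  move=> s2; rewrite -subn1 leq_subLR; apply: leq_trans (leq_add s2 IH) _.
  by rewrite add2n add1n addnS.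
have -> : \sum_(j < N) z ^+ j * phi 0%N (j%:R * h) = A.[z].
  by rewrite horner_poly; apply: eq_bigr => j _; rewrite mulrC.
have -> : normc A.[z] * normc (1 - z) ^+ p = normc (B p).[z].
  by rewrite /B hornerM horner_exp !hornerE -normcX -normcM mulrC.
rewrite (horner_coef_wide z (sizeB p)).
apply: le_trans (normc_sum _ _ _) _.
apply: (@le_trans _ _ (\sum_(j < N + p) (2 * h) ^+ p * M)).
  apply: ler_sum => j _; rewrite normcM normcX z1 expr1n mulr1 coefB.
  by apply: nabla_bound => // t; rewrite addn0.
by rewrite sumr_const card_ord -[leLHS]mulr_natl.
Qed.

End SummationByParts.

Section PartitionOfUnity.
Variables (R : realType) (s : R).
Hypothesis hs : 1 < s.

Definition rtower (phi : nat -> R -> R) :=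
  forall b (t : R), is_derive t 1 (phi b) (phi b.+1 t).

Lemma antiderivative (rho : R -> R) (r : R) : continuous rho ->
  (forall t : R, t <= r -> rho t = 0) ->
  exists F : R -> R, forall t : R, is_derive t 1 F (rho t).
Proof.
move=> crho rho0; pose a := r - 1.
pose F (x : R) := \int[lebesgue_measure]_(t in [set` `[a, x]]) rho t.
have F0 x : x <= r -> F x = 0.
  move=> xr; rewrite /F /Rintegral (eq_integral (cst 0%E)) ?integral0 //.
  move=> t; rewrite inE /= in_itv /= => /andP[_ tx].
  by rewrite rho0 // (le_trans tx).
exists F => t; have [tr|rt] := ltP t r.
  rewrite rho0 ?(ltW tr) //; apply: near_eq_is_derive (is_derive_cst (0 : R) t 1).
  have : \forall y \near t, y < r by exact: lt_nbhsl.
  by apply: filterS => y yr; rewrite F0 // ltW.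
have at_ : a < t by rewrite /a; lra.
have tt1 : t < t + 1 by rewrite ltrDl.
have int : lebesgue_measure.-integrable [set` `[a, t + 1]] (EFin \o rho).
  apply: continuous_compact_integrable; first exact: segment_compact.
  by apply: continuous_subspaceT.
have [d1 d2] := continuous_FTC1_closed tt1 int at_ (crho t).
by split; [exact: d1|rewrite -derive1E; exact: d2].
Qed.

Lemma is_derive_shift_arg (f : R -> R) (c t df : R) :
  is_derive (t + c) 1 f df -> is_derive t 1 (fun u => f (u + c)) df.
Proof.
apply: (@is_derive_affine _ _ _ _ f (fun u : R => u + c)) => h.
by rewrite addrA.
Qed.

(** A smooth step: from a nonnegative Gevrey function of compact support that
    does not vanish at 0, by integration and normalization. *)
Lemma gevrey_step_function (rho : nat -> R -> R) (B : nat) (C h : R) :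
  1 <= h -> 0 < C -> rtower rho ->
  (forall b (t : R), `|rho b t| <= C * gw s h b) ->
  (forall b (t : R), B%:R <= `|t| -> rho b t = 0) ->
  (forall t : R, 0 <= rho 0%N t) -> 0 < rho 0%N 0 ->
  exists (T : nat -> R -> R) (C' : R), [/\ 0 < C', rtower T,
    forall b (t : R), `|T b t| <= C' * gw s h b,
    forall b (t : R), t <= - B%:R -> T b t = 0 &
    forall b (t : R), B%:R <= t -> T b t = (b == 0%N)%:R].
Proof.
move=> h1 C0 trho brho srho rho_ge0 rho_gt0.
have crho : continuous (rho 0%N) := is_derive_continuous (trho 0%N).
have [|F dF] := @antiderivative (rho 0%N) (- B%:R) crho.
  by move=> t tB; apply: srho; rewrite ler_normr lerNr tB orbT.
have mono u v : u <= v -> F u <= F v.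
  move=> uv; have [c _ E] := mean_value uv dF.
  by rewrite -subr_ge0 E mulr_ge0 // subr_ge0.
have lo t : t <= - B%:R -> F t = F (- B%:R).
  move=> tB; have [c /andP[_ cB] E] := mean_value tB dF.
  by move: E; rewrite srho ?mul0r => [/eqP|]; [rewrite subr_eq0 => /eqP ->|rewrite ler_normr lerNr cB orbT].
have hi t : B%:R <= t -> F t = F B%:R.
  move=> tB; have [c /andP[cB _] E] := mean_value tB dF.
  by move: E; rewrite srho ?mul0r => [/eqP|]; [rewrite subr_eq0 => /eqP ->|rewrite ler_normr cB].
pose c := F B%:R - F (- B%:R).
have B0 : (0 : R) < B%:R.
  rewrite lt0r ler0n andbT; apply/negP => /eqP BR.
  by move: rho_gt0; rewrite srho ?ltxx // BR normr0.
have c0 : 0 < c.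
  have r2 : 0 < rho 0%N 0 / 2 by rewrite divr_gt0.
  have [d d0 hd] := continuous_dist (crho 0) r2.
  pose e := Num.min (d / 2) B%:R.
  have e0 : 0 < e by rewrite lt_min divr_gt0.
  have ed : e <= d / 2 by rewrite ge_min lexx.
  have eB : e <= B%:R by rewrite ge_min lexx orbT.
  have [u /andP[u0 ue] E] := mean_value (ltW e0) dF.
  have : 0 < F e - F 0.
    rewrite E subr0 mulr_gt0 //.
    have := hd u; rewrite sub0r normrN ger0_norm // => /(_ _).
    have ud : u < d by lra.
    move=> /(_ ud); rewrite ltr_norml => /andP[_]; lra.
  have := mono _ _ eB; have : F (- B%:R) <= F 0 by apply: mono; rewrite lerNl oppr0 ltW.
  rewrite /c; lra.
pose T b t := if b is b'.+1 then c^-1 * rho b' t else c^-1 * (F t - F (- B%:R)).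
have gwS b : gw s h b <= gw s h b.+1 := gw_leS hs h1 (leqnSn b).
exists T, (1 + c^-1 * C); split.
- by rewrite addr_gt0 // mulr_gt0 ?invr_gt0.
- case=> [|b] t /=.
    have := is_deriveZ (c^-1) (is_deriveB (dF t) (is_derive_cst (F (- B%:R)) t 1)).
    by rewrite subr0.
  exact: (is_deriveZ (c^-1) (trho b t)).
- case=> [|b] t /=.
    rewrite gw0 mulr1 normrM gtr0_norm ?invr_gt0 //.
    rewrite ler_wpDr ?mulr_ge0 ?invr_ge0 ?(ltW c0) ?(ltW C0) //.
    rewrite ler_pdivrMl // mulr1.
    have [tB|Bt] := leP t (- B%:R); first by rewrite lo // subrr normr0 ltW.
    rewrite ger0_norm ?subr_ge0 ?mono ?(ltW Bt) // /c lerD2r.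
    by have [tB|tB] := leP B%:R t; [rewrite hi|apply: mono; apply: ltW].
  rewrite normrM gtr0_norm ?invr_gt0 // mulrDl mul1r ler_wpDl ?gw_ge0 //; first lra.
  rewrite -mulrA ler_wpM2l ?invr_ge0 ?(ltW c0) //.
  by apply: le_trans (brho b t) _; rewrite ler_wpM2l // ltW.
- case=> [|b] t tB /=; first by rewrite lo // subrr mulr0.
  by rewrite srho ?mulr0 // ler_normr lerNr tB orbT.
- case=> [|b] t tB /=; first by rewrite hi // mulVf ?gt_eqF.
  by rewrite srho ?mulr0 // ler_normr tB.
Qed.

(** [th] cuts a function into pieces, of which it is the sum by [th_sum]; [tt] cuts
    off the periodic function that interpolates a piece. The entry number b of
    each sequence is the derivative of order b. *)
Record profile (B : nat) (C h : R) (th tt : nat -> R -> R) : Prop := Profile {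
  th_tower : rtower th;
  tt_tower : rtower tt;
  th_bound : forall b (t : R), `|th b t| <= C * gw s h b;
  tt_bound : forall b (t : R), `|tt b t| <= C * gw s h b;
  th_supp : forall b (t : R), B%:R < `|t| -> th b t = 0;
  tt_supp : forall b (t : R), B%:R < `|t| -> tt b t = 0;
  tt_plateau : forall t : R, th 0%N t != 0 -> tt 0%N t = 1;
  th_sum : forall (N : nat) (t : R), `|t| + B%:R <= N%:R ->
    \sum_(k < N.*2.+1) th 0%N (t - (k%:R - N%:R)) = 1 }.

(** Both functions are differences of two translates of the step, whence the
    telescoping sum of the first one. *)
Lemma profile_of_step (T : nat -> R -> R) (B : nat) (C h : R) : 1 <= h -> 0 < C ->
  rtower T -> (forall b (t : R), `|T b t| <= C * gw s h b) ->
  (forall b (t : R), t <= - B%:R -> T b t = 0) ->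
  (forall b (t : R), B%:R <= t -> T b t = (b == 0%N)%:R) ->
  exists th tt, profile (3 * B + 2) (C + C) h th tt.
Proof.
move=> h1 C0 tT bT lo hi.
exists (fun b t => T b (t + 1) - T b t).
exists (fun b t => T b (t + (2 * B%:R + 2)) - T b (t + - (2 * B%:R + 1))).
have B0 : 0 <= B%:R :> R by rewrite ler0n.
have BE : (3 * B + 2)%:R = 3 * B%:R + 2 :> R by rewrite natrD natrM.
have bd b u v : `|T b u - T b v| <= (C + C) * gw s h b.
  by apply: le_trans (ler_normB _ _) _; rewrite mulrDl lerD.
split=> //.
- by move=> b t; apply: is_deriveB; [apply: is_derive_shift_arg|]; exact: tT.
- by move=> b t; apply: is_deriveB; apply: is_derive_shift_arg; exact: tT.
- move=> b t; rewrite BE lter_normr => /orP[tB|tB].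
    by rewrite !hi ?subrr //; lra.
  by rewrite !lo ?subrr //; lra.
- move=> b t; rewrite BE lter_normr => /orP[tB|tB].
    by rewrite !hi ?subrr //; lra.
  by rewrite !lo ?subrr //; lra.
- move=> t ne.
  have [h2|h2] := leP t (- B%:R - 1); first by exfalso; move/negP: ne; apply; rewrite !lo ?subrr //; lra.
  have [h3|h3] := leP B%:R t; first by exfalso; move/negP: ne; apply; rewrite !hi ?subrr //; lra.
  by rewrite hi ?lo ?subr0 //; lra.
- move=> N t; rewrite BE => tN.
  have tb := ler_norm t; have tb' := ler_norm (- t); rewrite normrN in tb'.
  have tel m : \sum_(k < m) (T 0%N (t - (k%:R - N%:R) + 1) - T 0%N (t - (k%:R - N%:R))) =
      T 0%N (t + N%:R + 1) - T 0%N (t + N%:R + 1 - m%:R).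
    elim: m => [|m IH]; first by rewrite big_ord0 subr0 subrr.
    rewrite big_ord_recr /= IH.
    have -> : t - (m%:R - N%:R) + 1 = t + N%:R + 1 - m%:R by ring.
    have -> : t - (m%:R - N%:R) = t + N%:R + 1 - m.+1%:R by rewrite -[m.+1]addn1 natrD; ring.
    ring.
  have E : (N.*2.+1)%:R = 2 * N%:R + 1 :> R by rewrite -[_.+1]addn1 natrD -muln2 natrM; ring.
  by rewrite tel E hi ?lo ?subr0 //; lra.
Qed.

(** The square of the modulus of chi, on a coordinate line, is a nonnegative Gevrey
    bump, whose integral is the step. *)
Lemma profile_exists (n : nat) (i0 : 'I_n) (chi : 'rV[R]_n -> R[i]) :
  Gevrey s chi -> chi 0 <> 0 ->
  exists B C h th tt, [/\ 1 <= h, 0 < C & profile B C h th tt].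
Proof.
move=> /Gevrey_bd[h [r [C [h1 r0 C0 [sc c0 mc]]]]] chi0.
pose F := fun x => chi x * (chi x)^*%C.
have sJ := smoothJ sc; have sF : smooth F := smoothM sc sJ.
have h0 : 0 < h by lra.
have h2 : h <= 2 * h by lra.
have mF x : maj s (2 * h) (2 ^+ n * C * C) F x.
  exact: maj_mul hs _ _ _ _ _ _ _ h0 sc sJ (maj_le (ltW h0) h2 (lexx C) (mc x)) (majJ sc (mc x)).
have F0 (x : 'rV[R]_n) : (exists i, r < `|x 0 i|) -> F x = 0 by move=> /c0 E; rewrite /F E mul0r.
have bF : gevrey_bd s (2 * h) r (2 ^+ n * C * C) F by split.
pose C1 := 2 ^+ n * C * C; have C10 : 0 < C1 by rewrite !mulr_gt0 // exprn_gt0.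
pose e : 'rV[R]_n := delta_mx 0 i0.
pose rho b (t : R) := complex.Re (Cl (nseq b i0) F (t *: e)).
have cnt b i : count_mem i (nseq b i0) = ((i0 == i) * b)%N by rewrite count_nseq.
have [B hB] : exists B : nat, r < B%:R.
  have /archi_boundP := ltW r0; by exists (Num.bound r).
have [|||||||T [C' [C'0 tT bT lo hi]]] := @gevrey_step_function rho B C1 (2 * h).
- lra.
- by [].
- move=> b t; have [H _] := smooth_cder i0 (t *: e) (smooth_Cl (nseq b i0) sF).
  apply: (@is_derive_affine _ _ _ _ (fun y => complex.Re (Cl (nseq b i0) F y)) (fun t : R => t *: e)) H => k.
  by rewrite scalerDl /GRing.scale /= mulr1.
- move=> b t; apply: le_trans (Re_le_normc _) (le_trans (mF _ _) _).
  rewrite ler_wpM2l ?(ltW C10) // (bigD1 i0) //= cnt eqxx mul1n big1 ?mulr1 // => i ii.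
  by rewrite cnt eq_sym (negbTE ii) mul0n gw0.
- move=> b t Bt; rewrite /rho (Cl_outside_box (nseq b i0) bF) //; exists i0.
  by rewrite !mxE !eqxx mulr1 (lt_le_trans hB).
- move=> t; rewrite /rho /F /= ReM ReJ ImJ mulrN opprK -!expr2.
  by rewrite addr_ge0 ?sqr_ge0.
- rewrite /rho /F /= scale0r ReM ReJ ImJ mulrN opprK -!expr2.
  rewrite lt0r addr_ge0 ?sqr_ge0 // andbT paddr_eq0 ?sqr_ge0 // !sqrf_eq0.
  by apply/negP => /andP[/eqP a0 /eqP b0]; apply: chi0; move: a0 b0; case: (chi 0) => a b /= -> ->.
- have [|th [tt P]] := profile_of_step _ C'0 tT bT lo hi; first lra.
  exists (3 * B + 2)%N, (C' + C'), (2 * h), th, tt; split=> //; [lra|exact: addr_gt0].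
Qed.

End PartitionOfUnity.
(** * Discrete Fourier coefficients in several variables *)

Section Samples.
Variables (R : realType) (n N : nat) (h L : R) (x0 : 'rV[R]_n) (z : 'I_n -> R[i]).
Hypotheses (h0 : 0 < h) (LN : L < N%:R * h) (z1 : forall i, normc (z i) = 1).
Implicit Types (F : 'rV[R]_n -> R[i]) (i k : 'I_n) (r : seq 'I_n).

Definition sample_pt (j : {ffun 'I_n -> 'I_N}) : 'rV[R]_n :=
  \row_i (x0 0 i + (j i)%:R * h).

Definition sample_sum F := \sum_(j : {ffun 'I_n -> 'I_N})
  (\prod_(i < n) z i ^+ (j i)) * F (sample_pt j).

Definition line_sum i F : 'rV[R]_n -> R[i] :=
  fun x => \sum_(y < N) z i ^+ y * F ((y%:R * h) *: delta_mx 0 i + x).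

(** The sum over a grid is a composition of sums along the coordinate lines. *)
Lemma sample_sum_lines F r (q : {ffun 'I_n -> 'I_N}) : uniq r ->
  (\prod_(i | i \notin r) z i ^+ (q i)) *
    foldr line_sum F r (\row_i (if i \in r then x0 0 i else x0 0 i + (q i)%:R * h)) =
  \sum_(j : {ffun 'I_n -> 'I_N} | [forall i, (i \notin r) ==> (j i == q i)])
    (\prod_(i < n) z i ^+ (j i)) * F (sample_pt j).
Proof.
elim: r q => [|i r IH] q /=.
  move=> _; rewrite (eq_bigl (pred1 q)); last first.
    move=> j /=; apply/idP/idP => [/forallP H|/eqP ->].
      by apply/eqP/ffunP => k; apply/eqP; exact: (H k).
    by apply/forallP => k; rewrite eqxx.
  by rewrite big_pred1_eq; congr (_ * F _); apply/rowP => k; rewrite !mxE.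
move=> /andP[ir ur].
pose upd y : {ffun 'I_n -> 'I_N} := [ffun k => if k == i then y else q k].
rewrite (partition_big (fun j : {ffun 'I_n -> 'I_N} => j i) xpredT) //=.
rewrite {1}/line_sum mulr_sumr; apply: eq_bigr => y _.
transitivity (\sum_(j : {ffun 'I_n -> 'I_N} | [forall k, (k \notin r) ==> (j k == upd y k)])
    (\prod_(i < n) z i ^+ (j i)) * F (sample_pt j)); last first.
  apply: eq_bigl => j; apply/forallP/andP => [H|[/forallP H /eqP jy] k].
    split; last by have := implyP (H i) ir; rewrite ffunE eqxx.
    apply/forallP => k; apply/implyP; rewrite inE negb_or => /andP[ki kr].
    by have := implyP (H k) kr; rewrite ffunE (negbTE ki).
  apply/implyP => kr; have [->|ki] := eqVneq k i; first by rewrite ffunE eqxx jy.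
  rewrite ffunE (negbTE ki); by apply: (implyP (H k)); rewrite inE negb_or ki.
rewrite -(IH _ ur) [in RHS](bigD1 i) //= [LHS]mulrA.
have -> : upd y i = y by rewrite ffunE eqxx.
congr (_ * foldr line_sum F r _).
  rewrite mulrC; congr (_ * _).
  apply: eq_big => k; first by rewrite inE negb_or andbC.
  by rewrite inE negb_or ffunE => /andP[/negbTE -> _].
apply/rowP => k; rewrite !mxE inE ffunE.
have [->|ki] := eqVneq k i; first by rewrite (negbTE ir) mulr1 addrC.
by rewrite mulr0 add0r.
Qed.

Lemma sample_sumE F : (0 < N)%N -> sample_sum F = foldr line_sum F (enum 'I_n) x0.
Proof.
move=> N0; pose q : {ffun 'I_n -> 'I_N} := [ffun=> Ordinal N0].
have := sample_sum_lines F q (enum_uniq 'I_n).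
rewrite big1 ?mul1r => [|i]; last by rewrite mem_enum.
rewrite (_ : \row_i _ = x0); last by apply/rowP => i; rewrite !mxE mem_enum.
move=> ->; apply: eq_bigl => j; apply/esym/forallP => i.
by rewrite mem_enum.
Qed.

Lemma translate_basis (v : 'rV[R]_n) i (k : R) (y : 'rV[R]_n) :
  v + (k *: delta_mx 0 i + y) = k *: (1 *: delta_mx 0 i) + (v + y).
Proof. by rewrite scale1r addrCA. Qed.

Lemma continuous_translate (v : 'rV[R]_n) : continuous (fun x : 'rV[R]_n => v + x).
Proof. by move=> x; apply: continuousD; [exact: cst_continuous|exact: cvg_id]. Qed.

Lemma smooth_translate F (v : 'rV[R]_n) : smooth F -> smooth (fun x => F (v + x)).
Proof. exact: (smooth_subst (translate_basis v) (@continuous_translate v)). Qed.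

Lemma cpart_translate F (v : 'rV[R]_n) i : smooth F ->
  cpart i (fun x => F (v + x)) = (fun x => cpart i F (v + x)).
Proof.
move=> sF; apply: funext => x; rewrite (cpartE (cder_subst (translate_basis v) i x sF)).
by rewrite mul1r.
Qed.

Lemma smooth_line_sum i F : smooth F -> smooth (line_sum i F).
Proof.
by move=> sF; apply: smooth_sum => y; apply: smoothZ; exact: smooth_translate.
Qed.

Lemma smooth_line_sums r F : smooth F -> smooth (foldr line_sum F r).
Proof. by move=> sF; elim: r => [|i r IH]; [exact: sF|exact: smooth_line_sum IH]. Qed.

Lemma cpart_line_sums r i F : smooth F ->
  cpart i (foldr line_sum F r) = foldr line_sum (cpart i F) r.
Proof.
move=> sF; elim: r => [|k r IH]; first by [].
have sG := smooth_line_sums r sF.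
change (cpart i (line_sum k (foldr line_sum F r)) = line_sum k (foldr line_sum (cpart i F) r)).
rewrite -IH {1}/line_sum cpart_sum; last first.
  by move=> y; apply: smoothZ; exact: smooth_translate.
apply: funext => x; apply: eq_bigr => y _.
rewrite cpartZ; last exact: smooth_translate.
by rewrite cpart_translate.
Qed.

Lemma Cl_line_sums l r F : smooth F ->
  Cl l (foldr line_sum F r) = foldr line_sum (Cl l F) r.
Proof.
move=> sF; elim: l => [|i l IH]; first by [].
by rewrite !ClE IH (cpart_line_sums r i (smooth_Cl l sF)).
Qed.

Definition cell_supp F := forall (x : 'rV[R]_n) i, x 0 i < x0 0 i \/ x0 0 i + L < x 0 i -> F x = 0.

Lemma cell_supp_Cl l F : smooth F -> cell_supp F -> cell_supp (Cl l F).
Proof.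
move=> sF suppF x i hx.
pose U := [set y : 'rV[R]_n | y 0 i < x0 0 i] `|` [set y : 'rV[R]_n | x0 0 i + L < y 0 i].
have oU : open U.
  have co : continuous (fun y : 'rV[R]_n => y 0 i) by exact: coord_continuous.
  apply: openU.
    exact: (open_comp (fun y _ => co y) (@open_lt R (x0 0 i))).
  exact: (open_comp (fun y _ => co y) (@open_gt R (x0 0 i + L))).
by apply: (Cl_locally0 l oU sF) => // y Uy; apply: (suppF y i).
Qed.

Lemma cell_supp_line_sums r F (x : 'rV[R]_n) i : cell_supp F -> i \notin r ->
  x 0 i < x0 0 i \/ x0 0 i + L < x 0 i -> foldr line_sum F r x = 0.
Proof.
move=> suppF; elim: r x => [|k r IH] x /=; first by move=> _; exact: suppF.
rewrite inE negb_or => /andP[ik ir] hx.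
rewrite /line_sum big1 // => y _; rewrite IH ?mulr0 // !mxE (negbTE ik).
by rewrite mulr0 add0r.
Qed.

(** Summation by parts along one coordinate line after the other: derivatives
    commute with the sums along the lines that are left. *)
Lemma line_sums_bound (p : 'I_n -> nat) r F M (x : 'rV[R]_n) : uniq r -> smooth F -> cell_supp F ->
  (forall i, i \in r -> x 0 i = x0 0 i) ->
  (forall y, normc (Cl (flatten [seq nseq (p i) i | i <- r]) F y) <= M) ->
  normc (foldr line_sum F r x) * \prod_(i <- r) normc (1 - z i) ^+ p i
    <= \prod_(i <- r) ((N + p i)%:R * (2 * h) ^+ p i) * M.
Proof.
elim: r F x => [|i r IH] F x /=.
  by move=> _ _ _ _ hM; rewrite !big_nil mulr1 mul1r; exact: hM.
move=> /andP[ir ur] sF suppF hx hM.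
pose G := foldr line_sum F r; have sG : smooth G := smooth_line_sums r sF.
pose w : R[i] := \prod_(k <- r) (1 - z k) ^+ p k.
have nw : normc w = \prod_(k <- r) normc (1 - z k) ^+ p k.
  by rewrite normc_prod; apply: eq_bigr => k _; rewrite normcX.
pose e : 'rV[R]_n := delta_mx 0 i.
pose phi b (t : R) := w * Cl (nseq b i) G (t *: e + x).
have tphi : tower phi.
  move=> b t; apply: cderZ.
  apply: (@cder_affine _ _ _ _ (fun t : R => t *: e + x) _ _ e).
    by move=> k; rewrite scalerDl addrA /GRing.scale /= mulr1.
  exact: smooth_cder (smooth_Cl (nseq b i) sG).
have ex (t : R) : (t *: e + x) 0 i = t + x0 0 i.
  by rewrite !mxE !eqxx mulr1 hx ?mem_head.
have supp (t : R) : t < 0 \/ N%:R * h <= t -> phi 0%N t = 0.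
  move=> ht; rewrite /phi -[Cl _ G _]/(G (t *: e + x)) (_ : G _ = 0) ?mulr0 //.
  apply: (cell_supp_line_sums (i := i)) => //; rewrite ex.
  case: ht => ht; [left|right]; first by rewrite gtrDr.
  by rewrite addrC ltrD2r (lt_le_trans LN).
have bnd (t : R) : normc (phi (p i) t) <= \prod_(k <- r) ((N + p k)%:R * (2 * h) ^+ p k) * M.
  rewrite /phi normcM nw mulrC /G (Cl_line_sums _ r sF).
  apply: (IH _ (t *: e + x) ur (smooth_Cl (nseq (p i) i) sF)).
  - exact: cell_supp_Cl.
  - move=> k kr; rewrite !mxE.
    have -> : (k == i) = false by apply/negP => /eqP ki; rewrite -ki kr in ir.
    by rewrite mulr0 add0r hx // inE kr orbT.
  - move=> y; rewrite -Cl_cat (Cl_perm (l2 := nseq (p i) i ++ flatten [seq nseq (p k) k | k <- r]) sF).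
      exact: hM.
    by rewrite perm_catC.
have := fourier_decay h0 tphi supp (z1 i) bnd.
rewrite !big_cons -nw.
have -> : \sum_(j < N) z i ^+ j * phi 0%N (j%:R * h) = w * line_sum i G x.
  rewrite mulr_sumr; apply: eq_bigr => y _; rewrite /phi /=.
  by rewrite mulrCA.
rewrite normcM => H.
rewrite [X in X <= _](_ : _ = normc w * normc (line_sum i G x) * normc (1 - z i) ^+ p i); last by rewrite -/G; ring.
by apply: le_trans H _; lra.
Qed.

Lemma sample_sum_bound (p : 'I_n -> nat) F M : (0 < N)%N -> smooth F -> cell_supp F ->
  (forall y, normc (Cl (mlist p) F y) <= M) ->
  normc (sample_sum F) * \prod_(i < n) normc (1 - z i) ^+ p i
    <= \prod_(i < n) ((N + p i)%:R * (2 * h) ^+ p i) * M.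
Proof.
move=> N0 sF suppF hM; rewrite sample_sumE //.
have := line_sums_bound (enum_uniq 'I_n) sF suppF (fun i _ => erefl (x0 0 i)) hM.
by rewrite !big_enum.
Qed.

End Samples.
(** * The associated weight function *)

Section AssociatedFunction.
Variables (R : realType) (s : R).
Hypothesis hs : 1 < s.
Implicit Types (H t : R).

(** It grows like the exponential of a multiple of the s-th root of t. *)
Definition gfun H t : R := sup [set t ^+ b / gw s H b | b in [set: nat]].

Lemma gfun_has_sup H t : 0 < H -> 0 <= t -> has_sup [set t ^+ b / gw s H b | b in [set: nat]].
Proof.
move=> H0 t0; split; first by exists (t ^+ 0 / gw s H 0), 0%N.
have y0 : 0 <= t / H by rewrite divr_ge0 // ltW.
exists (expR (t / H)) => _ [b _ <-].
apply: (@le_trans _ _ ((t / H) ^+ b / b`!%:R)); last first.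
  have [->|b0] := eqVneq b 0%N; first by rewrite expr0 fact0 divr1 -expR0 ler_expR.
  by case: b b0 => // b _; apply: le_trans _ (expR_ge1Dxn b y0); rewrite lerDr.
rewrite /gw invfM expr_div_n mulrA mulrAC ler_wpM2l ?divr_ge0 ?exprn_ge0 ?(ltW H0) //.
by rewrite lef_pV2 ?posrE ?powR_gt0 ?ltr0n ?fact_gt0 // fact_powR_ge.
Qed.

Lemma gfun_ub H t b : 0 < H -> 0 <= t -> t ^+ b <= gfun H t * gw s H b.
Proof.
move=> H0 t0; rewrite -ler_pdivrMr ?gw_gt0 //.
by apply: ub_le_sup; [exact: (gfun_has_sup H0 t0).2|exists b].
Qed.

Lemma gfun_ge1 H t : 0 < H -> 0 <= t -> 1 <= gfun H t.
Proof. by move=> H0 t0; have := gfun_ub 0 H0 t0; rewrite expr0 gw0 mulr1. Qed.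

Lemma gfun_adherent H t : 0 < H -> 0 <= t -> exists b, gfun H t <= 2 * (t ^+ b / gw s H b).
Proof.
move=> H0 t0; have g1 := gfun_ge1 H0 t0.
have e0 : 0 < gfun H t / 2 by lra.
have [_ [b _ <-] hb] := sup_adherent e0 (gfun_has_sup H0 t0).
exists b; rewrite -/(gfun H t) in hb; lra.
Qed.

(** Each value of the weight is comparable with one of the quotients that define
    it; shrinking the radius also absorbs a square. *)
Lemma gfun_le_pow H h t : 0 < h -> 2 `^ s * h <= H -> 1 <= t ->
  exists b, gfun H t <= 2 * gw s H 2 * (t ^+ b / gw s h b) * (t ^+ 2)^-1.
Proof.
move=> h0 hH t1; have t0 : 0 < t by lra.
have H0 : 0 < H by apply: lt_le_trans hH; rewrite mulr_gt0 ?powR_gt0.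
have [b hb] := gfun_adherent H0 (ltW t0); exists (b + 2)%N.
apply: le_trans hb _.
have -> : 2 * gw s H 2 * (t ^+ (b + 2) / gw s h (b + 2)) * (t ^+ 2)^-1 =
    2 * (t ^+ b * (gw s H 2 / gw s h (b + 2))).
  by rewrite exprD; field; rewrite !gt_eqF ?gw_gt0.
rewrite !ler_wpM2l ?exprn_ge0 ?(ltW t0) //.
rewrite ler_pdivlMr ?gw_gt0 // ler_pdivrMl ?gw_gt0 // mulrC.
apply: le_trans (gw_add hs b 2 (ltW h0)) _.
rewrite mulrC; have p0 : 0 <= 2 `^ s * h by rewrite mulr_ge0 ?powR_ge0 ?ltW.
by apply: ler_pM; rewrite ?gw_ge0 ?gw_le.
Qed.

End AssociatedFunction.

Lemma prod_ge1 (R : realType) (I : Type) (r : seq I) (F : I -> R) :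
  (forall i, 1 <= F i) -> 1 <= \prod_(i <- r) F i.
Proof. by move=> F1; elim/big_ind: _ => // x y; exact: mulr_ege1. Qed.

Lemma prod_quot (R : realType) (n : nat) (c : R) (x y z : 'I_n -> R) :
  \prod_(i < n) (c * (x i / y i) * z i) =
  c ^+ n * (\prod_(i < n) x i / \prod_(i < n) y i) * \prod_(i < n) z i.
Proof. by rewrite !big_split /= prodr_const card_ord prodfV. Qed.

Lemma sum_inv_sq (R : realType) (m : nat) :
  \sum_(j < m) ((1 + j%:R) ^+ 2)^-1 <= 2 - 2 / (1 + m%:R) :> R.
Proof.
elim: m => [|m IH]; first by rewrite big_ord0 addr0 divr1 subrr.
rewrite big_ord_recr /= (le_trans (lerD IH (lexx _))) //.
have m0 : 0 <= m%:R :> R by rewrite ler0n.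
set a := 1 + m%:R; have a1 : 1 <= a by rewrite /a; lra.
have -> : 1 + m.+1%:R = a + 1 :> R by rewrite -[m.+1]addn1 natrD /a; ring.
have E : 2 / a - 2 / (a + 1) - (a ^+ 2)^-1 = (a - 1) / (a ^+ 2 * (a + 1)).
  by field; apply/andP; split; rewrite gt_eqF //; lra.
have : 0 <= (a - 1) / (a ^+ 2 * (a + 1)).
  by rewrite divr_ge0 ?mulr_ge0 ?sqr_ge0 //; lra.
rewrite -E; lra.
Qed.

Lemma sum_inv_sq_dist (R : realType) (m c : nat) :
  \sum_(j < m) ((1 + `|j%:R - c%:R|) ^+ 2)^-1 <= 4 :> R.
Proof.
have nn x : 0 <= ((1 + `|x|) ^+ 2)^-1 :> R by rewrite invr_ge0 sqr_ge0.
pose F j : R := ((1 + `|j%:R - c%:R|) ^+ 2)^-1.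
have le1 : \sum_(0 <= j < m) F j <= \sum_(0 <= j < c + m) F j.
  rewrite [leRHS](big_cat_nat (leq0n m) (leq_addl c m)) /= lerDl.
  by apply: sumr_ge0 => j _; exact: nn.
have -> : \sum_(j < m) ((1 + `|j%:R - c%:R|) ^+ 2)^-1 = \sum_(0 <= j < m) F j.
  by rewrite big_mkord.
apply: le_trans le1 _; rewrite (big_cat_nat (leq0n c) (leq_addr m c)) /=.
have A : \sum_(0 <= j < c) F j <= 2.
  rewrite big_nat_rev /= add0n big_mkord.
  apply: le_trans (_ : \sum_(j < c) ((1 + j%:R) ^+ 2)^-1 <= _).
    apply: ler_sum => j _; rewrite /F.
    have jc : (j.+1 <= c)%N by [].
    rewrite natrB // (_ : c%:R - j.+1%:R - c%:R = - j.+1%:R); last by ring.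
    rewrite normrN ger0_norm ?ler0n // lef_pV2 ?posrE ?exprn_gt0 ?ltr_wpDr ?ler0n //.
    by rewrite lerXn2r ?nnegrE ?addr_ge0 // lerD2l ler_nat.
  by apply: le_trans (sum_inv_sq _ _) _; rewrite gerBl divr_ge0 // addr_ge0.
have A2 : \sum_(c <= j < c + m) F j <= 2.
  rewrite -{1}[c]add0n big_addn addKn big_mkord.
  apply: le_trans (_ : \sum_(j < m) ((1 + j%:R) ^+ 2)^-1 <= _).
    apply: ler_sum => j _; rewrite /F.
    by rewrite natrD addrK ger0_norm.
  by apply: le_trans (sum_inv_sq _ _) _; rewrite gerBl divr_ge0 // addr_ge0.
lra.
Qed.

(** * Uniform convergence of bounded sequences of Gevrey functions *)

Lemma geometric_small (R : realType) (A e : R) : 0 <= A -> 0 < e ->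
  exists L : nat, A / 2 ^+ L <= e.
Proof.
move=> A0 e0; have /archi_boundP := divr_ge0 A0 (ltW e0) => H; exists (Num.bound (A / e)).
rewrite ler_pdivrMr ?exprn_gt0 // mulrC -ler_pdivrMr //.
apply: le_trans (ltW H) _; rewrite -natrX ler_nat.
exact: ltnW (ltn_expl _ (ltnSn 1)).
Qed.

Section Convergence.
Variables (R : realType) (s : R).
Hypothesis hs : 1 < s.
Variable n : nat.
Implicit Types (f g G : 'rV[R]_n -> R[i]) (x y : 'rV[R]_n).

Lemma cder_line (G : 'rV[R]_n -> R[i]) i x (t : R) : smooth G ->
  cder t 1 (fun t : R => G (t *: delta_mx 0 i + x)) (cpart i G (t *: delta_mx 0 i + x)).
Proof.
move=> sG; apply: (@cder_affine _ _ _ _ (fun t : R => t *: delta_mx 0 i + x) _ _ (delta_mx 0 i)).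
  by move=> k; rewrite scalerDl addrA /GRing.scale /= mulr1.
exact: smooth_cder.
Qed.

Lemma lipschitz_of_partials G A x y : smooth G ->
  (forall i z, normc (cpart i G z) <= A) ->
  normc (G x - G y) <= 2 * A * \sum_(i < n) `|x 0 i - y 0 i|.
Proof.
move=> sG hA.
pose mix (r : seq 'I_n) : 'rV[R]_n := \row_i (if i \in r then x 0 i else y 0 i).
have step r : uniq r -> normc (G (mix r) - G y) <= 2 * A * \sum_(i <- r) `|x 0 i - y 0 i|.
  elim: r => [|i r IH] /=.
    rewrite big_nil mulr0 (_ : mix [::] = y) ?subrr ?normc0 //.
    by apply/rowP => i; rewrite mxE.
  move=> /andP[ir ur]; rewrite big_cons mulrDr.
  have -> : G (mix (i :: r)) - G y = (G (mix (i :: r)) - G (mix r)) + (G (mix r) - G y) by ring.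
  apply: le_trans (le_normcD _ _) (lerD _ (IH ur)).
  have E : mix (i :: r) = (x 0 i - y 0 i) *: delta_mx 0 i + mix r.
    apply/rowP => k; rewrite !mxE inE; have [->|ki] := eqVneq k i.
      by rewrite (negbTE ir) mulr1 subrK.
    by rewrite mulr0 add0r.
  have E0 : G (mix r) = G (0 *: delta_mx 0 i + mix r) by rewrite scale0r add0r.
  rewrite E E0; have d (t : R) := cder_line i (mix r) t sG.
  have [h|h] := leP 0 (x 0 i - y 0 i).
    have := cder_mean_value h d (fun t _ => hA i (t *: delta_mx 0 i + mix r)).
    by rewrite subr0 ger0_norm.
  have := cder_mean_value (ltW h) d (fun t _ => hA i (t *: delta_mx 0 i + mix r)).
  by rewrite normcB_sym sub0r ltr0_norm.
have := step (enum 'I_n) (enum_uniq _); rewrite big_enum /=.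
rewrite (_ : mix (enum 'I_n) = x) //.
by apply/rowP => i; rewrite mxE mem_enum.
Qed.

(** The Landau inequality between a function and its first two derivatives. *)
Lemma landau G i e A x t : smooth G -> 0 < t -> (forall y, normc (G y) <= e) ->
  (forall y, normc (cpart i (cpart i G) y) <= A) ->
  normc (cpart i G x) <= 2 * e / t + 4 * A * t.
Proof.
move=> sG t0 hG hA; pose v : 'rV[R]_n := delta_mx 0 i.
have sGi := smooth_cpart i sG.
have A0 : 0 <= A := le_trans (normc_ge0 _) (hA x).
pose c := cpart i G x.
pose phi (u : R) : R[i] := G (u *: v + x) + (- c) * (u%:C)%C.
pose dphi (u : R) : R[i] := cpart i G (u *: v + x) + (- c) * 1.
have did (u : R) : cder u 1 (fun u : R => (u%:C)%C) 1.
  by split => /=; [exact: is_derive_id|exact: is_derive_cst].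
have d (u : R) : cder u 1 phi (dphi u).
  by apply: cderD; [exact: cder_line|exact: cderZ].
have near_ (u : R) : 0 <= u <= t -> normc (dphi u) <= 2 * A * t.
  move=> /andP[u0 ut]; rewrite /dphi mulr1.
  have := cder_mean_value u0 (fun r => cder_line i x r sGi) (fun r _ => hA (r *: v + x)).
  rewrite subr0 scale0r add0r -/c -/v => H; apply: le_trans H _.
  by rewrite ler_wpM2l // mulr_ge0.
have := cder_mean_value (ltW t0) d near_.
rewrite subr0 /phi scale0r add0r mulr0 addr0 => H.
have E : c * (t%:C)%C = G (t *: v + x) - G x - (G (t *: v + x) + - c * (t%:C)%C - G x) by ring.
have : normc c * t <= 2 * e + 2 * (2 * A * t) * t.
  rewrite -[t in X in X <= _]gtr0_norm // -normc_real -normcM E.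
  apply: le_trans (le_normcD _ _) _; rewrite normcN lerD //.
  apply: le_trans (le_normcD _ _) _; rewrite normcN.
  by have := hG (t *: v + x); have := hG x; lra.
move=> H2; have : normc c <= (2 * e + 2 * (2 * A * t) * t) / t by rewrite ler_pdivlMr.
move/le_trans; apply; rewrite mulrDl lerD2l -!mulrA mulfV ?gt_eqF //; nra.
Qed.

(** Landau's inequality carries uniform smallness from one order of derivation to
    the next; doubling the radius makes all the orders above some L small. *)
Lemma maj_converges (g : nat -> 'rV[R]_n -> R[i]) h A : 1 <= h ->
  (forall M, smooth (g M)) -> (forall M x, maj s h A (g M) x) ->
  (forall e, 0 < e -> exists M0, forall M x, (M0 <= M)%N -> normc (g M x) <= e) ->
  forall e, 0 < e -> exists M0, forall M x, (M0 <= M)%N -> maj s (2 * h) e (g M) x.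
Proof.
move=> h1 sg mg g0; have h0 : 0 < h by lra.
have A0 : 0 <= A := maj_C (mg 0%N 0).
have size_bd p : exists2 Ap, 0 < Ap & forall M l x, size l = p -> normc (Cl l (g M) x) <= Ap.
  exists (A * gw s h p ^+ n + 1); first by rewrite ltr_wpDl // mulr_ge0 // exprn_ge0 // gw_ge0 // ltW.
  move=> M l x lp; apply: le_trans (mg M x l) _; apply: ler_wpDr => //.
  rewrite ler_wpM2l // -[X in _ ^+ X](card_ord n) -prodr_const; apply: ler_prod => i _.
  by rewrite gw_ge0 ?(ltW h0) //= (gw_leS hs) // -lp count_size.
have conv p : forall e, 0 < e -> exists M0, forall M l x, (M0 <= M)%N -> size l = p ->
    normc (Cl l (g M) x) <= e.
  elim: p => [|p IH] e e0.
    have [M0 hM] := g0 e e0; exists M0 => M [|//] x MM _; exact: hM.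
  have [A2 A20 hA2] := size_bd p.+2.
  pose t := e / (8 * A2); have t0 : 0 < t by rewrite divr_gt0 // mulr_gt0.
  have e'0 : 0 < e * t / 4 by rewrite divr_gt0 // mulr_gt0.
  have [M0 hM] := IH _ e'0; exists M0 => M [//|i l] x MM /= [lp].
  have sl := smooth_Cl l (sg M).
  have b2 y : normc (cpart i (cpart i (Cl l (g M))) y) <= A2.
    by apply: (hA2 M [:: i, i & l]); rewrite /= lp.
  apply: le_trans (landau x sl t0 (fun y => hM M l y MM lp) b2) _.
  have -> : 2 * (e * t / 4) / t + 4 * A2 * t = e by rewrite /t; field; rewrite !gt_eqF.
  by [].
move=> e e0.
have [L hL] := geometric_small A0 e0.
have [M0 hM0] : exists M0, forall M l x, (M0 <= M)%N -> (size l < L)%N -> normc (Cl l (g M) x) <= e.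
  elim: L {hL} => [|L [M1 h1']]; first by exists 0%N.
  have [M2 h2'] := conv L e e0; exists (maxn M1 M2) => M l x; rewrite geq_max => /andP[a1 a2].
  by rewrite ltnS leq_eqVlt => /orP[/eqP|]; [exact: h2'|exact: h1'].
exists M0 => M x MM l.
have h21 : 1 <= 2 * h by lra.
have [lL|Ll] := ltnP (size l) L.
  apply: le_trans (hM0 M l x MM lL) _; rewrite ler_peMr ?(ltW e0) //.
  by apply: prod_ge1 => i; exact: gw_ge1.
apply: le_trans (mg M x l) _.
have -> : \prod_(i < n) gw s (2 * h) (count_mem i l) =
    2 ^+ size l * \prod_(i < n) gw s h (count_mem i l).
  by rewrite size_counts -prodrXr -big_split; apply: eq_bigr => i _; rewrite gwZ.
rewrite mulrA ler_wpM2r ?gw_prod_ge0 ?(ltW h0) // -ler_pdivrMr ?exprn_gt0 //.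
apply: le_trans _ hL; rewrite ler_wpM2l // lef_pV2 ?posrE ?exprn_gt0 //.
by apply: ler_weXn2l => //; rewrite ler1n.
Qed.

End Convergence.

(** * Windowed trigonometric interpolation *)

Section Frame.
Variables (R : realType) (s : R).
Hypothesis hs : 1 < s.
Variables (B : nat) (Cp hp : R) (th tt : nat -> R -> R).
Hypotheses (hp1 : 1 <= hp) (Cp0 : 0 < Cp) (P : profile s B Cp hp th tt).
Variable delta : R.
Hypothesis delta0 : 0 < delta.

(** The power of [delta^-1] makes a rescaled tower a tower again. *)
Definition scaled (phi : nat -> R -> R) (kk : R) (b : nat) (t : R) : R[i] :=
  ((delta^-1 ^+ b * phi b (t / delta - kk))%:C)%C.

Lemma scaled_tower phi kk : rtower phi -> tower (scaled phi kk).
Proof.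
move=> tphi b t; split; rewrite /scaled /=; last exact: is_derive_cst.
have lin : is_derive t 1 (fun t : R => t / delta - kk) delta^-1.
  have h := is_deriveB (is_deriveZ (delta^-1) (is_derive_id t (1 : R))) (is_derive_cst kk t 1).
  rewrite subr0 in h.
  have -> : (fun t : R => t / delta - kk) = delta^-1 *: id - cst kk.
    by apply: funext => u; rewrite /= mulrC.
  by apply: (is_derive_eq h); rewrite /GRing.scale /= mulr1.
have h := @is_derive1_comp _ (phi b) (fun t : R => t / delta - kk) _ _ _ (tphi b (t / delta - kk)) lin.
apply: (is_derive_eq (is_deriveZ (delta^-1 ^+ b) h)).
by rewrite /GRing.scale /= exprSr; ring.
Qed.

Lemma normc_scaled phi kk b t : (forall b (t : R), `|phi b t| <= Cp * gw s hp b) ->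
  normc (scaled phi kk b t) <= Cp * gw s (delta^-1 * hp) b.
Proof.
move=> bd; rewrite normc_real normrM ger0_norm ?exprn_ge0 ?invr_ge0 ?(ltW delta0) //.
by rewrite gwZ mulrCA ler_wpM2l ?exprn_ge0 ?invr_ge0 ?(ltW delta0).
Qed.

Lemma scaled_supp phi kk b t : (forall b (t : R), B%:R < `|t| -> phi b t = 0) ->
  B%:R < `|t / delta - kk| -> scaled phi kk b t = 0.
Proof. by move=> sp ht; rewrite /scaled sp // mulr0. Qed.

(** The stage-M grid has 2M+1 points per unit cell, 2M+1 cells per direction, and
    2B+1 unit cells per period; the number of samples in a period is odd, so the
    modes can be centred at 0. *)
Definition cells M := M.*2.+1.
Definition samples M := (B.*2.+1 * cells M)%N.
Definition mode0 M := ((samples M)./2)%N.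
Definition kval M (k : nat) : R := k%:R - M%:R.
Definition mval M (m : nat) : R := m%:R - (mode0 M)%:R.
Definition mesh M : R := delta / (cells M)%:R.

Lemma samples_gt0 M : (0 < samples M)%N.
Proof. by rewrite muln_gt0. Qed.

Lemma samplesR_gt0 M : 0 < (samples M)%:R :> R.
Proof. by rewrite ltr0n samples_gt0. Qed.

Lemma cellsR_gt0 M : 0 < (cells M)%:R :> R.
Proof. by rewrite ltr0n. Qed.

Lemma samplesR M : (samples M)%:R = (2 * B%:R + 1) * (cells M)%:R :> R.
Proof. by rewrite natrM -[(B.*2.+1)]addn1 natrD -muln2 natrM; congr (_ * _); ring. Qed.

Lemma samples_mode0 M : samples M = (mode0 M).*2.+1.
Proof.
rewrite /mode0 -[LHS]odd_double_half /samples /cells oddM /= !odd_double //.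
Qed.

Lemma mesh_gt0 M : 0 < mesh M.
Proof. by rewrite divr_gt0 // cellsR_gt0. Qed.

Lemma mval_le M (m : 'I_(samples M)) : `|mval M m| <= (mode0 M)%:R.
Proof.
rewrite /mval ler_norml lerBrDl subrr ler0n lerBlDl -natrD ler_nat.
by rewrite /= addnn -ltnS -samples_mode0 ltn_ord.
Qed.

Lemma mval_int M (m : nat) : mval M m = 0 \/ 1 <= `|mval M m|.
Proof.
rewrite /mval; have [e|e|->] := ltngtP m (mode0 M); last by left; rewrite subrr.
- by right; rewrite distrC -natrB ?(ltnW e) // ger0_norm // ler1n subn_gt0.
- by right; rewrite -natrB ?(ltnW e) // ger0_norm // ler1n subn_gt0.
Qed.

Section Multi.
Variable n : nat.
Implicit Types (f : 'rV[R]_n -> R[i]) (x : 'rV[R]_n).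

Section Stage.
Variable M : nat.
Implicit Types (k : {ffun 'I_n -> 'I_(cells M)}) (m j : {ffun 'I_n -> 'I_(samples M)}).

Definition corner k : 'rV[R]_n := \row_i (delta * (kval M (k i) - B%:R)).

Definition window k : 'rV[R]_n -> R[i] :=
  prodf (fun i => scaled th (kval M (k i))) (fun=> 0%N).
Definition plateau k : 'rV[R]_n -> R[i] :=
  prodf (fun i => scaled tt (kval M (k i))) (fun=> 0%N).

Definition freq (mm : R) : R := 2 * pi * mm / (delta * (2 * B%:R + 1)).

Definition mode k m : 'rV[R]_n -> R[i] :=
  prodf (fun i => exp_tower (freq (mval M (m i)))
    (- (freq (mval M (m i)) * (delta * (kval M (k i) - B%:R))))) (fun=> 0%N).

Definition atom k m : 'rV[R]_n -> R[i] := fun x => mode k m x * plateau k x.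

(** The conjugate of the factor that the mode m acquires from one sample to the
    next one in direction i. *)
Definition node m (i : 'I_n) : R[i] := cis (- (2 * pi * (mval M (m i) / (samples M)%:R))).

Definition coef k m f : R[i] := ((samples M)%:R ^- n) *
  sample_sum (samples M) (mesh M) (corner k) (node m) (fun x => f x * window k x).

Lemma smooth_window k : smooth (window k).
Proof. by apply: smooth_prodf => i; apply: scaled_tower; exact: th_tower P. Qed.
Lemma smooth_plateau k : smooth (plateau k).
Proof. by apply: smooth_prodf => i; apply: scaled_tower; exact: tt_tower P. Qed.
Lemma smooth_mode k m : smooth (mode k m).
Proof. by apply: smooth_prodf => i; exact: exp_towerP. Qed.
Lemma smooth_atom k m : smooth (atom k m).
Proof. exact: smoothM (smooth_mode k m) (smooth_plateau k). Qed.

Definition in_cell k x := forall i, `|x 0 i / delta - kval M (k i)| <= B%:R.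

Lemma Cl_scaled_prod phi k l x :
  rtower phi -> (forall b (t : R), `|phi b t| <= Cp * gw s hp b) ->
  (forall b (t : R), B%:R < `|t| -> phi b t = 0) ->
  maj s (delta^-1 * hp) (Cp ^+ n) (prodf (fun i => scaled phi (kval M (k i))) (fun=> 0%N)) x /\
  (~ in_cell k x -> Cl l (prodf (fun i => scaled phi (kval M (k i))) (fun=> 0%N)) x = 0).
Proof.
move=> tphi bphi sphi; split.
  move=> {}l; rewrite Cl_prodf; last by move=> i; exact: scaled_tower.
  have -> : Cp ^+ n = \prod_(i < n) Cp by rewrite prodr_const card_ord.
  rewrite normc_prod -big_split; apply: ler_prod => i _.
  by apply/andP; split; [exact: normc_ge0|exact: normc_scaled].
move=> /existsNP[i /negP]; rewrite -ltNge => hi.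
rewrite Cl_prodf; last by move=> j; exact: scaled_tower.
by rewrite /prodf (bigD1 i) //= scaled_supp // mul0r.
Qed.

Lemma maj_window k x : maj s (delta^-1 * hp) (Cp ^+ n) (window k) x.
Proof. exact: (Cl_scaled_prod k [::] x (th_tower P) (th_bound P) (th_supp P)).1. Qed.
Lemma window_out k l x : ~ in_cell k x -> Cl l (window k) x = 0.
Proof. exact: (Cl_scaled_prod k l x (th_tower P) (th_bound P) (th_supp P)).2. Qed.
Lemma window_out0 k x : ~ in_cell k x -> window k x = 0.
Proof. exact: (@window_out k [::] x). Qed.
Lemma maj_plateau k x : maj s (delta^-1 * hp) (Cp ^+ n) (plateau k) x.
Proof. exact: (Cl_scaled_prod k [::] x (tt_tower P) (tt_bound P) (tt_supp P)).1. Qed.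
Lemma plateau_out k l x : ~ in_cell k x -> Cl l (plateau k) x = 0.
Proof. exact: (Cl_scaled_prod k l x (tt_tower P) (tt_bound P) (tt_supp P)).2. Qed.

Lemma plateau_out0 k x : ~ in_cell k x -> plateau k x = 0.
Proof. exact: (@plateau_out k [::] x). Qed.

(** The norms of the atoms grow at most like these two weights, and the
    coefficients decay like their inverses. *)
Definition kweight H k : R := \prod_(i < n) gfun s H (1 + `|kval M (k i)|).
Definition mweight H m : R := \prod_(i < n) gfun s H (1 + `|mval M (m i)|).

Lemma kweight_ge1 H k : 0 < H -> 1 <= kweight H k.
Proof.
by move=> H0; apply: prod_ge1 => i; rewrite gfun_ge1 // addr_ge0.
Qed.

Lemma mweight_ge1 H m : 0 < H -> 1 <= mweight H m.
Proof.
by move=> H0; apply: prod_ge1 => i; rewrite gfun_ge1 // addr_ge0.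
Qed.

Definition freq0 : R := 2 * pi / (delta * (2 * B%:R + 1)).

Lemma freq0_gt0 : 0 < freq0.
Proof.
by rewrite divr_gt0 ?mulr_gt0 ?pi_gt0 // ltr_wpDl // mulr_ge0.
Qed.

Lemma maj_mode H k m x : 0 < H -> maj s (freq0 * H) (mweight H m) (mode k m) x.
Proof.
move=> H0 l; rewrite Cl_prodf; last by move=> i; exact: exp_towerP.
rewrite normc_prod -big_split /=; apply: ler_prod => i _.
rewrite normc_ge0 /= normc_exp_tower.
have -> : `|freq (mval M (m i))| = freq0 * `|mval M (m i)|.
  have -> : freq (mval M (m i)) = freq0 * mval M (m i) by rewrite /freq /freq0; ring.
  by rewrite normrM (gtr0_norm freq0_gt0).
rewrite gwZ mulrCA exprMn ler_wpM2l ?exprn_ge0 ?(ltW freq0_gt0) //.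
apply: le_trans _ (gfun_ub hs _ H0 _); last by rewrite addr_ge0.
by rewrite lerXn2r ?nnegrE ?addr_ge0 // lerDr.
Qed.

Definition atom_radius H : R := 2 * Num.max (freq0 * H) (delta^-1 * hp).

Lemma radius_half_gt0 H : 0 < Num.max (freq0 * H) (delta^-1 * hp).
Proof. by rewrite lt_max; apply/orP; right; rewrite mulr_gt0 ?invr_gt0 // (lt_le_trans ltr01). Qed.

Lemma maj_mode_plateau H A k m x : 0 < H -> maj s (delta^-1 * hp) A (plateau k) x ->
  maj s (atom_radius H) (2 ^+ n * mweight H m * A) (atom k m) x.
Proof.
move=> H0 mA; have r0 := radius_half_gt0 H.
have r1 : freq0 * H <= atom_radius H.
  have : freq0 * H <= Num.max (freq0 * H) (delta^-1 * hp) by rewrite le_max lexx.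
  rewrite /atom_radius; lra.
have r2 : delta^-1 * hp <= Num.max (freq0 * H) (delta^-1 * hp) by rewrite le_max lexx orbT.
have m1 := maj_le (ltW (mulr_gt0 freq0_gt0 H0)) r1 (lexx _) (maj_mode k m x H0).
have p0 : 0 <= delta^-1 * hp.
  by rewrite mulr_ge0 ?invr_ge0 ?(ltW delta0) // (le_trans ler01).
have := maj_mul hs r0 (smooth_mode k m) (smooth_plateau k) m1 (maj_le p0 r2 (lexx _) mA).
by [].
Qed.

Lemma maj_atom H k m x : 0 < H ->
  maj s (atom_radius H) ((2 ^+ n * Cp ^+ n) * mweight H m) (atom k m) x.
Proof. by move=> H0; rewrite mulrAC; apply: maj_mode_plateau (maj_plateau k x). Qed.

Lemma atom_out H k m x : 0 < H -> ~ in_cell k x -> maj s (atom_radius H) 0 (atom k m) x.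
Proof.
move=> H0 ox; rewrite -[0](mulr0 (2 ^+ n * mweight H m)); apply: maj_mode_plateau => // l.
by rewrite plateau_out // normc0 mul0r.
Qed.

Lemma node_norm m i : normc (node m i) = 1.
Proof. exact: normc_cis. Qed.

Lemma normc_1Bnode m i : `|mval M (m i)| / (samples M)%:R <= normc (1 - node m i).
Proof.
have N0 := samplesR_gt0 M; have piP := pi_gt0 R; have pi2 := pi_ge2 R.
rewrite /node; set a := (X in cis X).
have aE : `|a| = 2 * pi * (`|mval M (m i)| / (samples M)%:R).
  rewrite /a normrN !normrM normfV (gtr0_norm piP) (gtr0_norm N0).
  by rewrite ger0_norm.
have mle : `|mval M (m i)| / (samples M)%:R <= 1 / 2.
  rewrite ler_pdivrMr //; apply: le_trans (mval_le (m i)) _.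
  by rewrite samples_mode0 -[(_.*2.+1)]addn1 natrD -muln2 natrM; lra.
have m0 : 0 <= `|mval M (m i)| / (samples M)%:R by rewrite divr_ge0.
apply: le_trans _ (normc_1Bcis_ge _).
  by rewrite aE; nra.
by rewrite aE; nra.
Qed.

Lemma sample_window_supp f k :
  cell_supp (2 * B%:R * delta) (corner k) (fun x => f x * window k x).
Proof.
move=> x i hx; rewrite (_ : window k x = 0) ?mulr0 //.
apply: window_out0 => /(_ i); rewrite ler_norml => /andP[h1 h2].
have d0 := delta0; move: hx; rewrite mxE.
have xE : x 0 i = delta * (x 0 i / delta) by field; rewrite gt_eqF.
set t := x 0 i / delta in xE h1 h2 *; rewrite xE => -[]; nra.
Qed.

Lemma period_gt : 2 * B%:R * delta < (samples M)%:R * mesh M.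
Proof.
have -> : (samples M)%:R * mesh M = (2 * B%:R + 1) * delta.
  by rewrite samplesR /mesh; field; rewrite gt_eqF // cellsR_gt0.
by rewrite ltr_pM2r ?delta0 // ltrDl.
Qed.

Definition cell_ratio : R := delta^-1 + B%:R + 1.
Definition window_radius h : R := Num.max h (delta^-1 * hp).

Lemma cell_ratio_ge1 : 1 <= cell_ratio.
Proof. by rewrite /cell_ratio lerDr addr_ge0 // invr_ge0 ltW. Qed.

(** On the cell numbered k the weights of the variable are, up to constants, the
    powers of the coordinates of k; a coordinate of modulus below 1 is dropped. *)
Lemma windowed_bound h C f k (a : 'I_n -> nat) l y : 1 <= h -> 0 <= C -> gs_bd s h C f ->
  normc (Cl l (fun x => f x * window k x) y) * \prod_(i < n) (1 + `|kval M (k i)|) ^+ a i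
  <= (2 ^+ n * Cp ^+ n) * C * (\prod_(i < n) gw s (cell_ratio * h) (a i) *
      \prod_(i < n) gw s (2 * window_radius h) (count_mem i l)).
Proof.
move=> h1 C0 [sf mf].
have h0 : 0 < h by lra.
have hr : h <= window_radius h by rewrite /window_radius le_max lexx.
have pr : delta^-1 * hp <= window_radius h by rewrite /window_radius le_max lexx orbT.
have r0 : 0 < window_radius h by apply: lt_le_trans hr.
have Q1 := cell_ratio_ge1.
have p0 : 0 <= delta^-1 * hp.
  by rewrite mulr_ge0 ?invr_ge0 ?(ltW delta0) // (le_trans ler01).
have sw := smooth_window k.
have [ic|oc] := pselect (in_cell k y); last first.
  have m1 : maj s (2 * window_radius h) (C * 1) f y.
    apply: (@maj_le _ _ _ h C); rewrite ?mulr1 ?(ltW h0) //; first lra.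
    move=> l'; have := mf (fun=> 0%N) l' y.
    rewrite /monom; under eq_bigr do rewrite expr0.
    under [X in _ * (X * _)]eq_bigr do rewrite gw0.
    by rewrite !big1_eq normr1 !mul1r.
  have m2 : maj s (window_radius h) 0 (window k) y.
    by move=> l'; rewrite window_out // normc0 mul0r.
  have := maj_mul hs r0 sf sw m1 m2 l; rewrite mulr0 mul0r => H.
  have -> : normc (Cl l (fun x => f x * window k x) y) = 0.
    by apply/eqP; rewrite eq_le H normc_ge0.
  rewrite mul0r !mulr_ge0 ?exprn_ge0 ?(ltW Cp0) ?gw_prod_ge0 //.
    by rewrite mulr_ge0 ?(ltW h0) // (le_trans ler01).
  by rewrite mulr_ge0 ?(ltW r0).
pose a' i := if 1 <= `|y 0 i| then a i else 0%N.
have K1 : \prod_(i < n) (1 + `|kval M (k i)|) ^+ a i <=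
    \prod_(i < n) cell_ratio ^+ a i * `|monom y a'|.
  rewrite /monom normr_prod -big_split; apply: ler_prod => i _ /=.
  rewrite exprn_ge0 ?addr_ge0 //=.
  have kle : 1 + `|kval M (k i)| <= `|y 0 i| / delta + B%:R + 1.
    have := ic i; have := ler_normB (y 0 i / delta) (y 0 i / delta - kval M (k i)).
    rewrite opprB addrC subrK normrM normfV (gtr0_norm delta0); lra.
  have di : 0 < delta^-1 by rewrite invr_gt0.
  have B0 : 0 <= B%:R :> R by rewrite ler0n.
  rewrite /a'; have [yi|yi] := leP 1 `|y 0 i|.
    rewrite normrX -exprMn lerXn2r ?nnegrE ?addr_ge0 ?mulr_ge0 //.
      by rewrite !addr_ge0 // ltW.
    apply: le_trans kle _; rewrite /cell_ratio; nra.
  rewrite expr0 normr1 mulr1 lerXn2r ?nnegrE ?addr_ge0 //.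
    by rewrite ltW.
  apply: le_trans kle _; rewrite /cell_ratio; nra.
pose w := `|monom y a'|.
pose F2 x := ((w%:C)%C) * f x.
have sF2 : smooth F2 := smoothZ _ sf.
have m1 : maj s (2 * window_radius h) (C * \prod_(i < n) gw s h (a i)) F2 y.
  apply: (@maj_le _ _ _ h (C * \prod_(i < n) gw s h (a i))); rewrite ?(ltW h0) //; first lra.
  move=> l'; rewrite /F2 (ClZ l' _ sf) normcM normc_real normr_id.
  apply: le_trans (mf a' l' y) _; rewrite -mulrA ler_wpM2l //.
  rewrite ler_wpM2r ?gw_prod_ge0 ?(ltW h0) //; apply: ler_prod => i _.
  rewrite gw_ge0 ?(ltW h0) //= /a'; case: ifP => // _.
  by rewrite gw0 gw_ge1.
have m2 := maj_le p0 pr (lexx _) (maj_window k y).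
have := maj_mul hs r0 sF2 sw m1 m2 l.
have -> : Cl l (fun x => F2 x * window k x) = (fun x => (w%:C)%C * Cl l (fun x => f x * window k x) x).
  rewrite -(ClZ l _ (smoothM sf sw)); congr Cl.
  by apply: funext => x; rewrite /F2 mulrA.
rewrite normcM normc_real normr_id => H.
have QP : 0 <= \prod_(i < n) cell_ratio ^+ a i.
  by apply: prodr_ge0 => i _; rewrite exprn_ge0 // (le_trans ler01).
apply: le_trans (ler_wpM2l (normc_ge0 _) K1) _.
rewrite mulrCA (mulrC (normc _)); apply: le_trans (ler_wpM2l QP H) _.
have -> : \prod_(i < n) gw s (cell_ratio * h) (a i) =
    \prod_(i < n) cell_ratio ^+ a i * \prod_(i < n) gw s h (a i).
  by rewrite -big_split; apply: eq_bigr => i _; rewrite gwZ.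
lra.
Qed.

(** With p summations by parts in one variable, the powers [(2 * mesh) ^+ p] from
    the differences, [samples ^+ p] from the division by [1 - node] and [2 ^+ p]
    from the number of terms amount to [(4 * period) ^+ p]. *)
Definition mode_ratio : R := Num.max 1 (4 * (delta * (2 * B%:R + 1))).

Lemma coef_factor_bound h (b b' : nat) : 1 <= h -> (b' <= b)%N ->
  gw s (2 * window_radius h) b' <= gw s (2 * window_radius h) b ->
  2 ^+ b * (samples M)%:R ^+ b' *
    ((samples M + b')%:R * (2 * mesh M) ^+ b') * gw s (2 * window_radius h) b'
    <= (samples M)%:R * gw s (2 * mode_ratio * (2 * window_radius h)) b.
Proof.
move=> h1 pp E4.
have N0 := samplesR_gt0 M.
have r1 : 1 <= 2 * window_radius h.
  have : h <= window_radius h by rewrite /window_radius le_max lexx.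
  lra.
have wr0 : 0 <= 2 * window_radius h by apply: le_trans r1.
have E1 : ((samples M + b')%:R : R) <= (samples M)%:R * 2 ^+ b'.
  rewrite -natrX -natrM ler_nat; have := ltn_expl (b') (ltnSn 1).
  have := samples_gt0 M; nia.
have E2 : (samples M)%:R ^+ b' * (2 * mesh M) ^+ b' * 2 ^+ b' =
    (4 * (delta * (2 * B%:R + 1))) ^+ b'.
  rewrite -!exprMn; congr (_ ^+ _); rewrite samplesR /mesh; field.
  by rewrite gt_eqF // cellsR_gt0.
have d4 : 0 <= 4 * (delta * (2 * B%:R + 1)) by rewrite !mulr_ge0 ?addr_ge0 ?mulr_ge0 ?(ltW delta0).
have m1 : 1 <= mode_ratio by rewrite /mode_ratio le_max lexx.
have m4 : 4 * (delta * (2 * B%:R + 1)) <= mode_ratio by rewrite /mode_ratio le_max lexx orbT.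
have E3 : (4 * (delta * (2 * B%:R + 1))) ^+ b' <= mode_ratio ^+ b.
  apply: (@le_trans _ _ (mode_ratio ^+ b')).
    by rewrite lerXn2r ?nnegrE // (le_trans ler01).
  exact: ler_weXn2l.
have -> : gw s (2 * mode_ratio * (2 * window_radius h)) b =
    2 ^+ b * (mode_ratio ^+ b * gw s (2 * window_radius h) b).
  by rewrite gwZ exprMn mulrA.
have G0 : 0 <= gw s (2 * window_radius h) (b') by exact: gw_ge0.
have X0 : 0 <= (2 : R) ^+ b by rewrite exprn_ge0.
have Y0 : 0 <= (samples M)%:R ^+ b' * (2 * mesh M) ^+ b'.
  by rewrite mulr_ge0 ?exprn_ge0 ?(ltW N0) // mulr_ge0 // ltW // mesh_gt0.
apply: (@le_trans _ _ (2 ^+ b * ((samples M)%:R ^+ b' * (2 * mesh M) ^+ b' *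
   ((samples M)%:R * 2 ^+ b')) * gw s (2 * window_radius h) (b'))).
  rewrite ler_wpM2r // -mulrA ler_wpM2l // mulrCA mulrC ler_wpM2l //.
have -> : 2 ^+ b * ((samples M)%:R ^+ b' * (2 * mesh M) ^+ b' *
   ((samples M)%:R * 2 ^+ b')) * gw s (2 * window_radius h) (b')
  = (samples M)%:R * (2 ^+ b * ((4 * (delta * (2 * B%:R + 1))) ^+ b' *
    gw s (2 * window_radius h) (b'))) by rewrite -E2; ring.
rewrite ler_wpM2l ?(ltW N0) // ler_wpM2l //.
by apply: ler_pM => //; rewrite exprn_ge0.
Qed.

Lemma coef_bound h C f k m (a p : 'I_n -> nat) : 1 <= h -> 0 <= C -> gs_bd s h C f ->
  normc (coef k m f) * (\prod_(i < n) (1 + `|kval M (k i)|) ^+ a i *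
     \prod_(i < n) (1 + `|mval M (m i)|) ^+ p i)
  <= (2 ^+ n * Cp ^+ n) * C * (\prod_(i < n) gw s (cell_ratio * h) (a i) *
      \prod_(i < n) gw s (2 * mode_ratio * (2 * window_radius h)) (p i)).
Proof.
move=> h1 C0 gf; have [sf _] := gf.
have N0 := samplesR_gt0 M.
have r1 : 1 <= 2 * window_radius h.
  have : h <= window_radius h by rewrite /window_radius le_max lexx.
  lra.
pose p' i := if mval M (m i) == 0 then 0%N else p i.
have p'_le i : (p' i <= p i)%N by rewrite /p'; case: ifP.
have p'_gw i : gw s (2 * window_radius h) (p' i) <= gw s (2 * window_radius h) (p i).
  by rewrite /p'; case: ifP => // _; rewrite gw0 gw_ge1.
pose Wk := \prod_(i < n) (1 + `|kval M (k i)|) ^+ a i.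
have Wk0 : 0 < Wk by apply: prodr_gt0 => i _; rewrite exprn_gt0 // ltr_pwDl.
pose Z := (2 ^+ n * Cp ^+ n) * C * \prod_(i < n) gw s (cell_ratio * h) (a i).
pose Mx := Z * \prod_(i < n) gw s (2 * window_radius h) (p' i) / Wk.
have bnd y : normc (Cl (mlist p') (fun x => f x * window k x) y) <= Mx.
  rewrite ler_pdivlMr //; apply: le_trans (windowed_bound k a (mlist p') y h1 C0 gf) _.
  by under [X in _ * (_ * X)]eq_bigr do rewrite count_mlist; rewrite mulrA.
have sF := smoothM sf (smooth_window k).
have := sample_sum_bound (mesh_gt0 M) (period_gt) (node_norm m) (samples_gt0 M) sF
  (@sample_window_supp f k) bnd.
set S := sample_sum _ _ _ _ _ => H.
have Mx0 : 0 <= Mx by apply: le_trans (bnd 0); exact: normc_ge0.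
have Z0 : 0 <= Z.
  rewrite !mulr_ge0 ?exprn_ge0 ?(ltW Cp0) ?gw_prod_ge0 // mulr_ge0 //.
    by rewrite (le_trans ler01) // cell_ratio_ge1.
  by rewrite (le_trans ler01).
have S0 := normc_ge0 S.
have K2 : \prod_(i < n) (1 + `|mval M (m i)|) ^+ p i <=
    \prod_(i < n) (2 ^+ p i * (samples M)%:R ^+ p' i) *
    \prod_(i < n) normc (1 - node m i) ^+ p' i.
  rewrite -big_split; apply: ler_prod => i _.
  apply/andP; split; first by rewrite exprn_ge0 ?addr_ge0.
  have c0 := normc_ge0 (1 - node m i).
  change ((1 + `|mval M (m i)|) ^+ p i <=
    2 ^+ p i * (samples M)%:R ^+ p' i * normc (1 - node m i) ^+ p' i).
  rewrite -mulrA -exprMn /p'; case: eqP => [->|/eqP m0].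
    by rewrite normr0 addr0 expr1n expr0 mulr1 exprn_ege1 // ler1n.
  rewrite -exprMn lerXn2r ?nnegrE ?addr_ge0 ?mulr_ge0 // ?(ltW N0) //.
  have m1 : 1 <= `|mval M (m i)|.
    by have [E|//] := mval_int M (m i); rewrite E eqxx in m0.
  have := normc_1Bnode m i; rewrite ler_pdivrMr // => H1.
  rewrite mulrCA mulrC; nra.
have K3 i := coef_factor_bound h1 (p'_le i) (p'_gw i).
have K4 : normc S * \prod_(i < n) (1 + `|mval M (m i)|) ^+ p i <=
   (samples M)%:R ^+ n * \prod_(i < n) gw s (2 * mode_ratio * (2 * window_radius h)) (p i) * (Z / Wk).
  apply: le_trans (ler_wpM2l S0 K2) _; rewrite mulrCA.
  set A := \prod_(i < n) (2 ^+ p i * _).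
  have A0 : 0 <= A by apply: prodr_ge0 => i _; rewrite mulr_ge0 ?exprn_ge0 ?(ltW N0).
  apply: le_trans (ler_wpM2l A0 H) _.
  rewrite /Mx; set X := \prod_(i < n) (_ * (2 * mesh M) ^+ p' i).
  set Y := \prod_(i < n) gw s (2 * window_radius h) (p' i).
  have -> : A * (X * (Z * Y / Wk)) = A * X * Y * (Z / Wk) by ring.
  rewrite ler_wpM2r ?divr_ge0 ?(ltW Wk0) //.
  have -> : (samples M)%:R ^+ n = \prod_(i < n) (samples M)%:R :> R by rewrite prodr_const card_ord.
  rewrite /A /X /Y -!big_split; apply: ler_prod => i _; apply/andP; split; last exact: K3.
  have me0 := ltW (mesh_gt0 M); have w0 : 0 <= 2 * window_radius h by apply: le_trans r1.
  change (0 <= 2 ^+ p i * (samples M)%:R ^+ p' i *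
    ((samples M + p' i)%:R * (2 * mesh M) ^+ p' i) * gw s (2 * window_radius h) (p' i)).
  have m20 : 0 <= (2 * mesh M) ^+ p' i by rewrite exprn_ge0 // mulr_ge0.
  apply: mulr_ge0; last exact: gw_ge0.
  by apply: mulr_ge0; apply: mulr_ge0 => //; rewrite exprn_ge0 // ltW.
rewrite /coef -/S normcM.
have -> : normc ((samples M)%:R ^- n : R[i]) = (samples M)%:R ^- n.
  by rewrite normcV normcX -(rmorph_nat (real_complex R)) normc_real ger0_norm ?ler0n.
have -> : (samples M)%:R ^- n * normc S * (\prod_(i < n) (1 + `|kval M (k i)|) ^+ a i *
     \prod_(i < n) (1 + `|mval M (m i)|) ^+ p i) =
  (samples M)%:R ^- n * Wk * (normc S * \prod_(i < n) (1 + `|mval M (m i)|) ^+ p i).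
  by rewrite -/Wk; ring.
have W1 : 0 <= (samples M)%:R ^- n * Wk by rewrite mulr_ge0 ?invr_ge0 ?exprn_ge0 ?(ltW N0) ?(ltW Wk0).
apply: le_trans (ler_wpM2l W1 K4) _.
have Nn : (samples M)%:R ^+ n != 0 :> R by rewrite expf_neq0 // gt_eqF.
rewrite le_eqVlt; apply/orP; left; apply/eqP; rewrite /Z; field.
by rewrite Nn gt_eqF.
Qed.

Definition coef_radius h : R :=
  2 `^ s * Num.max (cell_ratio * h) (2 * mode_ratio * (2 * window_radius h)).
Definition coef_const H : R := (2 ^+ n * Cp ^+ n) * ((2 * gw s H 2) ^+ n * (2 * gw s H 2) ^+ n).
Definition decay k m : R := \prod_(i < n) ((1 + `|kval M (k i)|) ^+ 2)^-1 *
  \prod_(i < n) ((1 + `|mval M (m i)|) ^+ 2)^-1.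

(** The coefficient bound is applied to the exponents a and p that almost attain
    the two weights, coordinate by coordinate. *)
Lemma coef_weighted h H C f k m : 1 <= h -> coef_radius h <= H -> 0 <= C ->
  gs_bd s h C f ->
  normc (coef k m f) * (kweight H k * mweight H m) <= coef_const H * C * decay k m.
Proof.
move=> h1 hH C0 gf.
have h0 : 0 < h by lra.
pose hk := cell_ratio * h; pose hm := 2 * mode_ratio * (2 * window_radius h).
have hk0 : 0 < hk by rewrite mulr_gt0 // (lt_le_trans ltr01) // cell_ratio_ge1.
have wr0 : 0 < window_radius h by rewrite /window_radius lt_max h0.
have mr0 : 0 < mode_ratio by rewrite /mode_ratio lt_max ltr01.
have hm0 : 0 < hm by rewrite /hm !mulr_gt0.
have kH : 2 `^ s * hk <= H.
  by apply: le_trans hH; rewrite ler_wpM2l ?powR_ge0 // le_max lexx.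
have mH : 2 `^ s * hm <= H.
  by apply: le_trans hH; rewrite ler_wpM2l ?powR_ge0 // le_max lexx orbT.
have H0 : 0 < H by apply: lt_le_trans kH; rewrite mulr_gt0 ?powR_gt0.
have tk i : 1 <= 1 + `|kval M (k i)| by rewrite lerDl.
have tm i : 1 <= 1 + `|mval M (m i)| by rewrite lerDl.
have [a ha] := choice (fun i => gfun_le_pow hs hk0 kH (tk i)).
have [p hp_] := choice (fun i => gfun_le_pow hs hm0 mH (tm i)).
have g0 t : 1 <= t -> 0 <= gfun s H t.
  by move=> t1; rewrite (le_trans ler01) // gfun_ge1 // (le_trans ler01).
have Kk : kweight H k <= \prod_(i < n) (2 * gw s H 2 * ((1 + `|kval M (k i)|) ^+ a i / gw s hk (a i)) *
    ((1 + `|kval M (k i)|) ^+ 2)^-1).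
  by apply: ler_prod => i _; rewrite g0 ?tk //= ha.
have Km : mweight H m <= \prod_(i < n) (2 * gw s H 2 * ((1 + `|mval M (m i)|) ^+ p i / gw s hm (p i)) *
    ((1 + `|mval M (m i)|) ^+ 2)^-1).
  by apply: ler_prod => i _; rewrite g0 ?tm //= hp_.
rewrite prod_quot in Kk; rewrite prod_quot in Km.
have k0 : 0 <= kweight H k by apply: prodr_ge0 => i _; rewrite g0 ?tk.
have m0 : 0 <= mweight H m by apply: prodr_ge0 => i _; rewrite g0 ?tm.
apply: le_trans (ler_wpM2l (normc_ge0 _) (ler_pM k0 m0 Kk Km)) _.
have := coef_bound k m a p h1 C0 gf.
rewrite -/hk -/hm.
have Gk : 0 < \prod_(i < n) gw s hk (a i) by apply: gw_prod_gt0.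
have Gm : 0 < \prod_(i < n) gw s hm (p i) by apply: gw_prod_gt0.
rewrite /coef_const /decay.
set X := \prod_(i < n) (1 + _) ^+ a i; set Y := \prod_(i < n) (1 + _) ^+ p i.
set U := \prod_(i < n) gw s hk _ in Gk *; set V := \prod_(i < n) gw s hm _ in Gm *.
set G := normc _; set D1 := \prod_(i < n) ((1 + `|kval M (k i)|) ^+ 2)^-1.
set D2 := \prod_(i < n) ((1 + `|mval M (m i)|) ^+ 2)^-1.
set c := (2 * gw s H 2) ^+ n => E.
have D10 : 0 <= D1 by apply: prodr_ge0 => i _; rewrite invr_ge0 sqr_ge0.
have D20 : 0 <= D2 by apply: prodr_ge0 => i _; rewrite invr_ge0 sqr_ge0.
have c0 : 0 <= c by rewrite exprn_ge0 // mulr_ge0 // gw_ge0 // ltW.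
have -> : G * (c * (X / U) * D1 * (c * (Y / V) * D2)) =
   (G * (X * Y)) * ((c * c * (D1 * D2)) / (U * V)) by field; rewrite !gt_eqF.
have W0 : 0 <= (c * c * (D1 * D2)) / (U * V) by rewrite divr_ge0 ?mulr_ge0 // ltW.
apply: le_trans (ler_wpM2r W0 E) _.
by rewrite le_eqVlt; apply/orP; left; apply/eqP; field; rewrite !gt_eqF.
Qed.

Lemma coef_const_gt0 H : 0 < H -> 0 < coef_const H.
Proof. by move=> H0; rewrite !mulr_gt0 ?exprn_gt0 ?mulr_gt0 ?gw_gt0. Qed.

Lemma decay_sum : \sum_k \sum_m decay k m <= 16 ^+ n.
Proof.
under eq_bigr do rewrite -mulr_sumr.
rewrite -mulr_suml.
have -> : 16 = 4 * 4 :> R by ring.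
rewrite exprMn; apply: ler_pM.
- by apply: sumr_ge0 => k _; apply: prodr_ge0 => i _; rewrite invr_ge0 sqr_ge0.
- by apply: sumr_ge0 => k _; apply: prodr_ge0 => i _; rewrite invr_ge0 sqr_ge0.
- rewrite -(bigA_distr_bigA (fun (i : 'I_n) (j : 'I_(cells M)) => ((1 + `|kval M j|) ^+ 2)^-1)).
  rewrite -[X in _ <= _ ^+ X](card_ord n) -prodr_const; apply: ler_prod => i _.
  rewrite sum_inv_sq_dist andbT; apply: sumr_ge0 => j _.
  by rewrite invr_ge0 sqr_ge0.
- rewrite -(bigA_distr_bigA (fun (i : 'I_n) (j : 'I_(samples M)) => ((1 + `|mval M j|) ^+ 2)^-1)).
  rewrite -[X in _ <= _ ^+ X](card_ord n) -prodr_const; apply: ler_prod => i _.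
  rewrite sum_inv_sq_dist andbT; apply: sumr_ge0 => j _.
  by rewrite invr_ge0 sqr_ge0.
Qed.

(** Trigonometric interpolation of f times the window of a cell, cut off and
    summed over the cells. *)
Definition approx f : 'rV[R]_n -> R[i] :=
  fun x => \sum_k \sum_m coef k m f * atom k m x.

(** The inverse squares gained in [gfun_le_pow] make the weighted coefficients
    summable over cells and modes, with a bound that does not involve M. *)
Lemma coef_l1 h H C f : 1 <= h -> coef_radius h <= H -> 0 < H -> 0 <= C -> gs_bd s h C f ->
  \sum_k \sum_m normc (coef k m f) * (kweight H k * mweight H m)
  <= coef_const H * 16 ^+ n * C.
Proof.
move=> h1 hH H0 C0 gf.
have cc0 : 0 <= coef_const H * C by rewrite mulr_ge0 // ltW // coef_const_gt0.
rewrite mulrAC; apply: le_trans _ (ler_wpM2l cc0 decay_sum).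
rewrite mulr_sumr; apply: ler_sum => k _; rewrite mulr_sumr; apply: ler_sum => m _.
exact: (coef_weighted k m h1 hH C0 gf).
Qed.

Lemma cell_gevrey_bd rho C k F : smooth F -> 0 <= rho ->
  0 <= C -> (forall x, in_cell k x -> maj s rho C F x) ->
  (forall x, ~ in_cell k x -> maj s rho 0 F x) ->
  gevrey_bd s rho (delta * (M%:R + B%:R)) C F.
Proof.
move=> sF r0 C0 hin hout.
have out x : (exists i, delta * (M%:R + B%:R) < `|x 0 i|) -> ~ in_cell k x.
  move=> [i xi] /(_ i) ic.
  have kM : `|kval M (k i)| <= M%:R.
    rewrite /kval ler_norml lerBrDl subrr ler0n lerBlDl -natrD ler_nat /= addnn.
    by rewrite -ltnS ltn_ord.
  have : `|x 0 i / delta| <= M%:R + B%:R.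
    by rewrite -[x 0 i / delta](subrK (kval M (k i))) addrC (le_trans (ler_normD _ _)) // lerD.
  rewrite normrM normfV (gtr0_norm delta0) ler_pdivrMr // mulrC => H1.
  by have := lt_le_trans xi H1; rewrite ltxx.
split=> //.
- move=> x /out oc; have := maj_normc (hout x oc) => Z.
  by apply: eq0_normc; apply/eqP; rewrite eq_le Z normc_ge0.
- move=> x; have [ic|oc] := pselect (in_cell k x); first exact: hin.
  exact: (maj_le r0 (lexx _) C0 (hout x oc)).
Qed.

Lemma atom_gevrey H k m : 0 < H ->
  gevrey_bd s (atom_radius H) (delta * (M%:R + B%:R)) ((2 ^+ n * Cp ^+ n) * mweight H m) (atom k m).
Proof.
move=> H0; apply: cell_gevrey_bd => [|||x _|x].
- exact: smooth_atom.
- by rewrite mulr_ge0 // ltW // radius_half_gt0.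
- exact: maj_C (maj_atom k m 0 H0).
- exact: maj_atom.
- exact: atom_out.
Qed.

Lemma atom_Gevrey k m : Gevrey s (atom k m).
Proof.
apply: gevrey_bd_Gevrey (atom_gevrey k m ltr01).
by rewrite /atom_radius mulr_gt0 // radius_half_gt0.
Qed.

Lemma approx_pairs f : approx f =
  (fun x => \sum_(km : {ffun 'I_n -> 'I_(cells M)} * {ffun 'I_n -> 'I_(samples M)})
     coef km.1 km.2 f * atom km.1 km.2 x).
Proof. by apply: funext => x; rewrite /approx pair_bigA. Qed.

Lemma approx_Gevrey f : Gevrey s (approx f).
Proof.
rewrite approx_pairs.
apply: (@sum_closed _ _ (Gevrey s (n := n)) (Gevrey0 s n) (@Gevrey_lin _ s n) _ _
  (fun km => coef km.1 km.2 f) (fun km => atom km.1 km.2)) => km.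
exact: atom_Gevrey.
Qed.

Lemma smooth_approx f : smooth (approx f).
Proof.
by apply: smooth_sum => k; apply: smooth_sum => m; apply: smoothZ; exact: smooth_atom.
Qed.

Definition approx_const H : R := (2 ^+ n * Cp ^+ n) * (coef_const H * 16 ^+ n).

Lemma maj_approx h H C f x : 1 <= h -> coef_radius h <= H -> 0 < H -> 0 <= C ->
  gs_bd s h C f -> maj s (atom_radius H) (approx_const H * C) (approx f) x.
Proof.
move=> h1 hH H0 C0 gf.
have r0 : 0 < atom_radius H by rewrite /atom_radius mulr_gt0 // radius_half_gt0.
have sA k m : smooth (fun x => coef k m f * atom k m x) := smoothZ _ (smooth_atom k m).
have := @maj_sum _ s n _ (index_enum _) (atom_radius H)
  (fun k => \sum_m normc (coef k m f) * ((2 ^+ n * Cp ^+ n) * mweight H m))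
  (fun k x => \sum_m coef k m f * atom k m x) x.
move=> /(_ (fun k => smooth_sum _ (sA k))) H1.
apply: (maj_le (ltW r0) (lexx _) _ (H1 _)).
  rewrite /approx_const -mulrA; apply: le_trans (ler_wpM2l _ (coef_l1 h1 hH H0 C0 gf)); last first.
    by rewrite mulr_ge0 ?exprn_ge0 // ltW.
  rewrite mulr_sumr; apply: ler_sum => k _; rewrite mulr_sumr; apply: ler_sum => m _.
  rewrite mulrCA ler_wpM2l ?mulr_ge0 ?exprn_ge0 ?(ltW Cp0) //.
  rewrite ler_wpM2l ?normc_ge0 // ler_peMl ?kweight_ge1 //.
  by rewrite (le_trans ler01) // mweight_ge1.
move=> k; apply: maj_sum => [m|m]; first exact: sA.
by apply: majZ; [exact: smooth_atom|exact: maj_atom].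
Qed.

Lemma coef_supp f r k m : (forall x, (exists i, r < `|x 0 i|) -> f x = 0) ->
  (exists i, r < delta * (`|kval M (k i)| - B%:R)) -> coef k m f = 0.
Proof.
move=> f0 [i hi]; rewrite /coef /sample_sum big1 ?mulr0 // => j _.
set y := sample_pt _ _ _.
have [ic|oc] := pselect (in_cell k y); last by rewrite (window_out0 oc) !mulr0.
rewrite f0 ?mul0r ?mulr0 //; exists i; apply: lt_le_trans hi _.
have := ic i; have := ler_normB (y 0 i / delta) (y 0 i / delta - kval M (k i)).
rewrite opprB addrC subrK => h1 h2.
have -> : `|y 0 i| = delta * `|y 0 i / delta|.
  by rewrite normrM normfV (gtr0_norm delta0); field; rewrite gt_eqF.
rewrite ler_wpM2l ?(ltW delta0) //; lra.
Qed.

Lemma approx_supp f r x : (forall x, (exists i, r < `|x 0 i|) -> f x = 0) ->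
  (exists i, r + 2 * B%:R * delta < `|x 0 i|) -> approx f x = 0.
Proof.
move=> f0 [i hi]; rewrite /approx big1 // => k _; rewrite big1 // => m _.
have [ic|oc] := pselect (in_cell k x); last first.
  by rewrite /atom (plateau_out0 oc) !mulr0.
rewrite (coef_supp _ f0) ?mul0r //; exists i.
have := ic i; have := ler_normD (x 0 i / delta - kval M (k i)) (kval M (k i)).
rewrite subrK => h1 h2.
have xE : `|x 0 i| = delta * `|x 0 i / delta|.
  by rewrite normrM normfV (gtr0_norm delta0); field; rewrite gt_eqF.
rewrite xE in hi; have d0 := delta0; nra.
Qed.

(** Orthogonality of the characters in each variable; the cut-off is 1 wherever
    the window does not vanish. *)
Lemma interpolation f k (j' : {ffun 'I_n -> 'I_(samples M)}) :
  let x := sample_pt (mesh M) (corner k) j' in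
  \sum_m coef k m f * atom k m x = f x * window k x.
Proof.
move=> x; have N0 := samplesR_gt0 M.
have [ic|oc] := pselect (in_cell k x); last first.
  by rewrite window_out0 // mulr0 big1 // => m _; rewrite /atom plateau_out0 // !mulr0.
pose Nn : R[i] := (samples M)%:R ^- n.
pose F := fun y => f y * window k y.
pose z (m : {ffun 'I_n -> 'I_(samples M)}) (j : {ffun 'I_n -> 'I_(samples M)}) :=
  \prod_(i < n) node m i ^+ j i.
transitivity (Nn * plateau k x * \sum_j F (sample_pt (mesh M) (corner k) j) *
    \sum_m (z m j * mode k m x)).
  rewrite mulr_sumr; under [RHS]eq_bigr do rewrite mulr_sumr mulr_sumr.
  rewrite exchange_big /=; apply: eq_bigr => m _.
  rewrite /coef /sample_sum /atom -/Nn -/F mulr_sumr mulr_suml.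
  by apply: eq_bigr => j _; rewrite -/(z m j) /F; ring.
have inner j : \sum_m (z m j * mode k m x) = if j == j' then (samples M)%:R ^+ n else 0.
  pose G (i : 'I_n) (m : 'I_(samples M)) : R[i] :=
    cis (2 * pi * ((m%:R - (mode0 M)%:R) * ((j' i)%:R - (j i)%:R) / (samples M)%:R)).
  transitivity (\sum_(m : {ffun 'I_n -> 'I_(samples M)}) \prod_(i < n) G i (m i)).
    apply: eq_bigr => m _; rewrite /z /mode /prodf -big_split /=.
    apply: eq_bigr => i _; rewrite /exp_tower expr0 mul1r /node -cisMn -cisD /G.
    congr cis; rewrite /x !mxE /freq /mval /mesh samplesR.
    rewrite -[_ *+ j i]mulr_natr; field.
    by rewrite !gt_eqF ?cellsR_gt0 ?delta0 // ltr_wpDl // mulr_ge0.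
  rewrite -(bigA_distr_bigA G).
  have S i : \sum_(m < samples M) G i m = if j i == j' i then (samples M)%:R else 0.
    pose d := ((j' i - j i) + (j i - j' i))%N.
    have dE : `|(j' i)%:R - (j i)%:R| = d%:R :> R.
      rewrite /d; have [h|h] := leqP (j i) (j' i).
        by rewrite -natrB // ger0_norm // (eqP h) addn0.
      by rewrite distrC -natrB ?(ltnW h) // ger0_norm // (eqP (ltnW h)).
    have dN : (d < samples M)%N by rewrite /d; have := ltn_ord (j i); have := ltn_ord (j' i); lia.
    rewrite (sum_cis _ (samples_gt0 M) dE dN).
    have -> : (d == 0%N) = (j i == j' i).
      by rewrite -val_eqE /= /d; apply/eqP/eqP; lia.
    by [].
  under eq_bigr do rewrite S.
  have [->|ne] := eqVneq j j'.
    under eq_bigr do rewrite eqxx.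
    by rewrite prodr_const card_ord.
  have [i ji] : exists i, j i != j' i.
    apply: contrapT => H; move/eqP: ne; apply; apply/ffunP => i.
    by apply/eqP; apply: contrapT => /negP ij; apply: H; exists i.
  by rewrite (bigD1 i) //= (negbTE ji) mul0r.
rewrite (bigD1 j') //= inner eqxx big1 ?addr0; last first.
  by move=> j /negbTE jj; rewrite inner jj mulr0.
have Nn0 : ((samples M)%:R : R[i]) ^+ n != 0.
  by rewrite expf_neq0 // pnatr_eq0 -lt0n samples_gt0.
have pw : plateau k x * window k x = window k x.
  rewrite /plateau /window /prodf -big_split; apply: eq_bigr => i _.
  rewrite /scaled !expr0 !mul1r.
  set u := x 0 i / delta - kval M (k i).
  change ((tt 0%N u)%:C%C * (th 0%N u)%:C%C = (th 0%N u)%:C%C :> R[i]).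
  have [-> |ne] := eqVneq (th 0%N u) 0; first by rewrite mulr0.
  by rewrite (tt_plateau P ne) mul1r.
rewrite -/x /F /Nn -[in RHS]pw; field.
by [].
Qed.

(** Interpolation is exact at the grid points of each cell, so that only the sum
    of the windows remains. *)
Lemma approx_grid f x : (forall i, exists q : int, x 0 i = mesh M * q%:~R) ->
  approx f x = f x * \prod_(i < n) ((\sum_(k < cells M) th 0%N (x 0 i / delta - kval M k))%:C)%C.
Proof.
move=> gx.
transitivity (\sum_k f x * window k x).
  apply: eq_bigr => k _; have [ic|oc] := pselect (in_cell k x); last first.
    by rewrite window_out0 // mulr0 big1 // => m _; rewrite /atom plateau_out0 // !mulr0.
  have key i : exists j : 'I_(samples M), x 0 i = corner k 0 i + j%:R * mesh M.
    have [q xq] := gx i; have := ic i.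
    pose c : int := ((k i)%:Z - M%:Z - B%:Z) * (cells M)%:Z.
    have c0 := cellsR_gt0 M.
    have E : x 0 i / delta - kval M (k i) + B%:R = (q - c)%:~R / (cells M)%:R.
      rewrite xq /mesh /c /kval !(intrD, intrM, mulrNz, rmorphN) /= -!pmulrn.
      by field; rewrite !gt_eqF.
    rewrite ler_norml => /andP[lo hi].
    have q0 : 0 <= q - c.
      rewrite -(ler_int R) -(pmulr_lge0 _ (_ : 0 < (cells M)%:R^-1)) ?invr_gt0 // -E; lra.
    case: (q - c) q0 E => // j _ E.
    have jN : (j < samples M)%N.
      rewrite -(ltr_nat R) samplesR; have : j%:R / (cells M)%:R <= 2 * B%:R :> R.
        by rewrite -[j%:R]/(j%:~R) -E; lra.
      rewrite ler_pdivrMr // => H; apply: le_lt_trans H _.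
      by rewrite ltr_pM2r // ltrDl.
    exists (Ordinal jN); rewrite mxE /mesh /=.
    have -> : x 0 i = delta * (x 0 i / delta) by field; rewrite gt_eqF.
    have -> : x 0 i / delta = kval M (k i) - B%:R + j%:~R / (cells M)%:R by rewrite -E; ring.
    by field; rewrite gt_eqF.
  have [j hj] := choice key.
  have -> : x = sample_pt (mesh M) (corner k) [ffun i => j i].
    by apply/rowP => i; rewrite [RHS]mxE ffunE hj.
  exact: interpolation.
rewrite -mulr_sumr; congr (_ * _).
have E i : ((\sum_(k < cells M) th 0%N (x 0 i / delta - kval M k))%:C)%C =
    \sum_(k < cells M) scaled th (kval M k) 0%N (x 0 i).
  by rewrite raddf_sum; apply: eq_bigr => k _; rewrite /scaled expr0 mul1r.
under [RHS]eq_bigr do rewrite E.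
by rewrite (bigA_distr_bigA (fun i (k : 'I_(cells M)) => scaled th (kval M k) 0%N (x 0 i))).
Qed.

(** On the cell numbered k a coordinate is at most a multiple of 1 + |k|, whose
    powers are dominated by the weight of k. *)
Lemma cell_gs_bd rho H C k F : 0 < rho -> 0 < H -> 0 <= C -> smooth F ->
  (forall x, in_cell k x -> maj s rho C F x) ->
  (forall x, ~ in_cell k x -> maj s rho 0 F x) ->
  gs_bd s (Num.max rho (delta * (B%:R + 1) * H)) (C * kweight H k) F.
Proof.
move=> r0 H0 C0 sF hin hout; split=> // a l x.
set h := Num.max _ _; have rh : rho <= h by rewrite le_max lexx.
have dh : delta * (B%:R + 1) * H <= h by rewrite le_max lexx orbT.
have d0 : 0 <= delta * (B%:R + 1) by rewrite mulr_ge0 ?addr_ge0 // ltW.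
have h0 : 0 < h := lt_le_trans r0 rh.
have k0 : 0 <= kweight H k := le_trans ler01 (kweight_ge1 k H0).
have [ic|oc] := pselect (in_cell k x); last first.
  have := hout x oc l; rewrite mul0r => Z.
  have -> : normc (Cl l F x) = 0 by apply/eqP; rewrite eq_le Z normc_ge0.
  by rewrite mulr0 !mulr_ge0 ?gw_prod_ge0 // ltW.
rewrite mulrC -mulrA mulrA; rewrite (mulrC _ (\prod_(i < n) gw s h (count_mem i l))) mulrA.
rewrite [X in _ <= X](_ : _ = (C * \prod_(i < n) gw s h (count_mem i l)) *
   (kweight H k * \prod_(i < n) gw s h (a i))); last by ring.
apply: ler_pM; rewrite ?normc_ge0 //.
  by apply: le_trans (hin x ic l) _; rewrite ler_wpM2l // gw_prod_le // ltW.
rewrite /monom normr_prod -big_split; apply: ler_prod => i _; apply/andP; split=> //.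
change (`|x 0 i ^+ a i| <= gfun s H (1 + `|kval M (k i)|) * gw s h (a i)).
rewrite normrX.
have xi : `|x 0 i| <= delta * (B%:R + 1) * (1 + `|kval M (k i)|).
  have -> : `|x 0 i| = delta * `|x 0 i / delta|.
    by rewrite normrM normfV (gtr0_norm delta0); field; rewrite gt_eqF.
  rewrite -mulrA ler_wpM2l ?(ltW delta0) //.
  have := ic i; have := ler_normD (x 0 i / delta - kval M (k i)) (kval M (k i)).
  rewrite subrK; have : 0 <= B%:R :> R by [].
  have : 0 <= `|kval M (k i)| by [].
  nra.
have t1 : 0 <= 1 + `|kval M (k i)| by rewrite addr_ge0.
have w0 := mulr_ge0 d0 t1.
apply: (@le_trans _ _ ((delta * (B%:R + 1) * (1 + `|kval M (k i)|)) ^+ a i)).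
  by rewrite lerXn2r ?nnegrE.
have da0 : 0 <= (delta * (B%:R + 1)) ^+ a i by rewrite exprn_ge0.
rewrite exprMn; apply: le_trans (ler_wpM2l da0 (gfun_ub hs (a i) H0 t1)) _.
have g0 : 0 <= gfun s H (1 + `|kval M (k i)|) by rewrite (le_trans ler01) // gfun_ge1.
rewrite mulrCA -gwZ ler_wpM2l //; apply: gw_le => //.
by apply: mulr_ge0 => //; exact: ltW.
Qed.

(** The approximation is a combination of the samples of f, with coefficients that
    are products of these real functions of one variable; hence it commutes with
    conjugation and with tensor products. *)
Definition ker1 (k : 'I_(cells M)) (j : 'I_(samples M)) (t : R) : R[i] :=
  (samples M)%:R^-1 * scaled th (kval M k) 0 (delta * (kval M k - B%:R) + j%:R * mesh M) *
  scaled tt (kval M k) 0 t *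
  \sum_(m < samples M) cis (mval M m *
    (freq 1 * (t - delta * (kval M k - B%:R)) - 2 * pi / (samples M)%:R * j%:R)).

Lemma approx_kernel f x : approx f x =
  \sum_k \sum_j f (sample_pt (mesh M) (corner k) j) * \prod_(i < n) ker1 (k i) (j i) (x 0 i).
Proof.
apply: eq_bigr => k _.
transitivity (\sum_(j : {ffun 'I_n -> 'I_(samples M)}) \sum_(m : {ffun 'I_n -> 'I_(samples M)})
   (samples M)%:R ^- n * f (sample_pt (mesh M) (corner k) j) *
   window k (sample_pt (mesh M) (corner k) j) * plateau k x *
   ((\prod_(i < n) node m i ^+ j i) * mode k m x)).
  rewrite exchange_big /=; apply: eq_bigr => m _.
  rewrite /coef /sample_sum /atom mulr_sumr mulr_suml.
  by apply: eq_bigr => j _; ring.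
apply: eq_bigr => j _; rewrite -mulr_sumr.
pose G i (m : 'I_(samples M)) : R[i] := cis (mval M m *
    (freq 1 * (x 0 i - delta * (kval M (k i) - B%:R)) - 2 * pi / (samples M)%:R * (j i)%:R)).
have -> : \sum_m ((\prod_(i < n) node m i ^+ j i) * mode k m x) =
    \prod_(i < n) \sum_(m < samples M) G i m.
  rewrite bigA_distr_bigA; apply: eq_bigr => m _; rewrite /mode /prodf -big_split.
  apply: eq_bigr => i _; rewrite /exp_tower expr0 mul1r /node /G.
  rewrite -[LHS]/(cis _ ^+ _ * cis _) -cisMn -cisD; congr cis.
  rewrite -[_ *+ j i]mulr_natr /freq; field.
  by rewrite !gt_eqF ?samplesR_gt0 ?delta0 // ltr_wpDl // mulr_ge0.
have -> : (samples M)%:R ^- n = \prod_(i < n) (samples M)%:R^-1 :> R[i].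
  by rewrite prodr_const card_ord exprVn.
rewrite /ker1 -/(G _ _) !big_split /= /window /plateau /prodf.
under [\prod_(i < n) scaled th _ _ (sample_pt _ _ _ _ _)]eq_bigr do rewrite !mxE.
by rewrite !mulrA (mulrC (f _)).
Qed.

Lemma mval_rev (m : 'I_(samples M)) : mval M (rev_ord m) = - mval M m.
Proof.
have sE : (samples M)%:R = 2 * (mode0 M)%:R + 1 :> R.
  by rewrite {1}samples_mode0 -natr1 -muln2 natrM mulrC.
rewrite /mval (_ : (rev_ord m)%:R = (samples M)%:R - m.+1%:R); last by rewrite -natrB.
by rewrite sE -natr1; ring.
Qed.

Lemma ker1_real (k : 'I_(cells M)) (j : 'I_(samples M)) t : (ker1 k j t)^*%C = ker1 k j t.
Proof.
rewrite /ker1 !rmorphM /= !oppr0; congr (_ * _).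
  by rewrite fmorphV /= conjc_nat.
rewrite rmorph_sum [RHS](reindex_inj rev_ord_inj); apply: eq_bigr => m _.
set X := freq 1 * _ - _.
change ((cis (mval M m * X))^*%C = cis (mval M (rev_ord m) * X)).
by rewrite -cisN mval_rev mulNr.
Qed.

Lemma approxJ f : approx (fun x => (f x)^*%C) = (fun x => (approx f x)^*%C).
Proof.
apply: funext => x; rewrite !approx_kernel rmorph_sum; apply: eq_bigr => k _.
rewrite rmorph_sum; apply: eq_bigr => j _; rewrite rmorphM rmorph_prod.
by congr (_ * _); apply: eq_bigr => i _; rewrite [RHS]ker1_real.
Qed.

Definition mode_opp m : {ffun 'I_n -> 'I_(samples M)} := [ffun i => rev_ord (m i)].

Lemma atomJ k m x : (atom k m x)^*%C = atom k (mode_opp m) x.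
Proof.
rewrite /atom rmorphM /mode /plateau /prodf !rmorph_prod; congr (_ * _).
  apply: eq_bigr => i _; rewrite /exp_tower !expr0 !mul1r.
  rewrite -[LHS]/((cis _)^*%C) -cisN ffunE mval_rev; congr cis.
  by rewrite /freq; ring.
by apply: eq_bigr => i _; rewrite /scaled /= oppr0.
Qed.

Lemma mweight_opp H m : mweight H (mode_opp m) = mweight H m.
Proof. by apply: eq_bigr => i _; rewrite ffunE mval_rev normrN. Qed.

End Stage.

Lemma mesh_le (t : R) : 0 < t -> exists M0, forall M, (M0 <= M)%N -> mesh M <= t.
Proof.
move=> t0; have /archi_boundP := divr_ge0 (ltW delta0) (ltW t0) => H.
exists (Num.bound (delta / t)) => M MM.
rewrite /mesh ler_pdivrMr ?cellsR_gt0 // mulrC -ler_pdivrMr //.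
apply: le_trans (ltW H) _; rewrite ler_nat; apply: leq_trans MM _.
by rewrite /cells -addnn -addnS leq_addr.
Qed.

Lemma approx_grid_large f r : (forall x, (exists i, r < `|x 0 i|) -> f x = 0) ->
  exists M0, forall M x, (M0 <= M)%N -> (forall i, exists q : int, x 0 i = mesh M * q%:~R) ->
    approx M f x = f x.
Proof.
move=> f0; have [M0 hM0] : exists M0 : nat, r / delta + B%:R <= M0%:R.
  exists (Num.bound (`|r / delta + B%:R|)).
  apply: le_trans (ler_norm _) _; apply: ltW; exact: archi_boundP.
exists M0 => M y MM gy; rewrite approx_grid //.
have [H|H] := pselect (forall i, `|y 0 i / delta| + B%:R <= M%:R).
  rewrite big1 ?mulr1 // => i _.
  by have := th_sum P (H i); rewrite /kval /cells => ->.
have [i hi] : exists i, ~ (`|y 0 i / delta| + B%:R <= M%:R) by exact/existsNP.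
move/negP: hi; rewrite -ltNge => hi.
rewrite f0 ?mul0r //; exists i.
have : r / delta + B%:R < `|y 0 i / delta| + B%:R.
  by apply: le_lt_trans hM0 (le_lt_trans _ hi); rewrite ler_nat.
by rewrite ltrD2r normrM normfV (gtr0_norm delta0) ltr_pM2r // invr_gt0.
Qed.

(** The approximations are bounded in one Gevrey norm and coincide with f on grids
    of vanishing mesh, so that they converge uniformly. *)
Lemma approx_converges h r C f : 1 <= h -> 0 < r -> 0 <= C -> gevrey_bd s h r C f ->
  exists h' r', 1 <= h' /\ forall e, 0 < e -> exists M0, forall M, (M0 <= M)%N ->
    gevrey_bd s h' r' e (fun x => approx M f x - f x).
Proof.
move=> h1 r0 C0 gf; have [sf f0 mf] := gf.
have gsf := gevrey_bd_gs hs h1 r0 C0 gf.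
pose h2 := Num.max h r; have h21 : 1 <= h2 by rewrite le_max h1.
pose H := Num.max (coef_radius h2) 1.
have H0 : 0 < H by rewrite lt_max ltr01 orbT.
have cH : coef_radius h2 <= H by rewrite le_max lexx.
pose a := Num.max (atom_radius H) h; have a1 : 1 <= a by rewrite le_max h1 orbT.
pose A := approx_const H * C + C.
pose g M x := approx M f x - f x.
have gE M : g M = (fun x => approx M f x + (-1) * f x) by apply: funext => x; rewrite mulN1r.
have sN := smoothZ (-1) sf.
have sg M : smooth (g M) by rewrite gE; exact: smoothD (smooth_approx M f) sN.
have ar0 : 0 <= atom_radius H by rewrite mulr_ge0 // ltW // radius_half_gt0.
have mg M x : maj s a A (g M) x.
  rewrite gE; apply: (majD (smooth_approx M f) sN).
    apply: (maj_le ar0 _ (lexx _) (maj_approx M x h21 cH H0 C0 gsf)).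
    by rewrite le_max lexx.
  have := majZ (-1) sf (mf x); rewrite normcN normc1 mul1r.
  by apply: maj_le; rewrite ?le_max ?lexx ?orbT //; lra.
have A0 : 0 <= A := maj_C (mg 0%N 0).
have conv0 : forall e, 0 < e -> exists M0, forall M x, (M0 <= M)%N -> normc (g M x) <= e.
  move=> e e0.
  have [A1 A10 A1E] : exists2 A1, 0 < A1 & A * gw s a 1 ^+ n <= A1.
    exists (A * gw s a 1 ^+ n + 1); last by rewrite lerDl.
    by rewrite ltr_wpDl // mulr_ge0 // exprn_ge0 // gw_ge0 //; lra.
  have lip M i z : normc (cpart i (g M) z) <= A1.
    have := mg M z [:: i]; move/le_trans; apply; apply: le_trans A1E.
    rewrite ler_wpM2l // -[X in _ ^+ X](card_ord n) -prodr_const; apply: ler_prod => j _.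
    rewrite gw_ge0 /=; last lra.
    by apply: gw_leS => //; rewrite addn0; case: (i == j).
  have t0 : 0 < e / (2 * A1 * (n%:R + 1)).
    by rewrite divr_gt0 // !mulr_gt0 // ltr_wpDl.
  have [M1 hM1] := mesh_le t0.
  have [M2 hM2] := approx_grid_large f0.
  exists (maxn M1 M2) => M x; rewrite geq_max => /andP[MM1 MM2].
  have me0 := mesh_gt0 M.
  pose q : 'rV[R]_n := \row_i (mesh M * (Num.floor (x 0 i / mesh M))%:~R).
  have gq : g M q = 0.
    rewrite /g hM2 ?subrr // => i; exists (Num.floor (x 0 i / mesh M)); by rewrite mxE.
  have dist i : `|x 0 i - q 0 i| <= mesh M.
    rewrite mxE; have /andP[l1 l2] := floor_itv (x 0 i / mesh M).
    rewrite ler_pdivlMr // mulrC in l1; rewrite ltr_pdivrMr // intrD mulrDl mul1r mulrC in l2.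
    by rewrite ger0_norm ?subr_ge0 // lerBlDl ltW.
  rewrite -[g M x]subr0 -gq; apply: le_trans (lipschitz_of_partials x q (sg M) (lip M)) _.
  apply: (@le_trans _ _ (2 * A1 * (n%:R * mesh M))).
    rewrite ler_wpM2l ?mulr_ge0 ?(ltW A10) //.
    apply: le_trans (ler_sum _ (fun i _ => dist i)) _.
    by rewrite sumr_const card_ord mulr_natl.
  have den0 : 0 < 2 * A1 * (n%:R + 1).
    by apply: mulr_gt0; [exact: mulr_gt0|rewrite ltr_wpDl].
  have := hM1 M MM1; rewrite ler_pdivlMr // => Hm; apply: le_trans Hm.
  have -> : mesh M * (2 * A1 * (n%:R + 1)) = 2 * A1 * (n%:R * mesh M) + mesh M * (2 * A1).
    by ring.
  rewrite lerDl; apply: mulr_ge0; first exact: ltW.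
  by apply: mulr_ge0 => //; exact: ltW.
have mc := maj_converges hs a1 sg mg conv0.
exists (2 * a), (r + 2 * B%:R * delta); split; first lra.
move=> e e0; have [M0 hM0] := mc e e0; exists M0 => M MM; split; first exact: sg.
- move=> x hx; rewrite (approx_supp M f0 hx) f0 ?subr0 //.
  case: hx => i hi; exists i; apply: le_lt_trans hi.
  by rewrite lerDl !mulr_ge0 // ltW.
- by move=> x; exact: hM0.
Qed.

End Multi.
End Frame.
(** * Tensor products *)

Section Split.
Variables (T : finType) (p q : nat).

Definition fcat (a : {ffun 'I_p -> T}) (b : {ffun 'I_q -> T}) : {ffun 'I_(p + q) -> T} :=
  [ffun i => match fintype.split i with inl j => a j | inr j => b j end].

Lemma fcat_lshift a b j : fcat a b (lshift q j) = a j.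
Proof. by rewrite ffunE; case: split_ordP => j' /eqP; rewrite eq_shift // => /eqP ->. Qed.

Lemma fcat_rshift a b j : fcat a b (rshift p j) = b j.
Proof. by rewrite ffunE; case: split_ordP => j' /eqP; rewrite eq_shift // => /eqP ->. Qed.

Lemma fcat_split (k : {ffun 'I_(p + q) -> T}) :
  k = fcat [ffun j => k (lshift q j)] [ffun j => k (rshift p j)].
Proof. by apply/ffunP => i; rewrite [RHS]ffunE; case: split_ordP => j ->; rewrite ffunE. Qed.

Lemma sum_fcat (V : nmodType) (F : {ffun 'I_(p + q) -> T} -> V) :
  \sum_k F k = \sum_a \sum_b F (fcat a b).
Proof.
rewrite pair_bigA /=; apply: (reindex (fun ab => fcat ab.1 ab.2)); apply: onW_bij.
exists (fun k : {ffun 'I_(p + q) -> T} => ([ffun j => k (lshift q j)], [ffun j => k (rshift p j)])).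
  move=> [a b]; congr (_, _); apply/ffunP => j; rewrite ffunE.
    by rewrite fcat_lshift.
  by rewrite fcat_rshift.
by move=> k; rewrite -fcat_split.
Qed.

End Split.

Lemma continuous_of_lipschitz (R : realType) (m n : nat) (A : 'rV[R]_m -> 'rV[R]_n) (c : R) :
  0 < c -> (forall z t i, `|(A z - A t) 0 i| <= c * `|z - t|) -> continuous A.
Proof.
move=> c0 lip z U HU; have /nbhs_normP[e /= e0 eU] := HU.
apply: ((iffRL (@nbhs_normP R 'rV[R]_m z (A @^-1` U)))).
exists (e / (2 * c)) => /=; first by rewrite divr_gt0 // mulr_gt0.
move=> t /= zt; apply: eU => /=.
apply: (@le_lt_trans _ _ (e / 2)); last lra.
apply: norm_le_coord => [|i]; first lra.
apply: le_trans (lip z t i) _.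
move: zt; rewrite /ball_ /= => /ltW; rewrite ler_pdivlMr ?mulr_gt0 // => H.
lra.
Qed.

Section TensorBound.
Variables (R : realType) (s : R) (d : nat).
Implicit Types (f g : 'rV[R]_d -> R[i]) (l : seq 'I_(d + d)).

Definition half (i : 'I_(d + d)) : 'I_d := match fintype.split i with inl j => j | inr j => j end.
Definition is_left (i : 'I_(d + d)) : bool := if fintype.split i is inl _ then true else false.

Lemma is_left_lshift j : is_left (lshift d j).
Proof. by rewrite /is_left; case: split_ordP => j' /eqP; rewrite eq_shift. Qed.
Lemma is_left_rshift j : is_left (rshift d j) = false.
Proof. by rewrite /is_left; case: split_ordP => j' /eqP; rewrite eq_shift. Qed.
Lemma half_lshift j : half (lshift d j) = j.
Proof. by rewrite /half; case: split_ordP => j' /eqP; rewrite eq_shift // => /eqP. Qed.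
Lemma half_rshift j : half (rshift d j) = j.
Proof. by rewrite /half; case: split_ordP => j' /eqP; rewrite eq_shift // => /eqP. Qed.

Lemma lsubmx_basis i (h : R) (y : 'rV[R]_(d + d)) :
  lsubmx (h *: delta_mx 0 i + y) =
  h *: ((is_left i)%:R *: delta_mx 0 (half i)) + lsubmx y.
Proof.
apply/rowP => j; rewrite !mxE /=; congr (_ * _ + _).
case: (split_ordP i) => k ->; rewrite ?is_left_lshift ?is_left_rshift ?half_lshift ?half_rshift.
  by rewrite mul1r eq_shift.
by rewrite mul0r eq_shift.
Qed.

Lemma rsubmx_basis i (h : R) (y : 'rV[R]_(d + d)) :
  rsubmx (h *: delta_mx 0 i + y) =
  h *: ((~~ is_left i)%:R *: delta_mx 0 (half i)) + rsubmx y.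
Proof.
apply/rowP => j; rewrite !mxE /=; congr (_ * _ + _).
case: (split_ordP i) => k ->; rewrite ?is_left_lshift ?is_left_rshift ?half_lshift ?half_rshift.
  by rewrite mul0r eq_shift.
by rewrite mul1r eq_shift.
Qed.

Lemma continuous_lsubmx : continuous (fun z : 'rV[R]_(d + d) => lsubmx z).
Proof.
apply: (@continuous_of_lipschitz _ _ _ _ 1) => // z t i.
have -> : (lsubmx z - lsubmx t) 0 i = (z - t) 0 (lshift d i) by rewrite !mxE.
by rewrite mul1r; exact: coord_le_norm.
Qed.

Lemma continuous_rsubmx : continuous (fun z : 'rV[R]_(d + d) => rsubmx z).
Proof.
apply: (@continuous_of_lipschitz _ _ _ _ 1) => // z t i.
have -> : (rsubmx z - rsubmx t) 0 i = (z - t) 0 (rshift d i) by rewrite !mxE.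
by rewrite mul1r; exact: coord_le_norm.
Qed.

Lemma smooth_tensor f g : smooth f -> smooth g -> smooth (tensor f g).
Proof.
move=> sf sg; apply: smoothM.
  exact: (smooth_subst lsubmx_basis continuous_lsubmx sf).
exact: (smooth_subst rsubmx_basis continuous_rsubmx sg).
Qed.

Lemma cpart_tensor i f g : smooth f -> smooth g ->
  cpart i (tensor f g) =
  if is_left i then tensor (cpart (half i) f) g else tensor f (cpart (half i) g).
Proof.
move=> sf sg.
have sl := smooth_subst lsubmx_basis continuous_lsubmx sf.
have sr := smooth_subst rsubmx_basis continuous_rsubmx sg.
have := Cl_subst lsubmx_basis continuous_lsubmx [:: i] sf.
have := Cl_subst rsubmx_basis continuous_rsubmx [:: i] sg.
rewrite /= => Er El; apply: funext => z; rewrite /tensor (cpartM i sl sr).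
rewrite Er El !big_seq1; case: (is_left i).
  change (1%:C%C * cpart (half i) f (lsubmx z) * g (rsubmx z) + f (lsubmx z) * (0%:C%C * cpart (half i) g (rsubmx z)) = cpart (half i) f (lsubmx z) * g (rsubmx z)).
  by rewrite mul0r mulr0 addr0 mul1r.
change (0%:C%C * cpart (half i) f (lsubmx z) * g (rsubmx z) + f (lsubmx z) * (1%:C%C * cpart (half i) g (rsubmx z)) = f (lsubmx z) * cpart (half i) g (rsubmx z)).
by rewrite !mul0r add0r mul1r.
Qed.

Definition lefts l : seq 'I_d := [seq half i | i <- l & is_left i].
Definition rights l : seq 'I_d := [seq half i | i <- l & ~~ is_left i].

Lemma Cl_tensor l f g : smooth f -> smooth g ->
  Cl l (tensor f g) = tensor (Cl (lefts l) f) (Cl (rights l) g).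
Proof.
move=> sf sg; elim: l => [//|i l IH].
rewrite [LHS]/= IH (cpart_tensor i (smooth_Cl _ sf) (smooth_Cl _ sg)).
by rewrite /lefts /rights /=; case: (is_left i).
Qed.

Lemma count_lefts l j : count_mem j (lefts l) = count_mem (lshift d j) l.
Proof.
elim: l => [//|i l IH]; rewrite /lefts /= -{}IH.
case: (split_ordP i) => k ->; rewrite ?is_left_lshift ?is_left_rshift /=.
  by rewrite half_lshift eq_shift.
by rewrite eq_shift.
Qed.

Lemma count_rights l j : count_mem j (rights l) = count_mem (rshift d j) l.
Proof.
elim: l => [//|i l IH]; rewrite /rights /= -{}IH.
case: (split_ordP i) => k ->; rewrite ?is_left_lshift ?is_left_rshift /=.
  by rewrite eq_shift.
by rewrite half_rshift eq_shift.
Qed.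

Lemma gs_bd_tensor h (C C' : R) f g : 0 <= h -> gs_bd s h C f -> gs_bd s h C' g ->
  gs_bd s h (C * C') (tensor f g).
Proof.
move=> h0 [sf mf] [sg mg]; split=> [|a l z]; first exact: smooth_tensor.
rewrite (Cl_tensor l sf sg) /tensor normcM.
have := ler_pM _ _ (mf (fun j => a (lshift d j)) (lefts l) (lsubmx z))
  (mg (fun j => a (rshift d j)) (rights l) (rsubmx z)).
have -> : monom z a = monom (lsubmx z) (fun j => a (lshift d j)) *
    monom (rsubmx z) (fun j => a (rshift d j)).
  rewrite /monom big_split_ord; congr (_ * _); apply: eq_bigr => j _; by rewrite mxE.
rewrite !big_split_ord /= normrM.
have -> : \prod_(j < d) gw s h (count_mem (lshift d j) l) =
    \prod_(j < d) gw s h (count_mem j (lefts l)).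
  by apply: eq_bigr => j _; rewrite count_lefts.
have -> : \prod_(j < d) gw s h (count_mem (rshift d j) l) =
    \prod_(j < d) gw s h (count_mem j (rights l)).
  by apply: eq_bigr => j _; rewrite count_rights.
move=> H; rewrite mulrACA; apply: le_trans (H _ _) _.
- by rewrite mulr_ge0 ?normc_ge0.
- by rewrite mulr_ge0 ?normc_ge0.
lra.
Qed.

End TensorBound.

Section DiagonalMap.
Variables (R : realType) (s : R).
Hypothesis hs : 1 < s.
Variable d : nat.
Implicit Types (z : 'rV[R]_(d + d)) (l : seq 'I_(d + d)).

Definition minus z : 'rV[R]_d := lsubmx z - rsubmx z.

Lemma minus_basis i (h : R) (y : 'rV[R]_(d + d)) :
  minus (h *: delta_mx 0 i + y) =
  h *: ((if is_left i then 1 else -1) *: delta_mx 0 (half i)) + minus y.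
Proof.
rewrite /minus lsubmx_basis rsubmx_basis opprD addrACA -scalerN -scalerDr -scalerBl.
by case: (is_left i); rewrite ?subr0 ?sub0r.
Qed.

Lemma continuous_minus : continuous minus.
Proof.
apply: (@continuous_of_lipschitz _ _ _ _ 2) => // z t i.
have -> : (minus z - minus t) 0 i = (z - t) 0 (lshift d i) - (z - t) 0 (rshift d i).
  by rewrite !mxE; ring.
apply: le_trans (ler_normB _ _) _.
by have := coord_le_norm (z - t) (lshift d i); have := coord_le_norm (z - t) (rshift d i); lra.
Qed.

Lemma smooth_minus (f : 'rV[R]_d -> R[i]) : smooth f -> smooth (fun z => f (minus z)).
Proof. exact: (smooth_subst minus_basis continuous_minus). Qed.

Lemma count_half l j :
  count_mem j [seq half i | i <- l] = (count_mem (lshift d j) l + count_mem (rshift d j) l)%N.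
Proof.
elim: l => [//|i l IH]; rewrite /= {}IH addnACA; congr (_ + _)%N.
case: (split_ordP i) => k ->; rewrite ?half_lshift ?half_rshift !eq_shift.
  by rewrite addn0.
by rewrite add0n.
Qed.

(** A derivative of f (x - y) is one of f, up to sign, of the sum of the orders in
    x and in y, which [gw_add] splits. *)
Lemma maj_minus h C (f : 'rV[R]_d -> R[i]) z : 0 <= h -> smooth f ->
  maj s h C f (minus z) -> maj s (2 `^ s * h) C (fun z => f (minus z)) z.
Proof.
move=> h0 sf mf l; have C0 := maj_C mf.
have a1 (i : 'I_(d + d)) : `|if is_left i then 1 else -1 : R| <= 1.
  by case: (is_left i); rewrite ?normrN normr1.
apply: le_trans (normc_Cl_subst minus_basis continuous_minus a1 l z sf) _.
apply: le_trans (mf _) _; rewrite ler_wpM2l // big_split_ord /= -big_split /=.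
apply: ler_prod => j _; rewrite gw_ge0 //= count_half; exact: gw_add.
Qed.

End DiagonalMap.

Lemma maj_pow (R : realType) (s : R) (hs : 1 < s) (n : nat) (rho A c : R)
    (E u : 'rV[R]_n -> R[i]) x j : 0 < rho -> smooth E -> smooth u ->
  maj s (2 * rho) A E x -> maj s rho c u x ->
  smooth (fun y => E y * u y ^+ j) /\
  maj s (2 * rho) (A * (2 ^+ n * c) ^+ j) (fun y => E y * u y ^+ j) x.
Proof.
move=> r0 sE su mE mu; elim: j => [|j [sF mF]].
  have -> : (fun y => E y * u y ^+ 0) = E by apply: funext => y; rewrite expr0 mulr1.
  by rewrite expr0 mulr1; split.
have -> : (fun y => E y * u y ^+ j.+1) = (fun y => (E y * u y ^+ j) * u y).
  by apply: funext => y; rewrite exprSr mulrA.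
split; first exact: smoothM.
have -> : A * (2 ^+ n * c) ^+ j.+1 = 2 ^+ n * (A * (2 ^+ n * c) ^+ j) * c.
  by rewrite exprSr; ring.
exact: maj_mul.
Qed.

(** * Approximation of tensor products *)

Section TensorFrame.
Variables (R : realType) (B : nat) (th tt : nat -> R -> R) (delta : R).
Hypothesis delta0 : 0 < delta.
Variables (d M : nat).
Implicit Types (k : {ffun 'I_d -> 'I_(cells M)}) (m j : {ffun 'I_d -> 'I_(samples B M)}).
Implicit Types (f g : 'rV[R]_d -> R[i]).

Lemma atom_tensor k1 k2 m1 m2 :
  atom tt delta (fcat k1 k2) (fcat m1 m2) = tensor (atom tt delta k1 m1) (atom tt delta k2 m2).
Proof.
apply: funext => z; rewrite /tensor /atom /mode /plateau /prodf !big_split_ord mulrACA.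
by congr ((_ * _) * (_ * _)); apply: eq_bigr => i _; rewrite ?fcat_lshift ?fcat_rshift mxE.
Qed.

Lemma kweight_fcat (s H : R) k1 k2 : kweight s H (fcat k1 k2) = kweight s H k1 * kweight s H k2.
Proof.
rewrite /kweight big_split_ord.
by congr (_ * _); apply: eq_bigr => i _; rewrite ?fcat_lshift ?fcat_rshift.
Qed.

Lemma mweight_fcat (s H : R) m1 m2 : mweight s H (fcat m1 m2) = mweight s H m1 * mweight s H m2.
Proof.
rewrite /mweight big_split_ord.
by congr (_ * _); apply: eq_bigr => i _; rewrite ?fcat_lshift ?fcat_rshift.
Qed.

Lemma approx_tensor f g :
  approx B th tt delta M (tensor f g) =
  tensor (approx B th tt delta M f) (approx B th tt delta M g).
Proof.
apply: funext => z; rewrite /tensor !(approx_kernel B th tt delta0).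
rewrite mulr_suml sum_fcat; apply: eq_bigr => k1 _.
rewrite mulr_sumr; apply: eq_bigr => k2 _.
rewrite mulr_suml sum_fcat; apply: eq_bigr => j1 _.
rewrite mulr_sumr; apply: eq_bigr => j2 _.
rewrite mulrACA big_split_ord; congr (_ * _).
  congr (f _ * g _); apply/rowP => i; rewrite !mxE ?fcat_lshift ?fcat_rshift //.
by congr (_ * _); apply: eq_bigr => i _; rewrite ?fcat_lshift ?fcat_rshift mxE.
Qed.

End TensorFrame.

Lemma approx_lin (R : realType) B th tt (delta : R) n M c (f g : 'rV[R]_n -> R[i]) : 0 < delta ->
  approx B th tt delta M (fun x => c * f x + g x) =
  (fun x => c * approx B th tt delta M f x + approx B th tt delta M g x).
Proof.
move=> delta0; apply: funext => x; rewrite !(approx_kernel B th tt delta0).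
rewrite mulr_sumr -big_split; apply: eq_bigr => k _.
rewrite mulr_sumr -big_split; apply: eq_bigr => j _.
by rewrite mulrDl mulrA.
Qed.
(** * The kernel on the frame *)

(** The form is tested at [u = b] and at [v = a] times the fourth roots of 1: the
    imaginary parts give [Y = X^*], the real parts bound [Re X] and [Im X]. *)
Lemma cauchy_schwarz (R : realType) (p q X Y : R[i]) (a b : R) : 0 < a -> 0 < b ->
  (forall u v : R[i], 0 <= u^*%C * (u * p) + u^*%C * (v * X) + (v^*%C * (u * Y) + v^*%C * (v * q))) ->
  normc p <= a ^+ 2 -> normc q <= b ^+ 2 -> normc X <= 2 * (a * b).
Proof.
move=> a0 b0 pos pa qb.
have p1 : complex.Re p <= a ^+ 2.
  by apply: le_trans (ler_norm _) (le_trans (Re_le_normc p) pa).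
have q1 : complex.Re q <= b ^+ 2.
  by apply: le_trans (ler_norm _) (le_trans (Re_le_normc q) qb).
have p2 : b ^+ 2 * complex.Re p <= b ^+ 2 * a ^+ 2 by rewrite ler_wpM2l // sqr_ge0.
have q2 : a ^+ 2 * complex.Re q <= a ^+ 2 * b ^+ 2 by rewrite ler_wpM2l // sqr_ge0.
have ab0 : 0 < a * b by rewrite mulr_gt0.
apply: (le_trans (normc_le_ReIm X)).
have h1 := pos (b%:C)%C (a%:C)%C; have h2 := pos (b%:C)%C (- (a%:C)%C).
have h3 := pos (b%:C)%C (Complex 0 a); have h4 := pos (b%:C)%C (Complex 0 (- a)).
case: p q X Y {pos pa qb p1 q1} p2 q2 h1 h2 h3 h4 => [p1 p2] [q1 q2] [x1 x2] [y1 y2] /= pa qb.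
rewrite !lecE /= => /andP[/eqP i1 r1] /andP[/eqP i2 r2] /andP[/eqP i3 r3] /andP[/eqP i4 r4].
have e1 : `|x1| <= a * b.
  rewrite -(ler_pM2l ab0) -[X in X * `|_|]gtr0_norm // -normrM ler_norml; apply/andP; split; lra.
have e2 : `|x2| <= a * b.
  rewrite -(ler_pM2l ab0) -[X in X * `|_|]gtr0_norm // -normrM ler_norml; apply/andP; split; lra.
lra.
Qed.

Section KernelBound.
Variables (R : realType) (s : R).
Hypothesis hs : 1 < s.
Variables (B : nat) (Cp hp : R) (th tt : nat -> R -> R).
Hypotheses (hp1 : 1 <= hp) (Cp0 : 0 < Cp) (P : profile s B Cp hp th tt).
Variable delta : R.
Hypothesis delta0 : 0 < delta.
Variable d : nat.
Variables (K L : ('rV[R]_(d + d) -> R[i]) -> R[i]) (chi : 'rV[R]_d -> R[i]).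
Hypotheses (GK : Gevrey_dual s K) (GL : GS_dual s L).
Hypothesis KL : restricts_to s L (mult_diff chi K).
Hypotheses (Gchi : Gevrey s chi) (chi0 : chi 0 <> 0).

Let eps : R := 2 ^- (d + d).+1.

Hypothesis chi_flat : forall w : 'rV[R]_d, (forall i, `|w 0 i| <= 2 * B%:R * delta) ->
  normc (1 - (chi 0)^-1 * chi w) <= eps.

Definition defect (z : 'rV[R]_(d + d)) : R[i] := 1 - (chi 0)^-1 * chi (minus z).

Lemma eps_gt0 : 0 < eps.
Proof. by rewrite invr_gt0 exprn_gt0. Qed.

Lemma smooth_defect : smooth defect.
Proof.
have [h [r [C [h1 r0 C0 [sc _ _]]]]] := Gevrey_bd Gchi.
have -> : defect = fun z => 1 + (- (chi 0)^-1) * chi (minus z).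
  by apply: funext => z; rewrite /defect mulNr.
apply: smoothD; first exact: smooth_cst.
by apply: smoothZ; exact: smooth_minus.
Qed.

Lemma maj_defect : exists2 rho : R, 0 < rho & exists2 Cu : R, eps <= Cu &
  forall z, maj s rho Cu defect z.
Proof.
have [h [r [C [h1 r0 C0 [sc _ mc]]]]] := Gevrey_bd Gchi.
have h0 : 0 <= h by lra.
exists (2 `^ s * h); first by rewrite mulr_gt0 ?powR_gt0 //; lra.
have e1 : eps <= 1 by rewrite invf_le1 ?exprn_gt0 // exprn_ege1 // ler1n.
exists (1 + normc (- (chi 0)^-1) * C).
  by apply: le_trans e1 _; rewrite lerDl mulr_ge0 ?normc_ge0 // ltW.
move=> z; have -> : defect = fun z => 1 + (- (chi 0)^-1) * chi (minus z).
  by apply: funext => y; rewrite /defect mulNr.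
have sm := smooth_minus sc.
apply: majD; [exact: smooth_cst|exact: smoothZ| |].
  by rewrite -(normc1 R); apply: maj_cst; rewrite mulr_ge0 ?powR_ge0.
by apply: majZ => //; apply: (maj_minus hs h0 sc); exact: mc.
Qed.

Lemma in_cell_diag M (k : {ffun 'I_d -> 'I_(cells M)}) z :
  in_cell B delta (fcat k k) z -> normc (defect z) <= eps.
Proof.
move=> ic; apply: chi_flat => i.
have := ic (lshift d i); have := ic (rshift d i); rewrite fcat_lshift fcat_rshift => h1 h2.
have -> : minus z 0 i = delta * ((z 0 (lshift d i) / delta - kval R M (k i)) -
    (z 0 (rshift d i) / delta - kval R M (k i))).
  by rewrite !mxE; field; rewrite gt_eqF.
rewrite normrM (gtr0_norm delta0) mulrC ler_wpM2r ?(ltW delta0) //.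
by apply: le_trans (ler_normB _ _) _; lra.
Qed.

Lemma Klin c f g : Gevrey s f -> Gevrey s g -> K (fun x => c * f x + g x) = c * K f + K g.
Proof. exact: GK.1. Qed.

(** On a diagonal cell the defect u is so small that multiplication by it halves
    the bounds of an atom E. Summing [K (E u^j) = L (E u^j) / chi 0 + K (E u^j.+1)]
    over j yields a bound from L alone: the remainder tends to 0, although the
    continuity constant of K on the support depends on M. *)
Lemma diagonal_bound (H : R) : 0 < H -> exists2 Q : R, 0 < Q &
  forall M (k : {ffun 'I_d -> 'I_(cells M)}) (m : {ffun 'I_(d + d) -> 'I_(samples B M)}),
    normc (K (atom tt delta (fcat k k) m)) <= Q * (kweight s H (fcat k k) * mweight s H m).
Proof.
move=> H0; have e0 := eps_gt0.
have [rho1 rho10 [Cu eCu mu]] := maj_defect.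
pose rho2 := rho1 * (Cu / eps).
have Cu0 : 0 < Cu := lt_le_trans e0 eCu.
have rho2_ge : rho1 <= rho2 by rewrite /rho2 ler_peMr ?(ltW rho10) // ler_pdivlMr // mul1r.
pose ra := atom_radius B hp delta H.
pose rho := Num.max rho2 ra.
have rho0 : 0 < rho by rewrite lt_max (lt_le_trans rho10 rho2_ge).
have r2 : rho2 <= rho by rewrite le_max lexx.
have ra_le : ra <= 2 * rho.
  have : ra <= rho by rewrite le_max lexx orbT.
  lra.
have ra0 : 0 <= ra by rewrite /ra mulr_ge0 // ltW // (radius_half_gt0 B hp1 delta0).
pose hL := Num.max (2 * rho) (delta * (B%:R + 1) * H).
have hL0 : 0 < hL by rewrite lt_max mulr_gt0.
have [cL cL0 hcL] := GS_dual_bound hs GL hL0.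
pose A0 : R := 2 ^+ (d + d) * Cp ^+ (d + d).
have A00 : 0 < A0 by rewrite mulr_gt0 ?exprn_gt0.
pose ci : R := normc (chi 0)^-1.
have ci0 : 0 < ci.
  rewrite lt_def normc_ge0 andbT; apply/eqP => /eq0_normc /eqP.
  by rewrite invr_eq0 => /eqP.
have c1 : 0 < ci * cL * A0 by apply: mulr_gt0 => //; exact: mulr_gt0.
exists (2 * (ci * cL * A0)); first by apply: mulr_gt0.
move=> M k m; set E := atom _ _ _ _.
have sE : smooth E := smooth_atom P delta (fcat k k) m.
have su := smooth_defect.
pose A := A0 * mweight s H m.
have mw0 : 0 < mweight s H m := lt_le_trans ltr01 (mweight_ge1 hs m H0).
have kw0 : 0 < kweight s H (fcat k k) := lt_le_trans ltr01 (kweight_ge1 hs (fcat k k) H0).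
have A1 : 0 < A by rewrite mulr_gt0.
pose F j (y : 'rV[R]_(d + d)) := E y * defect y ^+ j.
have halfE : 2 ^+ (d + d) * eps = 1 / 2.
  by rewrite /eps exprSr; field; rewrite expf_neq0.
have mE x : maj s (2 * rho) A E x.
  exact: (maj_le ra0 ra_le (lexx _) (maj_atom hs hp1 P delta0 (fcat k k) m x H0)).
have sF j : smooth (F j).
  exact: (maj_pow hs j rho0 sE su (mE 0) (maj_le (ltW rho10) (le_trans rho2_ge r2) (lexx _) (mu 0))).1.
have F_in j x : in_cell B delta (fcat k k) x -> maj s (2 * rho) (A * (1 / 2) ^+ j) (F j) x.
  move=> ic; rewrite -halfE; apply: (maj_pow hs j rho0 sE su (mE x) _).2.
  apply: (@maj_le _ _ _ rho2 eps) => //; first by rewrite (le_trans (ltW rho10)).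
  exact: (maj_small rho10 e0 eCu (in_cell_diag ic) (mu x)).
have F_out j x : ~ in_cell B delta (fcat k k) x -> maj s (2 * rho) 0 (F j) x.
  move=> oc; have mu' := maj_le (ltW rho10) (le_trans rho2_ge r2) (lexx _) (mu x).
  have mE0 : maj s (2 * rho) 0 E x.
    exact: (maj_le ra0 ra_le (lexx _) (atom_out hs hp1 P delta0 m H0 oc)).
  by have := (maj_pow hs j rho0 sE su mE0 mu').2; rewrite mul0r.
have Aj0 j : 0 < A * (1 / 2) ^+ j by rewrite mulr_gt0 ?exprn_gt0.
have rho20 : 0 < 2 * rho by rewrite mulr_gt0.
have gF j := cell_gevrey_bd delta0 (sF j) (ltW rho20) (ltW (Aj0 j)) (F_in j) (F_out j).
have GF j : Gevrey s (F j) := gevrey_bd_Gevrey rho20 (gF j).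
have LF j : normc (L (F j)) <= cL * (A * (1 / 2) ^+ j * kweight s H (fcat k k)).
  apply: hcL; first exact: mulr_gt0.
  exact: (cell_gs_bd hs delta0 rho20 H0 (ltW (Aj0 j)) (sF j) (F_in j) (F_out j)).
have [cK cK0 hcK] := Gevrey_dual_bound (delta * (M%:R + B%:R)) GK rho20.
have KF j : normc (K (F j)) <= cK * (A * (1 / 2) ^+ j) by apply: hcK.
pose G0 := @Gevrey0 _ s (d + d).
pose X := ci * (cL * (A * kweight s H (fcat k k))).
have chin : chi 0 != 0 by apply/eqP.
have step j : normc (K (F j)) <= X * (1 / 2) ^+ j + normc (K (F j.+1)).
  have FE z : chi (minus z) * F j z = chi 0 * F j z + (- chi 0) * F j.+1 z.
    rewrite /F exprSr /defect; field.
    by [].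
  have GcF : Gevrey s (fun z => chi (minus z) * F j z).
    have -> : (fun z => chi (minus z) * F j z) =
        (fun z => chi 0 * F j z + (fun z => (- chi 0) * F j.+1 z) z).
      by apply: funext.
    by apply: Gevrey_lin => //; apply: (scale_closed G0 (@Gevrey_lin _ s (d + d))).
  have -> : F j = (fun z => (chi 0)^-1 * (fun z => chi (minus z) * F j z) z + F j.+1 z).
    by apply: funext => z; rewrite FE; field.
  rewrite (Klin _ GcF (GF j.+1)); apply: le_trans (le_normcD _ _) _; rewrite lerD2r.
  have -> : K (fun z => chi (minus z) * F j z) = L (F j) by rewrite (KL (GF j)).
  rewrite normcM -/ci /X -mulrA ler_wpM2l ?(ltW ci0) //.
  apply: le_trans (LF j) _.
  lra.
have sum J : normc (K (F 0%N)) <= X * (2 - 2 * (1 / 2) ^+ J) + normc (K (F J)).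
  elim: J => [|J IH]; first by rewrite expr0 mulr1 subrr mulr0 add0r.
  apply: le_trans IH _; have := step J; rewrite exprSr.
  set t := (1 / 2) ^+ J => H1; have -> : X * (2 - 2 * (t * (1 / 2))) = X * (2 - 2 * t) + X * t by field.
  lra.
have -> : 2 * (ci * cL * A0) * (kweight s H (fcat k k) * mweight s H m) = X * 2.
  by rewrite /X /A; ring.
have -> : E = F 0%N by apply: funext => y; rewrite /F expr0 mulr1.
have X0 : 0 < X by apply: mulr_gt0 => //; apply: mulr_gt0 => //; exact: mulr_gt0.
apply/ler_addgt0Pr => e e0'.
have [J hJ] : exists J : nat, cK * (A * (1 / 2) ^+ J) <= e.
  have [J HJ] := geometric_small (ltW (mulr_gt0 cK0 A1)) e0'; exists J.
  by rewrite mulrA div1r exprVn.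
apply: le_trans (sum J) _; apply: lerD; last exact: le_trans (KF J) hJ.
by rewrite ler_wpM2l ?(ltW X0) // gerBl mulr_ge0 // exprn_ge0.
Qed.

Hypothesis Kpos : positive_semidefinite (Gevrey s) K.

Lemma atom_conj M (k : {ffun 'I_d -> 'I_(cells M)}) (m : {ffun 'I_d -> 'I_(samples B M)}) :
  (fun x => (atom tt delta k m x)^*%C) = atom tt delta k (mode_opp m).
Proof. by apply: funext => x; exact: atomJ. Qed.

Lemma functional4 (a1 a2 a3 a4 : R[i]) F1 F2 F3 F4 :
  Gevrey s F1 -> Gevrey s F2 -> Gevrey s F3 -> Gevrey s F4 ->
  K (fun z => a1 * F1 z + (a2 * F2 z + (a3 * F3 z + a4 * F4 z))) =
  a1 * K F1 + (a2 * K F2 + (a3 * K F3 + a4 * K F4)).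
Proof.
move=> G1 G2 G3 G4; pose G0 := @Gevrey0 _ s (d + d); pose lin := @Gevrey_lin _ s (d + d).
have G4' := scale_closed G0 lin a4 G4; have G3' := lin a3 _ _ G3 G4'.
have G2' := lin a2 _ _ G2 G3'.
by rewrite (Klin a1 G1 G2') (Klin a2 G2 G3') (Klin a3 G3 G4') (functionalZ G0 Klin).
Qed.

(** By Cauchy-Schwarz for the positive form [K (f^* (x) g)], an atom located far
    from the diagonal is bounded by two atoms located on it. *)
Lemma atom_bound (H : R) : 0 < H -> exists2 Q : R, 0 < Q &
  forall M (k : {ffun 'I_(d + d) -> 'I_(cells M)}) (m : {ffun 'I_(d + d) -> 'I_(samples B M)}),
    normc (K (atom tt delta k m)) <= Q * (kweight s H k * mweight s H m).
Proof.
move=> H0; have [Q Q0 hQ] := diagonal_bound H0.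
exists (2 * Q) => [|M k m]; first by apply: mulr_gt0.
rewrite (fcat_split k) (fcat_split m); set k1 := finfun _; set k2 := finfun _.
set m1 := finfun _; set m2 := finfun _.
pose f := atom tt delta k1 (mode_opp m1); pose g := atom tt delta k2 m2.
have cf : (fun x => (f x)^*%C) = atom tt delta k1 m1.
  apply: funext => x; rewrite /f -(atom_conj k1 m1); exact: conjcK.
have cg : (fun x => (g x)^*%C) = atom tt delta k2 (mode_opp m2) := atom_conj k2 m2.
have ga (kk : {ffun 'I_(d + d) -> 'I_(cells M)}) mm : Gevrey s (atom tt delta kk mm) :=
  atom_Gevrey hs hp1 P delta0 kk mm.
have gf : Gevrey s f := atom_Gevrey hs hp1 P delta0 _ _.
have gg : Gevrey s g := atom_Gevrey hs hp1 P delta0 _ _.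
have E11 : tensor (fun x => (f x)^*%C) f = atom tt delta (fcat k1 k1) (fcat m1 (mode_opp m1)).
  by rewrite cf atom_tensor.
have E12 : tensor (fun x => (f x)^*%C) g = atom tt delta (fcat k1 k2) (fcat m1 m2).
  by rewrite cf atom_tensor.
have E21 : tensor (fun x => (g x)^*%C) f =
    atom tt delta (fcat k2 k1) (fcat (mode_opp m2) (mode_opp m1)).
  by rewrite cg atom_tensor.
have E22 : tensor (fun x => (g x)^*%C) g = atom tt delta (fcat k2 k2) (fcat (mode_opp m2) m2).
  by rewrite cg atom_tensor.
pose a := Num.sqrt Q * (kweight s H k1 * mweight s H m1).
pose b := Num.sqrt Q * (kweight s H k2 * mweight s H m2).
have wpos n (kk : {ffun 'I_n -> 'I_(cells M)}) : 0 < kweight s H kk.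
  exact: lt_le_trans ltr01 (kweight_ge1 hs kk H0).
have mpos n (mm : {ffun 'I_n -> 'I_(samples B M)}) : 0 < mweight s H mm.
  exact: lt_le_trans ltr01 (mweight_ge1 hs mm H0).
have sQ : 0 < Num.sqrt Q by rewrite sqrtr_gt0.
have a0 : 0 < a by apply: mulr_gt0 => //; exact: mulr_gt0.
have b0 : 0 < b by apply: mulr_gt0 => //; exact: mulr_gt0.
have sQ2 : Num.sqrt Q * Num.sqrt Q = Q by rewrite -expr2 sqr_sqrtr // ltW.
have -> : 2 * Q * (kweight s H (fcat k1 k2) * mweight s H (fcat m1 m2)) = 2 * (a * b).
  by rewrite kweight_fcat mweight_fcat /a /b -{1}sQ2; ring.
rewrite -E12.
apply: (@cauchy_schwarz _ (K (tensor (fun x => (f x)^*%C) f)) (K (tensor (fun x => (g x)^*%C) g))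
  _ (K (tensor (fun x => (g x)^*%C) f)) a b a0 b0).
- move=> u v; pose w x := u * f x + v * g x.
  have gw_ : Gevrey s w.
    apply: Gevrey_lin => //; exact: (scale_closed (@Gevrey0 _ s d) (@Gevrey_lin _ s d)).
  have := Kpos gw_; rewrite /pairing /kernel_op.
  have -> : tensor (fun x => (w x)^*%C) w = (fun z =>
      (u^*%C * u) * tensor (fun x => (f x)^*%C) f z + ((u^*%C * v) * tensor (fun x => (f x)^*%C) g z +
      ((v^*%C * u) * tensor (fun x => (g x)^*%C) f z + (v^*%C * v) * tensor (fun x => (g x)^*%C) g z))).
    by apply: funext => z; rewrite /tensor /w !rmorphD !rmorphM; ring.
  rewrite functional4 ?E11 ?E12 ?E21 ?E22 //.
  by rewrite -!mulrA addrA.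
- rewrite E11; apply: le_trans (hQ _ _ _) _.
  rewrite kweight_fcat mweight_fcat mweight_opp -sQ2 /a.
  lra.
- rewrite E22; apply: le_trans (hQ _ _ _) _.
  rewrite kweight_fcat mweight_fcat mweight_opp -sQ2 /b.
  lra.
Qed.

Lemma kernel_approx_bound (h : R) : 1 <= h -> exists2 Q : R, 0 < Q &
  forall M f (C : R), 0 < C -> gs_bd s h C f -> normc (K (approx B th tt delta M f)) <= Q * C.
Proof.
move=> h1; pose H := Num.max (coef_radius s B hp delta h) 1.
have H0 : 0 < H by rewrite lt_max ltr01 orbT.
have cH : coef_radius s B hp delta h <= H by rewrite le_max lexx.
have [Q Q0 hQ] := atom_bound H0.
have cc0 := @coef_const_gt0 _ s _ Cp0 (d + d) H H0.
exists (Q * (coef_const s Cp (d + d) H * 16 ^+ (d + d))).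
  by apply: mulr_gt0 => //; apply: mulr_gt0 => //; rewrite exprn_gt0.
move=> M f C C0 gf; rewrite approx_pairs.
rewrite (functional_sum (@Gevrey0 _ s (d + d)) (@Gevrey_lin _ s (d + d)) Klin); last first.
  by move=> km; exact: (atom_Gevrey hs hp1 P delta0).
rewrite -mulrA; apply: le_trans (ler_wpM2l (ltW Q0) (coef_l1 hs hp1 Cp0 P delta0 M h1 cH H0 (ltW C0) gf)).
apply: le_trans (normc_sum _ _ _) _.
rewrite pair_bigA /= mulr_sumr; apply: ler_sum => km _.
by rewrite normcM mulrCA ler_wpM2l ?normc_ge0.
Qed.

End KernelBound.
(** * A generalized limit *)

Section GeneralizedLimit.
Variable R : realType.

Lemma ultra_cvg (U : set_system nat) (u : nat -> R) (C : R) : UltraFilter U ->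
  (forall M, `|u M| <= C) -> cvg (u @ U).
Proof.
move=> UU hu; have PU : ProperFilter U := @ultra_proper _ _ UU.
have cpt := @segment_compact R (- C) C.
have inseg : (u @ U) `[- C, C]%classic.
  change (U (u @^-1` `[- C, C]%classic)); apply: filterS filterT => M _.
  by rewrite /= in_itv /= -ler_norml; exact: hu.
have [p [_ clp]] := cpt _ _ inseg.
apply/cvg_ex; exists p => V pV.
have [//|nV] := in_ultra_setVsetC (u @^-1` V) UU.
have [y [yn yV]] := clp (~` V) V nV pV.
by case: yn.
Qed.

Definition cbounded (u : nat -> R[i]) := exists C : R, forall M, normc (u M) <= C.

(** The limit along a free ultrafilter, of real and imaginary parts. *)
Lemma generalized_limit : exists lm : (nat -> R[i]) -> R[i],
  [/\ forall (c : R[i]) u v, cbounded u -> cbounded v ->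
        lm (fun M => c * u M + v M) = c * lm u + lm v,
      forall u C, (forall M, normc (u M) <= C) -> normc (lm u) <= 2 * C,
      forall u, cbounded u -> (forall M, 0 <= u M) -> 0 <= lm u &
      forall u l, cbounded u -> (forall e : R, 0 < e -> exists M0, forall M, (M0 <= M)%N ->
        normc (u M - l) <= e) -> lm u = l].
Proof.
have [U [UU sub]] := @ultraFilterLemma nat \oo _.
have PU : ProperFilter U := @ultra_proper _ _ UU.
pose rl (u : nat -> R) := lim (u @ U).
have cre u : cbounded u -> cvg ((fun M => complex.Re (u M)) @ U).
  by move=> [C hC]; apply: (ultra_cvg (C := C)) => M; apply: le_trans (Re_le_normc _) (hC M).
have cim u : cbounded u -> cvg ((fun M => complex.Im (u M)) @ U).
  by move=> [C hC]; apply: (ultra_cvg (C := C)) => M; apply: le_trans (Im_le_normc _) (hC M).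
pose re u := rl (fun M => complex.Re (u M)); pose im u := rl (fun M => complex.Im (u M)).
have nearU (Q : nat -> Prop) : (forall M, Q M) -> \forall M \near U, Q M.
  by move=> HQ; apply: filterS filterT => M _; exact: HQ.
exists (fun u => Complex (re u) (im u)); split.
- move=> [a b] u v bu bv; have ru := cre u bu; have rv := cre v bv.
  have iu := cim u bu; have iv := cim v bv.
  apply/eqP; rewrite eq_complex; apply/andP; split; apply/eqP.
    change (re (fun M => Complex a b * u M + v M) = a * re u - b * im u + re v).
    apply: cvg_lim => //.
    have -> : (fun M => complex.Re (Complex a b * u M + v M)) =
      (fun M => a * complex.Re (u M) - b * complex.Im (u M) + complex.Re (v M)).
      by apply: funext => M; case: (u M) (v M) => [? ?] [? ?].
    by apply: cvgD => //; apply: cvgB; apply: cvgMr.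
  change (im (fun M => Complex a b * u M + v M) = a * im u + b * re u + im v).
  apply: cvg_lim => //.
  have -> : (fun M => complex.Im (Complex a b * u M + v M)) =
    (fun M => a * complex.Im (u M) + b * complex.Re (u M) + complex.Im (v M)).
    by apply: funext => M; case: (u M) (v M) => [? ?] [? ?].
  by apply: cvgD => //; apply: cvgD; apply: cvgMr.
- move=> u C hC; have bu : cbounded u by exists C.
  apply: le_trans (normc_le_ReIm _) _ => /=.
  have key (pr : R[i] -> R) : (forall z, `|pr z| <= normc z) ->
      cvg ((fun M => pr (u M)) @ U) -> `|rl (fun M => pr (u M))| <= C.
    move=> pr1 cpr; have prC M : - C <= pr (u M) <= C.
      by rewrite -ler_norml; apply: le_trans (pr1 _) (hC M).
    rewrite ler_norml; apply/andP; split; [apply: (limr_ge cpr)|apply: (limr_le cpr)];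
      by apply: nearU => M; have /andP[] := prC M.
  have := key _ (@Re_le_normc R) (cre u bu); have := key _ (@Im_le_normc R) (cim u bu).
  rewrite -/(re u) -/(im u).
  lra.
- move=> u bu u0; rewrite lecE /=; apply/andP; split.
    have -> : im u = 0.
      apply: cvg_lim => //; have -> : (fun M => complex.Im (u M)) = fun=> 0.
        by apply: funext => M; have := u0 M; rewrite lecE => /andP[/eqP].
      exact: cvg_cst.
    by [].
  apply: (limr_ge (cre u bu)); apply: nearU => M.
  by have := u0 M; rewrite lecE => /andP[].
- move=> u l bu conv.
  have key (pr : R[i] -> R) : (forall z, `|pr z| <= normc z) -> (forall z w, pr (z - w) = pr z - pr w) ->
      (fun M => pr (u M)) @ U --> pr l.
    move=> pr1 prB; apply/cvgrPdist_le => e e0.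
    have [M0 hM] := conv e e0.
    apply: sub; exists M0 => // M /= MM.
    by rewrite -prB; apply: le_trans (pr1 _) _; rewrite normcB_sym; exact: hM.
  apply/eqP; rewrite eq_complex; apply/andP; split; apply/eqP => /=.
    have kr := key _ (@Re_le_normc R) (fun z w => raddfB (@complex.Re R) z w).
    exact: (cvg_lim _ kr).
  have ki := key _ (@Im_le_normc R) (fun z w => raddfB (@complex.Im R) z w).
  exact: (cvg_lim _ ki).
Qed.

End GeneralizedLimit.

(** * Extension of the kernel *)

Lemma flat_near0 (R : realType) (s : R) (hs : 1 < s) (d : nat) (chi : 'rV[R]_d -> R[i]) (eps : R) :
  0 < eps -> Gevrey s chi -> chi 0 <> 0 ->
  exists2 eta : R, 0 < eta & forall w : 'rV[R]_d, (forall i, `|w 0 i| <= eta) ->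
    normc (1 - (chi 0)^-1 * chi w) <= eps.
Proof.
move=> e0 Gchi /eqP c0; have [h [r [C [h1 r0 C0 [sc _ mc]]]]] := Gevrey_bd Gchi.
have h0 : 0 < h by lra.
pose A := C * gw s h 1 ^+ d.
have lip i z : normc (cpart i chi z) <= A.
  have := mc z [:: i]; move/le_trans; apply.
  rewrite ler_wpM2l ?(ltW C0) // -[X in _ ^+ X](card_ord d) -prodr_const; apply: ler_prod => j _.
  rewrite gw_ge0 ?(ltW h0) //=.
  by apply: gw_leS => //; rewrite addn0; case: (i == j).
have ci0 : 0 < normc (chi 0)^-1.
  rewrite lt_def normc_ge0 andbT; apply/eqP => /eq0_normc /eqP.
  by rewrite invr_eq0 (negbTE c0).
have A0 : 0 < A by rewrite mulr_gt0 ?exprn_gt0 ?gw_gt0.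
pose D := normc (chi 0)^-1 * (2 * A * (d%:R + 1)).
have D0 : 0 < D by apply: mulr_gt0 => //; apply: mulr_gt0; [exact: mulr_gt0|rewrite ltr_wpDl].
exists (eps / D); first exact: divr_gt0.
move=> w hw.
have -> : 1 - (chi 0)^-1 * chi w = (chi 0)^-1 * (chi 0 - chi w).
  by rewrite mulrBr mulVf.
rewrite normcM.
have := lipschitz_of_partials 0 w sc lip => H.
have S : \sum_(i < d) `|(0 : 'rV[R]_d) 0 i - w 0 i| <= (d%:R + 1) * (eps / D).
  apply: (@le_trans _ _ (\sum_(i < d) (eps / D))).
    by apply: ler_sum => i _; rewrite mxE sub0r normrN.
  by rewrite sumr_const card_ord mulrDl mul1r -[X in X <= _]mulr_natl lerDl divr_ge0 // ltW.
have A2 : 0 <= 2 * A by rewrite mulr_ge0 // ltW.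
apply: (@le_trans _ _ (normc (chi 0)^-1 * (2 * A * ((d%:R + 1) * (eps / D))))).
  rewrite ler_wpM2l ?(ltW ci0) //; apply: le_trans H _; exact: ler_wpM2l.
rewrite [X in X <= _](_ : _ = D * (eps / D)); last by rewrite /D; ring.
by rewrite mulrCA mulfV ?mulr1 // gt_eqF.
Qed.

(** On a point both spaces consist of all the functions, with equivalent norms. *)
Lemma extension0 (R : realType) (s : R) (hs : 1 < s) (K : ('rV[R]_(0 + 0) -> R[i]) -> R[i]) :
  Gevrey_dual_psd (d := 0) s K -> GS_dual_psd (d := 0) s K.
Proof.
have bd h C (f : 'rV[R]_0 -> R[i]) : gs_bd s h C f -> gevrey_bd s h 1 C f.
  move=> [sf mf]; split=> [//|x [[]]//|x l].
  have := mf (fun=> 0%N) l x; rewrite /monom !big_ord0 normr1 mul1r mulr1.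
  by [].
have GSG (f : 'rV[R]_0 -> R[i]) : GS s f -> Gevrey s f.
  move=> /GS_bd[h [C [h1 C0 gf]]]; apply: (gevrey_bd_Gevrey _ (bd _ _ _ gf)); lra.
move=> [GK Kpos]; split.
  apply: (GS_dual_of_bound hs) => [c f g Gf Gg|h h1]; first by apply: GK.1; exact: GSG.
  have h0 : 0 < h by lra.
  have [c c0 hc] := Gevrey_dual_bound 1 GK h0.
  by exists c => // f C C0 gf; apply: hc => //; exact: bd.
by move=> f Gf; apply: Kpos; exact: GSG.
Qed.

Section Extension.
Variables (R : realType) (s : R).
Hypothesis hs : 1 < s.
Variable d : nat.
Variables (K : ('rV[R]_(d + d) -> R[i]) -> R[i]) (chi : 'rV[R]_d -> R[i]).
Hypothesis hK : Gevrey_dual_psd s K.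
Hypotheses (Gchi : Gevrey s chi) (chi0 : chi 0 <> 0).
Hypothesis hKchi : in_GS_dual s (mult_diff chi K).

(** The generalized limit of the values of K on the approximations of f is linear
    and bounded in f; it is [K f] if f is a Gevrey function, since then the
    approximations converge, and it is positive since approximation commutes with
    conjugation and tensor products. *)
Lemma extension (B : nat) (Cp hp : R) (th tt : nat -> R -> R) (delta : R) :
  1 <= hp -> 0 < Cp -> profile s B Cp hp th tt -> 0 < delta ->
  (forall h : R, 1 <= h -> exists2 Q : R, 0 < Q & forall M f (C : R), 0 < C -> gs_bd s h C f ->
     normc (K (approx B th tt delta M f)) <= Q * C) ->
  exists L : ('rV[R]_(d + d) -> R[i]) -> R[i], GS_dual_psd s L /\ restricts_to s L K.
Proof.
move=> hp1 Cp0 P delta0 bnd; have [GK Kpos] := hK.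
have [lm [lmlin lmbd lmpos lmcvg]] := generalized_limit R.
pose ap M (f : 'rV[R]_(d + d) -> R[i]) := approx B th tt delta M f.
have Gap M f : Gevrey s (ap M f) := approx_Gevrey hs hp1 P delta0 M f.
have bd f : GS s f -> cbounded (fun M => K (ap M f)).
  move=> /GS_bd[h [C [h1 C0 gf]]]; have [Q Q0 hQ] := bnd h h1.
  by exists (Q * C) => M; exact: hQ.
exists (fun f => lm (fun M => K (ap M f))); split; last first.
  move=> f Gf; apply: lmcvg; first exact: bd (Gevrey_GS hs Gf).
  have [h [r [C [h1 r0 C0 gf]]]] := Gevrey_bd Gf.
  have [h' [r' [h'1 conv]]] := approx_converges hs hp1 Cp0 P delta0 h1 r0 (ltW C0) gf.
  have h'0 : 0 < h' by lra.
  have [c c0 hc] := Gevrey_dual_bound r' GK h'0.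
  move=> e e0; have ec : 0 < e / c by rewrite divr_gt0.
  have [M0 hM] := conv _ ec; exists M0 => M MM.
  have -> : K (ap M f) - K f = K (fun x => ap M f x - f x).
    have -> : (fun x => ap M f x - f x) = (fun x => (-1) * f x + ap M f x).
      by apply: funext => x; rewrite mulN1r addrC.
    have Kl := GK.1 (-1) f (ap M f) Gf (Gap M f).
    by rewrite [RHS]Kl mulN1r addrC.
  have := hc _ _ ec (hM M MM).
  by rewrite (_ : c * (e / c) = e) //; field; rewrite gt_eqF.
split.
  apply: (GS_dual_of_bound hs) => [c f g Gf Gg|h h1].
    rewrite -lmlin; [|exact: bd..]; congr lm; apply: funext => M.
    rewrite /ap (approx_lin _ _ _ _ _ _ _ delta0).
    exact: (GK.1 c _ _ (Gap M f) (Gap M g)).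
  have [Q Q0 hQ] := bnd h h1; exists (2 * Q) => [|f C C0 gf]; first by apply: mulr_gt0.
  by rewrite -mulrA; apply: lmbd => M; exact: hQ.
move=> f Gf; rewrite /pairing /kernel_op.
have Gt : GS s (tensor (fun x => (f x)^*%C) f).
  have [h [C [h1 C0 [sf mf]]]] := GS_bd Gf.
  have h0 : 0 < h by lra.
  apply: (gs_bd_GS h0 (gs_bd_tensor (ltW h0) (C := C) _ (conj sf mf))).
  by split=> [|a l x]; [exact: smoothJ|rewrite (ClJ l sf) normcJc].
apply: lmpos; first exact: bd.
move=> M; rewrite /ap (approx_tensor _ _ _ delta0) (approxJ _ _ _ delta0).
exact: Kpos (approx_Gevrey hs hp1 P delta0 M f).
Qed.

Lemma extension_pos : 'I_d ->
  exists L : ('rV[R]_(d + d) -> R[i]) -> R[i], GS_dual_psd s L /\ restricts_to s L K.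
Proof.
move=> i0; have [GK Kpos] := hK; have [L GL KL] := hKchi.
have [B [Cp [hp [th [tt [hp1 Cp0 P]]]]]] := profile_exists hs i0 Gchi chi0.
have e0 : 0 < (2 ^- (d + d).+1 : R) by rewrite invr_gt0 exprn_gt0.
have [eta eta0 flat] := flat_near0 hs e0 Gchi chi0.
pose delta := eta / (2 * B%:R + 1).
have B0 : 0 < 2 * B%:R + 1 :> R by rewrite ltr_wpDl // mulr_ge0.
have delta0 : 0 < delta by rewrite divr_gt0.
apply: (extension hp1 Cp0 P delta0) => h h1.
apply: (kernel_approx_bound hs hp1 Cp0 P delta0 GK GL KL Gchi chi0) => // w hw.
apply: flat => i; apply: le_trans (hw i) _.
rewrite /delta mulrA ler_pdivrMr // mulrC ler_wpM2l ?(ltW eta0) //; lra.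
Qed.

End Extension.

Theorem theorem3p1 (R : realType) (d : nat) (s : R) (hs : 1 < s)
    (K : ('rV[R]_(d + d) -> R[i]) -> R[i])
    (hK : Gevrey_dual_psd s K)
    (hchi : exists chi : 'rV[R]_d -> R[i],
        [/\ Gevrey s chi, chi 0 <> 0 & in_GS_dual s (mult_diff chi K)]) :
  exists L : ('rV[R]_(d + d) -> R[i]) -> R[i],
    GS_dual_psd s L /\ restricts_to s L K.
Proof.
case: hchi => chi [Gchi chi0 hKchi].
case: d => [|d'] in K hK chi Gchi chi0 hKchi *.
  by exists K; split; first exact: extension0.
exact: (extension_pos hs hK Gchi chi0 hKchi ord0).
Qed.
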